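(* Let $d\ge2$ and let $(H,\mathbb Y,\mathbf 1)$ be a $d$-CC system. There exists a unique linear map $Y(-,x):H\otimes H\to H((x_1,\dots,x_d,|x|^{\mathbb R}))$, $a\otimes b\mapsto Y(a,x)b$, such that for any $u\in H_{\Delta_0}^*$, $a\in H_{\Delta_1}$, $b\in H_{\Delta_2}$ one has $$\langle u,Y(a,x)b\rangle\in|x|^{\Delta_0-\Delta_1-\Delta_2}\,\mathbb C\Big[\frac{x_1}{|x|},\dots,\frac{x_d}{|x|}\Big]$$ and $Y(a,x)b=\mathbb Y_{(x,0)}(a,b)$ holds (after pairing with elements of $H^\vee$) as real analytic functions of $x\in\mathbb R^d\setminus\{0\}$. Furthermore, $Y(-,x)$ is a conformally covariant vertex operator, and it satisfies $$\mathbb Y_{(x^{(1)},x^{(2)})}(a,b)=\exp\Big(\sum_\rho x^{(2)}_\rho P_\rho\Big)Y(a,x)b\Big|_{x=x^{(1)}-x^{(2)}}$$ for all $a,b\in H$ and $(x^{(1)},x^{(2)})\in\mathrm{Conf}_2(\mathbb R^d)$.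
   Context: **Lie algebra.** Fix an integer $d\ge2$. $\mathfrak{so}(d+1,1)$ is the real Lie algebra with basis $D$, $P_\mu,K_\mu$ ($1\le\mu\le d$), $J_{\mu,\nu}$ ($1\le\mu<\nu\le d$), with $J_{\nu,\mu}=-J_{\mu,\nu}$ and brackets $[P_\mu,P_\nu]=[K_\mu,K_\nu]=0$, $[D,K_\mu]=-K_\mu$, $[D,P_\mu]=P_\mu$, $[D,J_{\mu,\nu}]=0$, $[P_\mu,K_\nu]=-2(\delta_{\mu,\nu}D+J_{\mu,\nu})$, $[J_{\mu,\nu},P_\rho]=-\delta_{\mu,\rho}P_\nu+\delta_{\nu,\rho}P_\mu$, $[J_{\mu,\nu},K_\rho]=-\delta_{\mu,\rho}K_\nu+\delta_{\nu,\rho}K_\mu$, $[J_{\mu,\nu},J_{\rho,\sigma}]=\delta_{\nu,\rho}J_{\mu,\sigma}-\delta_{\mu,\rho}J_{\nu,\sigma}-\delta_{\nu,\sigma}J_{\mu,\rho}+\delta_{\mu,\sigma}J_{\nu,\rho}$. For $X\in\mathfrak{so}(d+1,1)$ put $\tau_x(X)=\exp(-\sum_\rho x_\rho\,\mathrm{ad}P_\rho)X$ (a finite sum, polynomial in $x$). **Compact modules.** A (complex) $\mathfrak{so}(d+1,1)$-module $H$ is compact if (C1) $H=\bigoplus_{\Delta\in\mathbb R}H_\Delta$ with $H_\Delta=\{a: Da=\Delta a\}$; (C2) $\sum_{\Delta\le M}\dim H_\Delta<\infty$ for all $M\in\mathbb R$; (C3) the action of $\mathfrak{so}(d)=\langle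 J_{\mu,\nu}\rangle$ on each $H_\Delta$ exponentiates to $\mathrm{SO}(d)$. Put $\overline H=\prod_\Delta H_\Delta$ (with componentwise action), $H^\vee=\bigoplus_\Delta H_\Delta^*$, $\langle-,-\rangle$ the pairing of $H^\vee$ with $\overline H$, $\mathrm{pr}_\Delta:\overline H\to H_\Delta$ the projection. **$d$-CC systems.** $\mathrm{Conf}_n(\mathbb R^d)=\{(x^{(1)},\dots,x^{(n)})\in(\mathbb R^d)^n: x^{(i)}\ne x^{(j)}\text{ for }i\neq j\}$. For $n,m\ge1$, $U_{n,m}$ is the set of $((x^{(1)},\dots,x^{(n)},w),(y^{(1)},\dots,y^{(m)}))\in\mathrm{Conf}_{n+1}(\mathbb R^d)\times\mathrm{Conf}_m(\mathbb R^d)$ with $\min_k|x^{(k)}-w|>\max_l|y^{(l)}|$; $U_{0,m}=\mathrm{Conf}_1(\mathbb R^d)\times\mathrm{Conf}_m(\mathbb R^d)$. A $d$-CC system $(H,\mathbb Y,\mathbf 1)$ is a compact $\mathfrak{so}(d+1,1)$-module $H$, maps $\mathbb Y:\mathrm{Conf}_n(\mathbb R^d)\to\mathrm{Hom}_{\mathbb C}(H^{\otimes n},\overline H)$, $x_{[n]}\mapsto\mathbb Y_{x_{[n]}}$ ($n\ge1$), and $\mathbf 1\in H_0$ such that: (unit) $\mathbb Y_{(0)}(a)=a$; (analyticity) $x_{[n]}\mapsto\langle u,\mathbb Y_{x_{[n]}}(a_1,\dots,a_n)\rangle$ is real analytic on $\mathrm{Conf}_n(\mathbb R^d)$ for all $u\in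 H^\vee$, $a_i\in H$; (permutation invariance) $\mathbb Y_{(x^{(1)},\dots,x^{(n)})}(a_1,\dots,a_n)=\mathbb Y_{(x^{(\sigma1)},\dots,x^{(\sigma n)})}(a_{\sigma1},\dots,a_{\sigma n})$ for $\sigma\in S_n$; (vacuum) $\mathbb Y_{(x^{(1)},\dots,x^{(n+1)})}(a_1,\dots,a_n,\mathbf 1)=\mathbb Y_{(x^{(1)},\dots,x^{(n)})}(a_1,\dots,a_n)$ for $n\ge1$; (invariance of vacuum) $X\mathbf 1=0$ for all $X\in\mathfrak{so}(d+1,1)$; (translation invariance) $\mathbb Y_{x_{[n]}}(a_1,\dots,P_\mu a_p,\dots,a_n)=\frac{d}{dx^{(p)}_\mu}\mathbb Y_{x_{[n]}}(a_1,\dots,a_n)$ for all $p,\mu$; (conformal covariance) $X\,\mathbb Y_{x_{[n]}}(a_1,\dots,a_n)=\sum_{q=1}^n\mathbb Y_{x_{[n]}}(a_1,\dots,\tau_{x^{(q)}}(X)a_q,\dots,a_n)$ for all $X\in\mathfrak{so}(d+1,1)$; (strong cluster decomposition) for $n\ge0,m\ge1$, $a_i\in H$, $u\in H^\vee$, the series $\sum_{\Delta}\langle u,\mathbb Y_{(x^{(1)},\dots,x^{(n)},w)}(a_1,\dots,a_n,\mathrm{pr}_\Delta\mathbb Y_{(y^{(1)},\dots,y^{(m)})}(a_{n+1},\dots,a_{n+m}))\rangle$ converges absolutely on $U_{n,m}$, and its partial sums over $\Delta<M$ converge as $M\to\infty$, uniformly on compact subsets of $U_{n,m}$, to $\langle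 u,\mathbb Y_{(x^{(1)},\dots,x^{(n)},w+y^{(1)},\dots,w+y^{(m)})}(a_1,\dots,a_{n+m})\rangle$. **Spherical Laurent series.** $\mathbb R[x_1,\dots,x_d,|x|^{\mathbb R}]$ is the quotient of $\mathbb R[x_1,\dots,x_d]\otimes\mathbb R[t^{\mathbb R}]$ (group algebra of $(\mathbb R,+)$) by $x_1^2+\dots+x_d^2-t^2$, with $t=|x|$, graded by $\deg x_\mu=1$, $\deg|x|^r=r$, with $\partial_\mu(P|x|^r)=(\partial_\mu P)|x|^r+rx_\mu P|x|^{r-2}$. $H[x_1,\dots,x_d,|x|^{\mathbb R}]_\lambda=H\otimes\mathbb R[x_1,\dots,x_d,|x|^{\mathbb R}]_\lambda$, $H[[x_1,\dots,x_d,|x|^{\mathbb R}]]=\prod_\lambda H[x_1,\dots,x_d,|x|^{\mathbb R}]_\lambda$, and $H((x_1,\dots,x_d,|x|^{\mathbb R}))$ consists of those $(f_\lambda)$ with $\{\lambda<M:f_\lambda\ne0\}$ finite for all $M\in\mathbb R$. Elements $P(x)|x|^r$ are also regarded as real analytic functions on $\mathbb R^d\setminus\{0\}$. **Conformally covariant vertex operator.** A linear map $Y(-,x):H\otimes H\to H((x_1,\dots,x_d,|x|^{\mathbb R}))$ is called a conformally covariant vertex operator if $Y(P_\mu a,x)b=\frac{d}{dx_\mu}Y(a,x)b$ for all $\mu$ and $A\,Y(a,x)b=Y(a,x)Ab+Y(\tau_x(A)a,x)b$ for all $A\in\mathfrak{so}(d+1,1)$, $a,b\in H$ (here $A$ acts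 on coefficients). *)

(* Defs.v *)
From HB Require Import structures.
From mathcomp Require Import all_boot all_order all_algebra.
From mathcomp Require Import perm generic_quotient ring_quotient.
From mathcomp Require Import finmap complex.
From mathcomp Require Import all_classical all_reals all_analysis.

Set Implicit Arguments.
Unset Strict Implicit.
Unset Printing Implicit Defensive.

Import Order.TTheory GRing.Theory Num.Theory.
Import numFieldNormedType.Exports.

Local Open Scope classical_set_scope.
Local Open Scope ring_scope.
Local Open Scope complex_scope.
Local Open Scope quotient_scope.

(* Labels of the basis: D, then the P_mu, the K_mu, and the J_{mu,nu} with
   mu < nu. *)
Definition so_basis (d : nat) : Type :=
  (unit + 'I_d + 'I_d + {p : 'I_d * 'I_d | (p.1 < p.2)%N})%type.
HB.instance Definition _ d := Finite.on (so_basis d).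

Definition bD d : so_basis d := inl (inl (inl tt)).
Definition bP d (mu : 'I_d) : so_basis d := inl (inl (inr mu)).
Definition bK d (mu : 'I_d) : so_basis d := inl (inr mu).

Definition so (R : realType) (d : nat) : Type := {ffun so_basis d -> R^o}.
HB.instance Definition _ R d := GRing.Lmodule.on (so R d).

HB.lock Definition so_e (R : realType) (d : nat) (i : so_basis d) : so R d :=
  [ffun j => (j == i)%:R].
Definition so_D R d : so R d := so_e R (bD d).
Definition so_P R d (mu : 'I_d) : so R d := so_e R (bP mu).
Definition so_K R d (mu : 'I_d) : so R d := so_e R (bK mu).

(* J_{mu,nu} for arbitrary indices, so that J_{nu,mu} = - J_{mu,nu}. *)
HB.lock Definition so_J (R : realType) (d : nat) (mu nu : 'I_d) : so R d :=
  [ffun j => if j is inr p then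
     (val p == (mu, nu))%:R - (val p == (nu, mu))%:R else 0].

Section Bracket.
Variables (R : realType) (d : nat).
Local Notation so := (so R d).
Local Notation so_D := (so_D R d).
Local Notation so_P := (@so_P R d).
Local Notation so_K := (@so_K R d).
Local Notation so_J := (@so_J R d).

Definition kron (mu nu : 'I_d) : R := (mu == nu)%:R.

Definition brPK (mu nu : 'I_d) : so :=
  - 2%:R *: (kron mu nu *: so_D + so_J mu nu).
Definition brJP (mu nu rho : 'I_d) : so :=
  - kron mu rho *: so_P nu + kron nu rho *: so_P mu.
Definition brJK (mu nu rho : 'I_d) : so :=
  - kron mu rho *: so_K nu + kron nu rho *: so_K mu.
Definition brJJ (mu nu rho sigma : 'I_d) : so :=
  kron nu rho *: so_J mu sigma - kron mu rho *: so_J nu sigma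
  - kron nu sigma *: so_J mu rho + kron mu sigma *: so_J nu rho.

Definition br_basis (i j : so_basis d) : so :=
  match i, j with
  | inl (inl (inl _)), inl (inl (inl _)) => 0
  | inl (inl (inl _)), inl (inl (inr nu)) => so_P nu
  | inl (inl (inl _)), inl (inr nu) => - so_K nu
  | inl (inl (inl _)), inr _ => 0
  | inl (inl (inr mu)), inl (inl (inl _)) => - so_P mu
  | inl (inl (inr _)), inl (inl (inr _)) => 0
  | inl (inl (inr mu)), inl (inr nu) => brPK mu nu
  | inl (inl (inr rho)), inr p => - brJP (val p).1 (val p).2 rho
  | inl (inr mu), inl (inl (inl _)) => so_K mu
  | inl (inr mu), inl (inl (inr nu)) => - brPK nu mu
  | inl (inr _), inl (inr _) => 0
  | inl (inr rho), inr p => - brJK (val p).1 (val p).2 rho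
  | inr _, inl (inl (inl _)) => 0
  | inr p, inl (inl (inr rho)) => brJP (val p).1 (val p).2 rho
  | inr p, inl (inr rho) => brJK (val p).1 (val p).2 rho
  | inr p, inr q => brJJ (val p).1 (val p).2 (val q).1 (val q).2
  end.

End Bracket.

HB.lock Definition br {R : realType} {d} (X Y : so R d) : so R d :=
  \sum_i \sum_j (X i * Y j) *: br_basis R i j.

Section LieAlgebraTheory.
Variables (R : realType) (d : nat).
Local Notation so := (so R d).
Local Notation so_basis := (so_basis d).
Local Notation so_D := (so_D R d).
Local Notation so_P := (@so_P R d).
Local Notation so_K := (@so_K R d).
Local Notation so_J := (@so_J R d).
Local Notation so_e := (@so_e R d).
Local Notation brJP := (@brJP R d).
Local Notation brJK := (@brJK R d).
Local Notation brJJ := (@brJJ R d).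
Local Notation kron := (@kron R d).
Implicit Types X Y Z : so.

Definition adPs (s : seq 'I_d) (X : so) : so :=
  foldr (fun rho Z => br (so_P rho) Z) X s.

(* tau_x(X) = exp(- sum_rho x_rho ad P_rho) X, with the k-th power of
   sum_rho x_rho ad P_rho expanded over k-tuples of indices.  The terms with
   k >= 3 vanish by adPs_eq0 below. *)
Definition tau (x : 'rV[R]_d) (X : so) : so :=
  \sum_(k < 3) \sum_(s : k.-tuple 'I_d)
    ((-1) ^+ k / k`!%:R * \prod_(rho <- s) x 0 rho) *: adPs s X.

Lemma so_eE i j : so_e i j = (j == i)%:R.
Proof. by rewrite so_e.unlock ffunE. Qed.

Lemma so_J_anti mu nu : so_J nu mu = - so_J mu nu.
Proof. by apply/ffunP => -[?|p]; rewrite so_J.unlock !ffunE ?oppr0 ?opprB. Qed.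

Lemma so_J_basis (p : {p : 'I_d * 'I_d | (p.1 < p.2)%N}) :
  so_J (val p).1 (val p).2 = so_e (inr p).
Proof.
apply/ffunP => -[j|q]; rewrite so_J.unlock so_e.unlock !ffunE //.
case: p q => -[m n] /= mn [[m' n'] /= mn'].
have -> : (inr (exist _ (m', n') mn') == inr (exist _ (m, n) mn) :> so_basis)
    = ((m', n') == (m, n)) by [].
have -> : ((m', n') == (n, m)) = false; last by rewrite subr0.
apply/negP => /eqP[e1 e2]; move: mn mn'; rewrite e1 e2 => h1 h2.
by have := ltn_trans h1 h2; rewrite ltnn.
Qed.

Lemma so_ind (Q : so -> Prop) : Q 0 ->
  (forall r X Y, Q X -> Q Y -> Q (r *: X + Y)) ->
  Q so_D -> (forall mu, Q (so_P mu)) -> (forall mu, Q (so_K mu)) ->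
  (forall mu nu, Q (so_J mu nu)) -> forall X, Q X.
Proof.
move=> Q0 QZD QD QP QK QJ X.
have -> : X = \sum_i X i *: so_e i.
  apply/ffunP => j; rewrite so_e.unlock sum_ffunE (bigD1 j) //= big1 ?addr0 => [|i ij].
    by rewrite !ffunE eqxx; exact: esym (mulr1 _).
  rewrite !ffunE eq_sym (negbTE ij); exact: mulr0.
elim: (index_enum _) => [|i r IH]; first by rewrite big_nil.
rewrite big_cons; apply: QZD IH.
case: i => [[[[]|mu]|mu]|p]; [exact: QD|exact: QP|exact: QK|].
by rewrite -so_J_basis; apply: QJ.
Qed.

Lemma brZDl Z r X Y : br (r *: X + Y) Z = r *: br X Z + br Y Z.
Proof.
rewrite br.unlock scaler_sumr -big_split /=; apply: eq_bigr => i _.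
rewrite scaler_sumr -big_split /=; apply: eq_bigr => j _.
by rewrite !ffunE scalerA mulrA -scalerDl -mulrDl.
Qed.

Lemma brZDr Z r X Y : br Z (r *: X + Y) = r *: br Z X + br Z Y.
Proof.
rewrite br.unlock scaler_sumr -big_split /=; apply: eq_bigr => i _.
rewrite scaler_sumr -big_split /=; apply: eq_bigr => j _.
rewrite !ffunE scalerA mulrCA -scalerDl -mulrDr.
by rewrite [_ *: X j]/(_ * _).
Qed.

Lemma br_e i j : br (so_e i) (so_e j) = br_basis R i j.
Proof.
have h1 k : k != i -> \sum_l (so_e i k * so_e j l) *: br_basis R k l = 0.
  by move=> ki; rewrite big1 // => l _; rewrite so_eE (negbTE ki) mul0r scale0r.
have h2 l : l != j -> (so_e i i * so_e j l) *: br_basis R i l = 0.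
  by move=> lj; rewrite [so_e j l]so_eE (negbTE lj) mulr0 scale0r.
rewrite br.unlock (bigD1 i) //= [X in _ + X]big1 // addr0.
rewrite (bigD1 j) //= [X in _ + X]big1 // addr0.
by rewrite !so_eE !eqxx mulr1 scale1r.
Qed.

Lemma br0l X : br 0 X = 0.
Proof. by have := brZDl X (-1) 0 0; rewrite scaler0 addr0 scaleN1r addNr. Qed.
Lemma br0r X : br X 0 = 0.
Proof. by have := brZDr X (-1) 0 0; rewrite scaler0 addr0 scaleN1r addNr. Qed.
Lemma brDl X Y Z : br (X + Y) Z = br X Z + br Y Z.
Proof. by have := brZDl Z 1 X Y; rewrite !scale1r. Qed.
Lemma brDr X Y Z : br Z (X + Y) = br Z X + br Z Y.
Proof. by have := brZDr Z 1 X Y; rewrite !scale1r. Qed.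
Lemma brZl r X Z : br (r *: X) Z = r *: br X Z.
Proof. by have := brZDl Z r X 0; rewrite br0l !addr0. Qed.
Lemma brZr r X Z : br Z (r *: X) = r *: br Z X.
Proof. by have := brZDr Z r X 0; rewrite br0r !addr0. Qed.
Lemma brNl X Z : br (- X) Z = - br X Z.
Proof. by rewrite -scaleN1r brZl scaleN1r. Qed.
Lemma brNr X Z : br Z (- X) = - br Z X.
Proof. by rewrite -scaleN1r brZr scaleN1r. Qed.

Lemma so_J_diag mu : so_J mu mu = 0.
Proof. by apply/ffunP => -[?|p]; rewrite so_J.unlock !ffunE ?subrr. Qed.

Lemma so_J_case (Q : 'I_d -> 'I_d -> Prop) :
  (forall p : {p : 'I_d * 'I_d | (p.1 < p.2)%N}, Q (val p).1 (val p).2) ->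
  (forall mu nu, Q mu nu -> Q nu mu) -> (forall mu, Q mu mu) ->
  forall mu nu, Q mu nu.
Proof.
move=> Qp Qs Qd mu nu; case: (ltngtP mu nu) => [lt|lt|/val_inj ->//].
- exact: (Qp (exist _ (mu, nu) lt)).
- by apply: Qs; exact: (Qp (exist _ (nu, mu) lt)).
Qed.

Lemma br_PP mu nu : br (so_P mu) (so_P nu) = 0.
Proof. by rewrite br_e. Qed.
Lemma br_KK mu nu : br (so_K mu) (so_K nu) = 0.
Proof. by rewrite br_e. Qed.
Lemma br_DK mu : br so_D (so_K mu) = - so_K mu.
Proof. by rewrite br_e. Qed.
Lemma br_DP mu : br so_D (so_P mu) = so_P mu.
Proof. by rewrite br_e. Qed.
Lemma br_PD mu : br (so_P mu) so_D = - so_P mu.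
Proof. by rewrite br_e. Qed.
Lemma br_DJ mu nu : br so_D (so_J mu nu) = 0.
Proof.
move: mu nu; apply: so_J_case => [p|mu nu h|mu]; idtac.
    rewrite so_J_basis. rewrite br_e. cbv beta iota delta [br_basis bD bP bK]. exact: erefl.
- by rewrite so_J_anti brNr h oppr0.
- by rewrite so_J_diag br0r.
Qed.
Lemma br_PK mu nu : br (so_P mu) (so_K nu) =
  - 2%:R *: ((mu == nu)%:R *: so_D + so_J mu nu).
Proof. by rewrite br_e. Qed.

Lemma brJP_anti mu nu rho : brJP nu mu rho = - brJP mu nu rho.
Proof. by rewrite /brJP !scaleNr opprD opprK addrC. Qed.
Lemma brJK_anti mu nu rho : brJK nu mu rho = - brJK mu nu rho.
Proof. by rewrite /brJK !scaleNr opprD opprK addrC. Qed.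

Lemma br_JP mu nu rho : br (so_J mu nu) (so_P rho) =
  - (mu == rho)%:R *: so_P nu + (nu == rho)%:R *: so_P mu.
Proof.
rewrite -/(kron mu rho) -/(kron nu rho) -/(brJP mu nu rho).
move: mu nu; apply: so_J_case => [p|mu nu h|mu]; idtac.
    rewrite so_J_basis. rewrite br_e. cbv beta iota delta [br_basis bD bP bK]. exact: erefl.
- rewrite brJP_anti so_J_anti brNl h; exact: erefl.
- by rewrite so_J_diag br0l /brJP scaleNr addNr.
Qed.
Lemma br_PJ mu nu rho : br (so_P rho) (so_J mu nu) = - brJP mu nu rho.
Proof.
move: mu nu; apply: so_J_case => [p|mu nu h|mu]; idtac.
    rewrite so_J_basis. rewrite br_e. cbv beta iota delta [br_basis bD bP bK]. exact: erefl.
- rewrite brJP_anti so_J_anti brNr h; exact: erefl.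
- by rewrite so_J_diag br0r /brJP scaleNr addNr oppr0.
Qed.
Lemma br_JK mu nu rho : br (so_J mu nu) (so_K rho) =
  - (mu == rho)%:R *: so_K nu + (nu == rho)%:R *: so_K mu.
Proof.
rewrite -/(kron mu rho) -/(kron nu rho) -/(brJK mu nu rho).
move: mu nu; apply: so_J_case => [p|mu nu h|mu]; idtac.
    rewrite so_J_basis. rewrite br_e. cbv beta iota delta [br_basis bD bP bK]. exact: erefl.
- rewrite brJK_anti so_J_anti brNl h; exact: erefl.
- by rewrite so_J_diag br0l /brJK scaleNr addNr.
Qed.

Lemma brJJ_antil mu nu rho sigma : brJJ nu mu rho sigma = - brJJ mu nu rho sigma.
Proof.
have E (a b c e : so) : b - a - e + c = - (a - b - c + e).
  by rewrite !opprD !opprK [b - a]addrC addrAC.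
exact: E.
Qed.
Lemma brJJ_antir mu nu rho sigma : brJJ mu nu sigma rho = - brJJ mu nu rho sigma.
Proof.
have E (a b c e : so) : c - e - a + b = - (a - b - c + e).
  by rewrite !opprD !opprK -addrA addrC addrA.
exact: E.
Qed.
Lemma br_JJ mu nu rho sigma : br (so_J mu nu) (so_J rho sigma) =
  (nu == rho)%:R *: so_J mu sigma - (mu == rho)%:R *: so_J nu sigma
  - (nu == sigma)%:R *: so_J mu rho + (mu == sigma)%:R *: so_J nu rho.
Proof.
rewrite -/(brJJ mu nu rho sigma).
move: mu nu; apply: so_J_case => [p|mu nu h|mu].
- move: rho sigma; apply: so_J_case => [q|rho sigma h|rho].
  + rewrite !so_J_basis; rewrite br_e; cbv beta iota delta [br_basis bD bP bK]; exact: erefl.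
  + rewrite brJJ_antir (so_J_anti rho sigma) brNr h; exact: erefl.
  + have E (a b : so) : 0 = a - b - a + b by rewrite (addrAC a) subrr add0r addNr.
    rewrite so_J_diag br0r; exact: E.
- rewrite brJJ_antil so_J_anti brNl h; exact: erefl.
- have E (a b : so) : 0 = a - a - b + b by rewrite subrr sub0r addNr.
  rewrite so_J_diag br0l; exact: E.
Qed.

Lemma adP3_eq0 mu nu rho X : br (so_P mu) (br (so_P nu) (br (so_P rho) X)) = 0.
Proof.
have PJ m n r s : br (so_P m) (br (so_P n) (so_J r s)) = 0.
  by rewrite br_PJ brNr /brJP brDr !brZr !br_PP !scaler0 addr0 oppr0.
have PD m n : br (so_P m) (br (so_P n) so_D) = 0.
  by rewrite br_PD brNr br_PP oppr0.
move: X; apply: so_ind => [|r X Y hX hY||m|m|m n].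
- by rewrite !br0r.
- by rewrite !brZDr hX hY scaler0 addr0.
- by rewrite PD br0r.
- by rewrite br_PP !br0r.
- by rewrite br_PK !(brZr, brDr) PJ PD !scaler0 addr0 scaler0.
- by rewrite PJ br0r.
Qed.

Lemma adPs_eq0 (s : seq 'I_d) X : (3 <= size s)%N -> adPs s X = 0.
Proof. by case: s => [|i [|j [|k s]]] //= _; rewrite adP3_eq0. Qed.

End LieAlgebraTheory.

Section FinSupp.
Variables (K : choiceType) (V : zmodType).

Definition fsupp : {pred (K -> V)} :=
  [pred f : K -> V | `[< finite_set [set k | f k != 0] >]].

Lemma fsupp_zmod_closed : zmod_closed fsupp.
Proof.
split=> [|f g /asboolP ff /asboolP fg]; apply/asboolP.
  rewrite (_ : [set k | _] = set0); first exact: finite_set0.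
  by apply/seteqP; split => k //=; rewrite eqxx.
apply: (@sub_finite_set _ _ ([set k | f k != 0] `|` [set k | g k != 0])).
  move=> k /=; have [f0|?] := eqVneq (f k) 0; last by left.
  have [g0|?] := eqVneq (g k) 0; last by right.
  have -> : (f - g) k = f k - g k by [].
  by rewrite f0 g0 subrr eqxx.
by rewrite finite_setU.
Qed.
HB.instance Definition _ := GRing.isZmodClosed.Build (K -> V) fsupp
  fsupp_zmod_closed.

Record fs := Fs { fs_val :> K -> V; _ : fs_val \in fsupp }.
HB.instance Definition _ := [isSub for fs_val].
HB.instance Definition _ := [Choice of fs by <:].
HB.instance Definition _ := [SubChoice_isSubZmodule of fs by <:].

Lemma fs_finite (f : fs) : finite_set [set k | f k != 0].
Proof. by apply/asboolP; exact: (valP f). Qed.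

Lemma fs0E k : (0 : fs) k = 0. Proof. by []. Qed.
Lemma fsDE (f g : fs) k : (f + g) k = f k + g k. Proof. by []. Qed.
Lemma fsNE (f : fs) k : (- f) k = - f k. Proof. by []. Qed.
Lemma fsP (f g : fs) : (forall k, f k = g k) -> f = g.
Proof. by move=> fg; apply: val_inj; apply/funext. Qed.

Lemma mono_subproof (k : K) (v : V) : (fun j => if j == k then v else 0) \in fsupp.
Proof.
apply/asboolP; apply: (@sub_finite_set _ _ [set k]); last exact: finite_set1.
by move=> j /=; case: (j =P k) => // _; rewrite eqxx.
Qed.
Definition mono k v : fs := Fs (mono_subproof k v).

End FinSupp.

(* The additive map sending mono k v to F k v, when F k is additive. *)
Definition fslin (K : choiceType) (V W : zmodType) (F : K -> V -> W)
  (f : fs K V) : W := \sum_(k \in [set: K]) F k (f k).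

Section FsLin.
Variables (K : choiceType) (V W : zmodType) (F : K -> V -> W).
Hypothesis Fadd : forall k v w, F k (v + w) = F k v + F k w.

Let F0 k : F k 0 = 0.
Proof. by have /(congr1 (fun x => x - F k 0)) := Fadd k 0 0; rewrite addrK addr0 subrr. Qed.

Lemma fslinE (f : fs K V) (D : {fset K}) :
  (forall k, f k != 0 -> k \in D) -> fslin F f = \sum_(k <- D) F k (f k).
Proof.
move=> fD; rewrite /fslin (fsbigTE D) // => k kD.
by have [->|/fD] := eqVneq (f k) 0; rewrite ?F0 // (negbTE kD).
Qed.

Lemma fslinD (f g : fs K V) : fslin F (f + g) = fslin F f + fslin F g.
Proof.
pose D := (fset_set [set k | f k != 0] `|` fset_set [set k | g k != 0])%fset.
have hD k : (f k != 0) || (g k != 0) -> k \in D.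
  rewrite in_fsetU (in_fset_set (fs_finite f)) (in_fset_set (fs_finite g)).
  by move=> /orP[h|h]; apply/orP; [left|right]; rewrite inE.
rewrite (@fslinE f D) => [|k fk]; last by rewrite hD ?fk.
rewrite (@fslinE g D) => [|k gk]; last by rewrite hD ?gk ?orbT.
rewrite (@fslinE (f + g) D) => [|k fgk].
  by rewrite -big_split /=; apply: eq_bigr => k _; rewrite Fadd.
apply: hD; apply: contraNT fgk; rewrite fsDE.
by rewrite negb_or !negbK => /andP[/eqP -> /eqP ->]; rewrite addr0.
Qed.

Lemma fslin_mono k v : fslin F (mono k v) = F k v.
Proof.
rewrite (@fslinE _ [fset k]%fset) ?big_seq_fset1 /= ?eqxx // => j /=.
by case: (j =P k) => [->|_]; rewrite ?inE ?eqxx.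
Qed.

End FsLin.

(* Exponents: the label (alpha, r) stands for x^alpha |x|^r. *)
Definition mexp (d : nat) : Type := {ffun 'I_d -> nat}.
HB.instance Definition _ d := Choice.on (mexp d).
Definition sexp (R : realType) (d : nat) : Type := (mexp d * R)%type.
HB.instance Definition _ (R : realType) d := Choice.on (sexp R d).

Section Exponents.
Variables (R : realType) (d : nat).
Definition mexp_inc (mu : 'I_d) (alpha : mexp d) : mexp d :=
  [ffun nu => alpha nu + (mu == nu)]%N.
Definition mexp_dec (mu : 'I_d) (alpha : mexp d) : mexp d :=
  [ffun nu => alpha nu - (mu == nu)]%N.
Definition mexp_deg (alpha : mexp d) : nat := (\sum_mu alpha mu)%N.
Definition sexp_deg (k : sexp R d) : R := (mexp_deg k.1)%:R + k.2.
Definition sexp_eval (x : 'rV[R]_d) (k : sexp R d) (norm : R) : R :=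
  (\prod_mu x 0 mu ^+ k.1 mu) * norm `^ k.2.
End Exponents.

Definition enorm (R : realType) d (x : 'rV[R]_d) : R :=
  Num.sqrt (\sum_mu x 0 mu ^+ 2).

Section Spherical.
Variables (R : realType) (d : nat).

(* V (x) R[x_1,...,x_d] (x) R[t^R], for a real vector space V: finitely
   supported V-valued functions of the exponents.  V (x) R[x_1,...,x_d,|x|^R]
   is its quotient by (x_1^2 + ... + x_d^2 - t^2) times itself. *)
Definition sph_relk (V : zmodType) (k : sexp R d) (v : V) : fs (sexp R d) V :=
  \sum_mu mono (mexp_inc mu (mexp_inc mu k.1), k.2) v
  - mono (k.1, k.2 + 2%:R) v.
Definition sph_rel (V : zmodType) (g : fs (sexp R d) V) : fs (sexp R d) V :=
  fslin (@sph_relk V) g.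

Lemma monoD (K : choiceType) (V : zmodType) (k : K) (v w : V) :
  mono k (v + w) = mono k v + mono k w.
Proof. by apply: fsP => j; rewrite fsDE /=; case: eqP; rewrite ?addr0. Qed.

Lemma sph_relkD (V : zmodType) k (v w : V) : sph_relk k (v + w) = sph_relk k v + sph_relk k w.
Proof.
rewrite /sph_relk monoD opprD addrACA -big_split /=.
by under eq_bigr do rewrite monoD.
Qed.

Definition sph_ideal (V : zmodType) : {pred fs (sexp R d) V} :=
  [pred f | `[< exists g, f = sph_rel g >]].

Lemma sph_ideal_zmod_closed (V : zmodType) : zmod_closed (@sph_ideal V).
Proof.
have relB (f g : fs (sexp R d) V) : sph_rel (f - g) = sph_rel f - sph_rel g.
  apply: (addIr (sph_rel g)); rewrite subrK -fslinD ?subrK //.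
  exact: sph_relkD.
split=> [|f g /asboolP[f' ->] /asboolP[g' ->]]; apply/asboolP.
  by exists 0; rewrite -[X in sph_rel X](subrr 0) relB subrr.
by exists (f' - g'); rewrite relB.
Qed.
HB.instance Definition _ (V : zmodType) := GRing.isZmodClosed.Build (fs (sexp R d) V)
  (@sph_ideal V) (@sph_ideal_zmod_closed V).

Definition sph (V : zmodType) : Type := {ideal_quot (@sph_ideal V)}.
HB.instance Definition _ (V : zmodType) := GRing.Zmodule.on (sph V).

Definition sph_pi (V : zmodType) (f : fs (sexp R d) V) : sph V :=
  \pi_({ideal_quot (@sph_ideal V)}) f.
Definition sph_repr (V : zmodType) (q : sph V) : fs (sexp R d) V :=
  repr (q : {ideal_quot (@sph_ideal V)}).

Definition sph_mono (V : zmodType) (k : sexp R d) (v : V) : sph V :=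
  sph_pi (mono k v).

(* The additive map sending v x^alpha |x|^r to F (alpha, r) v; it is used only
   for F compatible with |x|^2 = x_1^2 + ... + x_d^2 (see sph_liftE). *)
Definition sph_lift (V W : zmodType) (F : sexp R d -> V -> W) (q : sph V) : W :=
  fslin F (sph_repr q).

Lemma fslinN (K : choiceType) (V W : zmodType) (F : K -> V -> W) :
  (forall k v w, F k (v + w) = F k v + F k w) ->
  forall f, fslin F (- f) = - fslin F f.
Proof.
move=> Fadd f; apply: (addIr (fslin F f)).
rewrite -fslinD // !addNr /fslin fsbig1 // => k _.
by have /(congr1 (fun x => x - F k 0)) := Fadd k 0 0; rewrite addrK addr0 subrr.
Qed.

Lemma sph_liftE (V W : zmodType) (F : sexp R d -> V -> W) :
  (forall k v w, F k (v + w) = F k v + F k w) ->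
  (forall k v, \sum_mu F (mexp_inc mu (mexp_inc mu k.1), k.2) v
               = F (k.1, k.2 + 2%:R) v) ->
  forall f, sph_lift F (sph_pi f) = fslin F f.
Proof.
move=> Fadd Frel f.
have F0 : fslin F 0 = 0.
  by apply: (addIr (fslin F 0)); rewrite -fslinD // !add0r.
have : sph_repr (sph_pi f) - f \in @sph_ideal V.
  by rewrite Quotient.idealrBE /sph_repr /sph_pi reprK.
move=> /asboolP[g /eqP]; rewrite subr_eq => /eqP e.
rewrite /sph_lift e fslinD // -[RHS]add0r; congr (_ + _).
rewrite /sph_rel (@fslinE _ _ _ _ (@sph_relkD V) _ (fset_set [set k | g k != 0])).
  rewrite (big_morph (fslin F) (id1 := 0) (op1 := +%R)) //; last exact: fslinD.
  rewrite big1 // => k _; rewrite /sph_relk fslinD // fslinN //.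
  rewrite (big_morph (fslin F) (id1 := 0) (op1 := +%R)) //; last exact: fslinD.
  rewrite fslin_mono //; under eq_bigr do rewrite fslin_mono //.
  by rewrite Frel subrr.
by move=> k gk; rewrite (in_fset_set (fs_finite g)) inE.
Qed.

Lemma sph_piD (V : zmodType) (f g : fs (sexp R d) V) :
  sph_pi (f + g) = sph_pi f + sph_pi g.
Proof. exact: raddfD. Qed.
Lemma sph_pi0 (V : zmodType) : sph_pi (0 : fs (sexp R d) V) = 0.
Proof. exact: raddf0. Qed.

Lemma sph_monoD (V : zmodType) (k : sexp R d) (v w : V) :
  sph_mono k (v + w) = sph_mono k v + sph_mono k w.
Proof. by rewrite /sph_mono monoD sph_piD. Qed.

Lemma sph_mono0 (V : zmodType) (k : sexp R d) : sph_mono k (0 : V) = 0.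
Proof. by apply: (addIr (sph_mono k 0)); rewrite -sph_monoD !add0r. Qed.

Lemma sph_mono_rel (V : zmodType) (alpha : mexp d) (r : R) (v : V) :
  \sum_mu sph_mono (mexp_inc mu (mexp_inc mu alpha), r) v
  = sph_mono (alpha, r + 2%:R) v.
Proof.
rewrite /sph_mono -(big_morph _ (@sph_piD V) (@sph_pi0 V)).
apply/eqP; rewrite /sph_pi -Quotient.idealrBE; apply/asboolP.
exists (mono (alpha, r) v); rewrite /sph_rel fslin_mono //.
exact: sph_relkD.
Qed.

Definition sph_map (V W : zmodType) (T : V -> W) : sph V -> sph W :=
  sph_lift (fun k v => sph_mono k (T v)).

Lemma sph_map_pi (V W : zmodType) (T : V -> W) (f : fs (sexp R d) V) :
  (forall v w, T (v + w) = T v + T w) ->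
  sph_map T (sph_pi f) = fslin (fun k v => sph_mono k (T v)) f.
Proof.
move=> TD; apply: sph_liftE => [k v w|k v]; first by rewrite TD sph_monoD.
by rewrite sph_mono_rel.
Qed.

Definition sph_X (V : zmodType) (mu : 'I_d) : sph V -> sph V :=
  sph_lift (fun k v => sph_mono (mexp_inc mu k.1, k.2) v).

Lemma mexp_incC (mu nu : 'I_d) alpha :
  mexp_inc mu (mexp_inc nu alpha) = mexp_inc nu (mexp_inc mu alpha).
Proof. by apply/ffunP => rho; rewrite !ffunE addnAC. Qed.

Lemma sph_X_pi (V : zmodType) mu (f : fs (sexp R d) V) :
  sph_X mu (sph_pi f) =
  fslin (fun k v => sph_mono (mexp_inc mu k.1, k.2) v) f.
Proof.
apply: sph_liftE => [k v w|k v]; first exact: sph_monoD.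
rewrite -sph_mono_rel; apply: eq_bigr => nu _ /=.
by rewrite (mexp_incC mu nu) (mexp_incC mu nu).
Qed.

Definition sph_d (V : lmodType R[i]) (mu : 'I_d) : sph V -> sph V :=
  sph_lift (fun k v =>
    sph_mono (mexp_dec mu k.1, k.2) (v *+ k.1 mu)
    + sph_mono (mexp_inc mu k.1, k.2 - 2%:R) (k.2%:C *: v)).

Lemma sph_d_pi (V : lmodType R[i]) mu (f : fs (sexp R d) V) :
  sph_d mu (sph_pi f) = fslin (fun k v =>
    sph_mono (mexp_dec mu k.1, k.2) (v *+ k.1 mu)
    + sph_mono (mexp_inc mu k.1, k.2 - 2%:R) (k.2%:C *: v)) f.
Proof.
apply: sph_liftE => [k v w|[alpha r] v /=].
  by rewrite mulrnDl scalerDr !sph_monoD addrACA.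
have sph_monoMn k (w : V) n : sph_mono k (w *+ n) = sph_mono k w *+ n.
  elim: n => [|n IH]; last by rewrite !mulrS sph_monoD IH.
  by apply: (addIr (sph_mono k 0)); rewrite -sph_monoD !mulr0n !add0r.
have incdec (be : mexp d) : mexp_dec mu (mexp_inc mu be) = be.
  by apply/ffunP => rho; rewrite !ffunE addnK.
rewrite big_split /= [X in _ + X](eq_bigr (fun nu =>
    sph_mono (mexp_inc nu (mexp_inc nu (mexp_inc mu alpha)), r - 2%:R) (r%:C *: v))); last first.
  by move=> nu _; rewrite (mexp_incC mu nu) (mexp_incC mu nu).
rewrite sph_mono_rel subrK addrK.
have -> : \sum_nu sph_mono (mexp_dec mu (mexp_inc nu (mexp_inc nu alpha)), r)
      (v *+ mexp_inc nu (mexp_inc nu alpha) mu)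
    = sph_mono (mexp_dec mu alpha, r + 2%:R) (v *+ alpha mu)
      + sph_mono (mexp_inc mu alpha, r) (v *+ 2).
  rewrite -sph_mono_rel (bigD1 mu) //= [in RHS](bigD1 mu) //= addrAC; congr (_ + _).
    rewrite !incdec !ffunE eqxx -addnA mulrnDr sph_monoD; congr (_ + _).
    have [a0|a0] := posnP (alpha mu); first by rewrite a0 !mulr0n !sph_mono0.
    congr (sph_mono (_, _) _); apply/ffunP => rho; rewrite !ffunE.
    by case: eqP => [<-|_] /=; rewrite ?addn0 ?subn0 // subnK.
  apply: eq_bigr => nu numu; rewrite !ffunE (negbTE numu) !addn0.
  congr (sph_mono (_, _) _); apply/ffunP => rho; rewrite !ffunE.
  case: (eqVneq mu rho) => [<-|_]; last by rewrite !subn0.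
  by rewrite (negbTE numu) !addn0.
rewrite -addrA -sph_monoD; congr (_ + sph_mono _ _).
by rewrite rmorphD /= scalerDl addrC rmorphMn /= scaler_nat.
Qed.

(* The value at x != 0. *)
Definition sph_eval (V : lmodType R[i]) (x : 'rV[R]_d) : sph V -> V :=
  sph_lift (fun k v => (sexp_eval x k (enorm x))%:C *: v).

Lemma sph_eval_pi (V : lmodType R[i]) (x : 'rV[R]_d) (f : fs (sexp R d) V) :
  x != 0 -> sph_eval x (sph_pi f) =
  fslin (fun k v => (sexp_eval x k (enorm x))%:C *: v) f.
Proof.
move=> x0; apply: sph_liftE => [k v w|[alpha r] v /=]; first by rewrite scalerDr.
rewrite -scaler_suml -rmorph_sum /=; congr (_%:C *: v).
have n0 : 0 < enorm x.
  have [mu xmu] : exists mu, x 0 mu != 0.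
    apply/existsP; apply: contraNT x0 => /existsPn x0; apply/eqP/rowP => mu.
    by rewrite mxE; apply/eqP/negPn/x0.
  rewrite sqrtr_gt0 (bigD1 mu) //= ltr_pwDl ?exprn_even_gt0 //.
  by apply: sumr_ge0 => nu _; rewrite sqr_ge0.
rewrite /sexp_eval /= powRD ?(gt_eqF n0) ?implybT // (mulrC (_ `^ r)) mulrA.
rewrite -mulr_suml; congr (_ * _).
rewrite powR_mulrn ?ltW // sqr_sqrtr ?sumr_ge0 // => [|nu _]; last exact: sqr_ge0.
rewrite mulr_sumr; apply: eq_bigr => mu _.
rewrite (bigD1 mu) //= [in RHS](bigD1 mu) //= !ffunE eqxx !exprD !expr1 -!mulrA.
congr (_ * _); rewrite mulrA -expr2 [RHS]mulrC; congr (_ * _).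
by apply: eq_bigr => nu numu; rewrite !ffunE eq_sym (negbTE numu) !addn0.
Qed.

(* V[x_1,...,x_d,|x|^R]_lambda *)
Definition sph_homog (V : zmodType) (lambda : R) (q : sph V) : Prop :=
  exists2 f : fs (sexp R d) V,
    (forall k, f k != 0 -> sexp_deg k = lambda) & q = sph_pi f.

(* V((x_1,...,x_d,|x|^R)), as families indexed by the degree. *)
Definition is_laurent (V : zmodType) (f : R -> sph V) : Prop :=
  (forall lambda, sph_homog lambda (f lambda)) /\
  (forall M, finite_set [set lambda | lambda < M /\ f lambda != 0]).

Definition ser_map (V W : zmodType) (T : V -> W) (f : R -> sph V) : R -> sph W :=
  fun lambda => sph_map T (f lambda).
Definition ser_X (V : zmodType) (mu : 'I_d) (f : R -> sph V) : R -> sph V :=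
  fun lambda => sph_X mu (f (lambda - 1)).
Definition ser_d (V : lmodType R[i]) (mu : 'I_d) (f : R -> sph V) : R -> sph V :=
  fun lambda => sph_d mu (f (lambda + 1)).

(* |x|^s V[x_1/|x|,...,x_d/|x|]: p is the polynomial. *)
Definition in_sphere_poly (V : zmodType) (s : R) (f : R -> sph V) : Prop :=
  exists p : fs (mexp d) V, forall lambda, f lambda =
    if lambda == s
    then fslin (fun alpha v => sph_mono (alpha, s - (mexp_deg alpha)%:R) v) p
    else 0.

End Spherical.

Section Modules.
Variables (R : realType) (d : nat) (H : lmodType R[i]).
Implicit Types (act : so R d -> H -> H) (u : {scalar H}).

Definition cabs (z : R[i]) : R := complex.Re `|z|.

Definition is_so_module act : Prop :=
  [/\ forall (r : R) X Y a, act (r *: X + Y) a = r%:C *: act X a + act Y a,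
      forall X (c : R[i]) a b, act X (c *: a + b) = c *: act X a + act X b
    & forall X Y a, act (br X Y) a = act X (act Y a) - act Y (act X a)].

Definition eigsp act (Delta : R) : set H :=
  [set a | act (so_D R d) a = Delta%:C *: a].

Definition is_decomp act (a : H) (c : R -> H) : Prop :=
  [/\ forall Delta, eigsp act Delta (c Delta),
      finite_set [set Delta | c Delta != 0]
    & a = \sum_(Delta \in [set: R]) c Delta].

Definition compact1 act : Prop := forall a, exists! c, is_decomp act a c.

Definition lin_indep n (b : 'I_n -> H) : Prop :=
  forall c : 'I_n -> R[i], \sum_i c i *: b i = 0 -> forall i, c i = 0.

Definition edim (S : set H) : \bar R :=
  ereal_sup [set n%:R%:E | n in [set n : nat |
    exists b : 'I_n -> H, (forall i, S (b i)) /\ lin_indep b]].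

Definition compact2 act : Prop := forall M : R,
  (\esum_(Delta in [set Delta : R | (Delta <= M)%R]) edim (eigsp act Delta) < +oo)%E.

Definition is_cderive (f : R -> R[i]) (t : R) (l : R[i]) : Prop :=
  is_derive t 1 (fun s => complex.Re (f s)) (complex.Re l) /\
  is_derive t 1 (fun s => complex.Im (f s)) (complex.Im l).

Definition SO : set 'M[R]_d := [set g | g *m g^T = 1%:M /\ \det g = 1].

(* The element of <J_{mu,nu}> corresponding to an antisymmetric matrix, where
   J_{mu,nu} corresponds to E_{mu,nu} - E_{nu,mu}; this is the identification
   for which P_1, ..., P_d transform as the standard basis vectors. *)
Definition so_of_mx (A : 'M[R]_d) : so R d :=
  \sum_(p : 'I_d * 'I_d | (p.1 < p.2)%N) A p.1 p.2 *: so_J R p.1 p.2.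

(* For each Delta there is a representation pi of the group SO(d) on H_Delta
   whose differential at 1 is the given action of so(d).  The differential is
   expressed through matrix coefficients along curves; a homomorphism which
   has a differential at 1 in this sense is automatically smooth. *)
Definition compact3 act : Prop := forall Delta : R,
  exists pi : 'M[R]_d -> H -> H,
  [/\ forall g a, SO g -> eigsp act Delta a -> eigsp act Delta (pi g a),
      forall g (c : R[i]) a b, SO g -> eigsp act Delta a -> eigsp act Delta b ->
        pi g (c *: a + b) = c *: pi g a + pi g b,
      forall a, eigsp act Delta a -> pi 1%:M a = a,
      forall g h a, SO g -> SO h -> eigsp act Delta a ->
        pi (g *m h) a = pi g (pi h a)
    & forall (gamma : R -> 'M[R]_d) (A : 'M[R]_d),
        (forall t, SO (gamma t)) -> gamma 0 = 1%:M ->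
        (forall mu nu, is_derive (0 : R) 1 (fun t => gamma t mu nu) (A mu nu)) ->
        forall a u, eigsp act Delta a ->
        is_cderive (fun t => u (pi (gamma t) a)) 0 (u (act (so_of_mx A) a))].

Record compact_module act : Prop := CompactModule {
  cm_module : is_so_module act;
  cm_1 : compact1 act;
  cm_2 : compact2 act;
  cm_3 : compact3 act }.

Definition pr act (Delta : R) (a : H) : H :=
  xget (fun=> 0) [set c | is_decomp act a c] Delta.

(* The product of the H_Delta. *)
Definition hbar act : set (R -> H) :=
  [set v | forall Delta, eigsp act Delta (v Delta)].

(* The action on the product: the component of X v in H_Delta collects the
   contributions of all the (at most three) v_Delta'. *)
Definition bar_act act (X : so R d) (v : R -> H) : R -> H :=
  fun Delta => \sum_(Delta' \in [set: R]) pr act Delta (act X (v Delta')).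

Definition bar_exp act (X : so R d) (v : R -> H) : R -> H :=
  fun Delta => \sum_(k \in [set: nat])
    (k`!%:R^-1 : R[i]) *: iter k (bar_act act X) v Delta.

(* The direct sum of the duals H_Delta^*, as the functionals on H (the direct
   sum of the H_Delta) vanishing on all but finitely many H_Delta. *)
Definition hvee act : set {scalar H} :=
  [set u | finite_set [set Delta | exists2 a, eigsp act Delta a & u a != 0]].

(* The summand H_Delta0^* of the preceding space. *)
Definition hdual act (Delta0 : R) : set {scalar H} :=
  [set u | forall Delta a, Delta != Delta0 -> eigsp act Delta a -> u a = 0].

Definition hpair (u : {scalar H}) (v : R -> H) : R[i] :=
  \sum_(Delta \in [set: R]) u (v Delta).

End Modules.

Section CCSystems.
Variables (R : realType) (d : nat).

(* n-tuples of points of R^d are the rows of n x d matrices. *)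
Definition Conf n : set 'M[R]_(n, d) :=
  [set x | forall i j, i != j -> row i x != row j x].
Arguments Conf : clear implicits.

(* The family c is absolutely (equivalently, unconditionally) summable, with
   sum l. *)
Definition has_csum (I : choiceType) (c : I -> R[i]) (l : R[i]) : Prop :=
  forall e : R, 0 < e -> exists F0 : {fset I}, forall F : {fset I},
    (F0 `<=` F)%fset -> cabs (\sum_(i <- F) c i - l) < e.

(* Real analyticity on the open set A of a function of the matrix entries;
   the multi-indices alpha are matrices of natural numbers. *)
Definition real_analytic n (A : set 'M[R]_(n, d)) (f : 'M[R]_(n, d) -> R[i]) :=
  forall p, A p -> exists (r : R) (c : 'M[nat]_(n, d) -> R[i]), 0 < r /\
    forall x : 'M[R]_(n, d), (forall i j, `|x i j - p i j| < r) ->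
      has_csum (fun alpha : 'M[nat]_(n, d) =>
        c alpha * (\prod_i \prod_j (x i j - p i j) ^+ alpha i j)%:C) (f x).

Definition U n m : set ('M[R]_(n, d) * 'rV[R]_d * 'M[R]_(m, d)) :=
  [set z | [/\ Conf (n + 1) (col_mx z.1.1 z.1.2), Conf m z.2
    & forall k l, enorm (row l z.2) < enorm (row k z.1.1 - z.1.2)]].

Arguments U : clear implicits.

Definition cat_args (T : Type) n m (a : 'I_n -> T) (b : 'I_m -> T) : 'I_(n + m) -> T :=
  fun i => match fintype.split i with inl j => a j | inr k => b k end.

Definition upd (T : Type) n (a : 'I_n -> T) (p : 'I_n) (b : T) : 'I_n -> T :=
  fun i => if i == p then b else a i.

Variable H : lmodType R[i].
Implicit Types (act : so R d -> H -> H) (vac : H).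

(* The values of YY outside Conf n, and for n = 0, are irrelevant. *)
Variable YY : forall n, 'M[R]_(n, d) -> ('I_n -> H) -> R -> H.

Definition cluster_term n m (u : {scalar H}) (a : 'I_n -> H) (b : 'I_m -> H)
    (z : 'M[R]_(n, d) * 'rV[R]_d * 'M[R]_(m, d)) (Delta : R) : R[i] :=
  hpair u (YY (col_mx z.1.1 z.1.2) (cat_args a (fun _ : 'I_1 => YY z.2 b Delta))).

Definition cluster_lim n m (u : {scalar H}) (a : 'I_n -> H) (b : 'I_m -> H)
    (z : 'M[R]_(n, d) * 'rV[R]_d * 'M[R]_(m, d)) : R[i] :=
  hpair u (YY (col_mx z.1.1 (\matrix_(l < m) (z.1.2 + row l z.2))) (cat_args a b)).

Record CC_system act vac : Prop := CCSystem {
  cc_compact : compact_module act;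
  cc_bar : forall n x a, (0 < n)%N -> Conf n x -> hbar act (YY x a);
  cc_multilinear : forall n x a p (c : R[i]) b b' Delta, (0 < n)%N -> Conf n x ->
    YY x (upd a p (c *: b + b')) Delta
    = c *: YY x (upd a p b) Delta + YY x (upd a p b') Delta;
  cc_vac0 : eigsp act 0 vac;
  cc_unit : forall a Delta,
    YY (0 : 'M[R]_(1, d)) (fun=> a) Delta = pr act Delta a;
  cc_analytic : forall n a u, (0 < n)%N -> hvee act u ->
    real_analytic (Conf n) (fun x => hpair u (YY x a));
  cc_perm : forall n x a (s : {perm 'I_n}), (0 < n)%N -> Conf n x ->
    YY x a = YY (row_perm s x) (fun i => a (s i));
  cc_vacuum : forall n (x : 'M[R]_(n, d)) (y : 'rV[R]_d) a, (0 < n)%N ->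
    Conf (n + 1) (col_mx x y) ->
    YY (col_mx x y) (cat_args a (fun _ : 'I_1 => vac)) = YY x a;
  cc_vac_inv : forall X, act X vac = 0;
  cc_translation : forall n x a p mu u, (0 < n)%N -> Conf n x -> hvee act u ->
    is_cderive (fun t => hpair u (YY (x + t *: delta_mx p mu) a)) 0
      (hpair u (YY x (upd a p (act (so_P R mu) (a p)))));
  cc_covariance : forall n x a X Delta, (0 < n)%N -> Conf n x ->
    bar_act act X (YY x a) Delta
    = \sum_q YY x (upd a q (act (tau (row q x) X) (a q))) Delta;
  cc_cluster_abs : forall n m (a : 'I_n -> H) (b : 'I_m -> H) u z,
    (0 < m)%N -> hvee act u -> U n m z ->
    summable [set: R] (fun Delta => (cabs (cluster_term u a b z Delta))%:E);
  cc_cluster_unif : forall n m (a : 'I_n -> H) (b : 'I_m -> H) u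
      (K : set ('M[R]_(n, d) * 'rV[R]_d * 'M[R]_(m, d))),
    (0 < m)%N -> hvee act u -> compact K -> K `<=` U n m ->
    forall e : R, 0 < e -> exists M0 : R, forall M z, M0 <= M -> K z ->
      cabs (\sum_(Delta \in [set Delta | Delta < M]) cluster_term u a b z Delta
            - cluster_lim u a b z) < e }.

End CCSystems.

Section VertexOperators.
Variables (R : realType) (d : nat) (H : lmodType R[i]).
Implicit Types (act : so R d -> H -> H) (Y : H -> H -> R -> sph R d H).

(* Linear maps H (x) H -> H((x_1,...,x_d,|x|^R)); scalars act coefficientwise. *)
Definition is_vertex_map Y : Prop :=
  [/\ forall a b, is_laurent (Y a b),
      forall (c : R[i]) a a' b,
        Y (c *: a + a') b = ser_map ( *:%R c) (Y a b) + Y a' b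
    & forall (c : R[i]) a b b',
        Y a (c *: b + b') = ser_map ( *:%R c) (Y a b) + Y a b'].

(* Y(tau_x(X) a, x) b, with the polynomial tau_x(X) expanded as in tau. *)
Definition Y_tau act Y (X : so R d) (a b : H) : R -> sph R d H :=
  \sum_(k < 3) \sum_(s : k.-tuple 'I_d)
    ser_map ( *:%R ((-1) ^+ k / k`!%:R : R[i]))
      (foldr (fun rho f => ser_X rho f) (Y (act (adPs s X) a) b) s).

Definition covariant_vertex_operator act Y : Prop :=
  [/\ is_vertex_map Y,
      forall mu a b, Y (act (so_P R mu) a) b = ser_d mu (Y a b)
    & forall X a b,
        ser_map (act X) (Y a b) = Y a (act X b) + Y_tau act Y X a b].

(* The value at x != 0, in the product of the H_Delta, of a series whose
   component in each H_Delta involves finitely many degrees. *)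
Definition ser_eval act (x : 'rV[R]_d) (f : R -> sph R d H) : R -> H :=
  fun Delta => \sum_(lambda \in [set: R])
    sph_eval x (sph_map (pr act Delta) (f lambda)).

Definition pair2 (a b : H) : 'I_(1 + 1) -> H :=
  cat_args (fun _ : 'I_1 => a) (fun _ : 'I_1 => b).

Definition is_two_point act (YY : forall n, 'M[R]_(n, d) -> ('I_n -> H) -> R -> H)
    Y : Prop :=
  [/\ is_vertex_map Y,
      forall (D0 D1 D2 : R) (u : {scalar H}) a b,
        hdual act D0 u -> eigsp act D1 a -> eigsp act D2 b ->
        in_sphere_poly (D0 - D1 - D2) (ser_map u (Y a b))
    & forall (u : {scalar H}) a b (x : 'rV[R]_d), hvee act u -> x != 0 ->
        \sum_(lambda \in [set: R])
          sph_eval x (ser_map u (Y a b) lambda : sph R d R[i]^o)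
        = hpair u (YY _ (col_mx x 0) (pair2 a b))].

End VertexOperators.

(* Main.v *)
From HB Require Import structures.
Require Import Defs.
From mathcomp Require Import all_boot all_order all_algebra.
From mathcomp Require Import complex finmap.
From mathcomp Require Import all_classical all_reals all_analysis.
From mathcomp Require Import ring lra zify.
Import Order.TTheory GRing.Theory Num.Theory.
Import numFieldNormedType.Exports.
Local Open Scope classical_set_scope.
Local Open Scope ring_scope.
Local Open Scope complex_scope.
Set Implicit Arguments.
Unset Strict Implicit.
Unset Printing Implicit Defensive.

(** Let a and b have weights D1 and D2, let u be a functional on the space of
    weight D0, and put f(x) = <u, YY_(x,0)(a,b)>.  The heart of the matter is
    that f is |x|^(D0-D1-D2) times a polynomial in the x_mu/|x|.  Covariance
    under D is Euler's equation, so f is homogeneous of degree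
    lambda = D0 - D1 - D2.  Covariance under the J_{mu,nu} says that, when u, a
    and b run through bases of three finite-dimensional weight spaces, the
    resulting functions F_i satisfy
      (x_nu d_mu - x_mu d_nu) F_i = sum_j A_ij F_j
    with constant coefficients.  Along a great circle this is a linear
    differential equation with constant coefficients, and its solutions are
    2pi-periodic because they are functions on the sphere; so they are
    trigonometric polynomials, whose frequencies are bounded by the size of A
    and hence uniformly in the circle ([periodic_system]).  For N large,
      G(x) = |x|^(N-lambda) (F_i(x) + (-1)^N F_i(-x))
    is therefore a homogeneous polynomial of degree N on every plane spanned by
    a vector and a coordinate axis, so it is a polynomial of degree at most N
    in each variable separately, and interpolation on a grid makes it a
    polynomial ([separately_polynomial]).  Using an even and an odd N recovers
    F_i ([sphere_finite], [two_pt_homog_exists]).  Derivatives along curves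
    make sense because an analytic function differs from its affine part by
    O(h^2) ([analytic_chain]).

    The rest is bookkeeping made possible by one fact: a homogeneous element of
    V[x_1,...,x_d,|x|^R] is determined by its values at x != 0
    ([sph_eval_inj]).  Its numerator can be split by parity, x -> -x separates
    the two parts, and a polynomial that vanishes on a grid is zero.  Hence
    Y(a,x)b is defined degree by degree through its values, and its linearity,
    its uniqueness, the translation property and the covariance are all
    identities between values, that is, properties of YY.

    Finally, s |-> YY_(x1-x2+s x2, s x2)(a,b) has derivative X YY(...) with
    X = sum_rho x2_rho P_rho.  As X raises the weight by one and the weights
    are bounded below, each component has only finitely many nonzero
    derivatives, and Taylor's formula from s = 0 to s = 1 is the exponential
    formula ([two_pt_flow]). *)

(** * Calculus of spherical polynomials *)

(** The sum is over the support, so that additive statements about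
    finitely supported families reduce to [mono]. *)
Lemma fs_sum (K : choiceType) (V : zmodType) (f : fs K V) :
  f = \sum_(k <- fset_set [set k | f k != 0]) mono k (f k).
Proof.
apply: fsP => j.
have -> : (\sum_(k <- fset_set [set k | f k != 0]) mono k (f k)) j
    = \sum_(k <- fset_set [set k | f k != 0]) mono k (f k) j.
  by apply: (big_morph (fun g : fs K V => g j)).
have [fj|fj] := eqVneq (f j) 0.
  rewrite fj big1_seq // => k _ /=; case: eqP => // <-; exact: fj.
rewrite (big_fsetD1 j) /=; last by rewrite (in_fset_set (fs_finite f)) inE.
rewrite eqxx big1_fset ?addr0 // => k.
by rewrite !inE => /andP[kj _] _; rewrite eq_sym (negbTE kj).
Qed.

Lemma scale_lin (R : realType) (V : lmodType R[i]) (k c : R[i]) (v w : V) :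
  k *: (c *: v + w) = c *: (k *: v) + k *: w.
Proof. by rewrite scalerDr !scalerA mulrC. Qed.

Lemma scaleD (R : realType) (V : lmodType R[i]) (c : R[i]) : {morph ( *:%R c : V -> V) : v w / v + w}.
Proof. by move=> v w; rewrite scalerDr. Qed.

Section SphCalculus.
Variables (R : realType) (d : nat).

Lemma sph_pi_sum (V : zmodType) (f : fs (sexp R d) V) :
  sph_pi f = \sum_(k <- fset_set [set k | f k != 0]) sph_mono k (f k).
Proof.
by rewrite {1}(fs_sum f) (big_morph _ (@sph_piD R d V) (@sph_pi0 R d V)).
Qed.

Lemma sph_homog_ind (V : zmodType) (lambda : R) (P : sph R d V -> Prop) :
  P 0 -> (forall p q, P p -> P q -> P (p + q)) ->
  (forall k v, sexp_deg k = lambda -> P (sph_mono k v)) ->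
  forall q, sph_homog lambda q -> P q.
Proof.
move=> P0 PD Pm q [f fl ->]; rewrite sph_pi_sum big_seq.
elim/big_ind : _ => // k.
rewrite (in_fset_set (fs_finite f)) inE => /= fk.
by apply: Pm; exact: fl.
Qed.

Lemma sph_reprK (V : zmodType) (q : sph R d V) : sph_pi (sph_repr q) = q.
Proof. by rewrite /sph_pi /sph_repr reprK. Qed.

Lemma sph_ind (V : zmodType) (P : sph R d V -> Prop) :
  P 0 -> (forall p q, P p -> P q -> P (p + q)) ->
  (forall k v, P (sph_mono k v)) -> forall q, P q.
Proof.
move=> P0 PD Pm q; rewrite -(sph_reprK q) sph_pi_sum.
by elim/big_ind : _ => // k _; exact: Pm.
Qed.

(** The second hypothesis expresses compatibility with the relation
    x_1^2 + ... + x_d^2 = |x|^2 that is divided out. *)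
Lemma sph_liftD (V W : zmodType) (F : sexp R d -> V -> W) :
  (forall k v w, F k (v + w) = F k v + F k w) ->
  (forall k v, \sum_mu F (mexp_inc mu (mexp_inc mu k.1), k.2) v
               = F (k.1, k.2 + 2%:R) v) ->
  {morph sph_lift F : p q / p + q}.
Proof.
move=> FD Frel p q; rewrite -(sph_reprK p) -(sph_reprK q) -sph_piD.
by rewrite !sph_liftE // fslinD.
Qed.

Lemma sph_lift_mono (V W : zmodType) (F : sexp R d -> V -> W) :
  (forall k v w, F k (v + w) = F k v + F k w) ->
  (forall k v, \sum_mu F (mexp_inc mu (mexp_inc mu k.1), k.2) v
               = F (k.1, k.2 + 2%:R) v) ->
  forall k v, sph_lift F (sph_mono k v) = F k v.
Proof. by move=> FD Frel k v; rewrite sph_liftE // fslin_mono. Qed.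

Lemma morph_add0 (V W : zmodType) (f : V -> W) :
  {morph f : p q / p + q} -> f 0 = 0.
Proof. by move=> fD; apply: (addIr (f 0)); rewrite -fD !add0r. Qed.

Lemma morph_addN (V W : zmodType) (f : V -> W) :
  {morph f : p q / p + q} -> {morph f : p / - p}.
Proof.
by move=> fD p; apply: (addIr (f p)); rewrite -fD !addNr morph_add0.
Qed.

Section Map.
Variables (V W : zmodType) (T : V -> W).
Hypothesis TD : {morph T : v w / v + w}.

Let FD (k : sexp R d) v w : sph_mono k (T (v + w)) = sph_mono k (T v) + sph_mono k (T w) :> sph R d W.
Proof. by rewrite TD sph_monoD. Qed.
Let Frel (k : sexp R d) v :
  \sum_mu sph_mono (mexp_inc mu (mexp_inc mu k.1), k.2) (T v)
  = sph_mono (k.1, k.2 + 2%:R) (T v) :> sph R d W.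
Proof. by rewrite sph_mono_rel. Qed.

Lemma sph_mapD : {morph sph_map (R := R) (d := d) T : p q / p + q}.
Proof. exact: sph_liftD. Qed.
Lemma sph_map0 : sph_map T 0 = 0 :> sph R d W.
Proof. exact: morph_add0 sph_mapD. Qed.
Lemma sph_map_mono (k : sexp R d) v : sph_map T (sph_mono k v) = sph_mono k (T v) :> sph R d W.
Proof. by rewrite /sph_map sph_lift_mono. Qed.
End Map.

Section MultX.
Variables (V : zmodType) (mu : 'I_d).

Let FD (k : sexp R d) (v w : V) : sph_mono (mexp_inc mu k.1, k.2) (v + w) =
  sph_mono (mexp_inc mu k.1, k.2) v + sph_mono (mexp_inc mu k.1, k.2) w
  :> sph R d V.
Proof. by rewrite sph_monoD. Qed.
Let Frel (k : sexp R d) (v : V) :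
  \sum_nu sph_mono (mexp_inc mu (mexp_inc nu (mexp_inc nu k.1)), k.2) v
  = sph_mono (mexp_inc mu k.1, k.2 + 2%:R) v :> sph R d V.
Proof.
rewrite -sph_mono_rel; apply: eq_bigr => nu _.
by rewrite (mexp_incC mu nu) (mexp_incC mu nu).
Qed.

Lemma sph_XD : {morph sph_X (R := R) (V := V) mu : p q / p + q}.
Proof. exact: sph_liftD. Qed.
Lemma sph_X_mono (k : sexp R d) (v : V) :
  sph_X mu (sph_mono k v) = sph_mono (mexp_inc mu k.1, k.2) v :> sph R d V.
Proof. by rewrite /sph_X sph_lift_mono. Qed.
End MultX.

Section Deriv.
Variables (V : lmodType R[i]) (mu : 'I_d).

Lemma sph_dD : {morph sph_d (R := R) (V := V) mu : p q / p + q}.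
Proof.
move=> p q; rewrite -(sph_reprK p) -(sph_reprK q) -sph_piD.
rewrite !sph_d_pi fslinD // => k v w.
by rewrite mulrnDl scalerDr !sph_monoD addrACA.
Qed.
Lemma sph_d_mono (k : sexp R d) (v : V) : sph_d mu (sph_mono k v) =
  sph_mono (mexp_dec mu k.1, k.2) (v *+ k.1 mu)
    + sph_mono (mexp_inc mu k.1, k.2 - 2%:R) (k.2%:C *: v) :> sph R d V.
Proof.
rewrite /sph_mono sph_d_pi fslin_mono // => j v' w.
by rewrite mulrnDl scalerDr !sph_monoD addrACA.
Qed.
End Deriv.

Section Eval.
Variables (V : lmodType R[i]) (x : 'rV[R]_d).
Hypothesis x0 : x != 0.

Lemma sph_evalD : {morph sph_eval (V := V) x : p q / p + q}.
Proof.
move=> p q; rewrite -(sph_reprK p) -(sph_reprK q) -sph_piD.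
by rewrite !sph_eval_pi // fslinD // => k v w; rewrite scalerDr.
Qed.
Lemma sph_eval_mono (k : sexp R d) (v : V) :
  sph_eval x (sph_mono k v) = (sexp_eval x k (enorm x))%:C *: v.
Proof.
by rewrite /sph_mono sph_eval_pi // fslin_mono // => j v' w; rewrite scalerDr.
Qed.
Lemma sph_eval0 : sph_eval x 0 = 0 :> V.
Proof. exact: morph_add0 sph_evalD. Qed.
Lemma sph_evalN : {morph sph_eval (V := V) x : p / - p}.
Proof. exact: morph_addN sph_evalD. Qed.
Lemma sph_eval_sum (I : Type) (r : seq I) (P : pred I) (F : I -> sph R d V) :
  sph_eval x (\sum_(i <- r | P i) F i) = \sum_(i <- r | P i) sph_eval x (F i).
Proof. exact: (big_morph _ sph_evalD sph_eval0). Qed.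
Lemma sph_eval_X mu (q : sph R d V) :
  sph_eval x (sph_X mu q) = (x 0 mu)%:C *: sph_eval x q.
Proof.
elim/sph_ind: q => [|p q hp hq|k v].
- by rewrite (morph_add0 (@sph_XD V mu)) sph_eval0 scaler0.
- by rewrite sph_XD !sph_evalD hp hq scalerDr.
rewrite sph_X_mono !sph_eval_mono scalerA -rmorphM; congr (_%:C *: _).
rewrite /sexp_eval mulrA; congr (_ * _) => /=.
rewrite (bigD1 mu) //= [in RHS](bigD1 mu) //= !ffunE eqxx exprD expr1 mulrA.
congr (_ * _); first by rewrite mulrC.
by apply: eq_bigr => nu numu; rewrite ffunE eq_sym (negbTE numu) addn0.
Qed.
End Eval.

Lemma sph_eval_map (V W : lmodType R[i]) (T : V -> W) (x : 'rV[R]_d) (q : sph R d V) :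
  x != 0 -> (forall (c : R[i]) v w, T (c *: v + w) = c *: T v + T w) ->
  sph_eval x (sph_map T q) = T (sph_eval x q).
Proof.
move=> x0 TL.
have TD : {morph T : v w / v + w} by move=> v w; have := TL 1 v w; rewrite !scale1r.
have TZ c v : T (c *: v) = c *: T v.
  by have := TL c v 0; rewrite addr0 (morph_add0 TD) addr0.
elim/sph_ind: q => [|p q hp hq|k v].
- by rewrite sph_map0 // !sph_eval0 // (morph_add0 TD).
- by rewrite sph_mapD // !sph_evalD // TD hp hq.
by rewrite sph_map_mono // !sph_eval_mono // TZ.
Qed.

Section Homog.
Variable V : zmodType.
Implicit Types p q : sph R d V.

Lemma sph_homog0 lambda : sph_homog lambda (0 : sph R d V).
Proof. by exists 0; [move=> k; rewrite fs0E eqxx|rewrite sph_pi0]. Qed.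

Lemma sph_homogD lambda p q :
  sph_homog lambda p -> sph_homog lambda q -> sph_homog lambda (p + q).
Proof.
move=> [f fl ->] [g gl ->]; exists (f + g); last by rewrite sph_piD.
move=> k; rewrite fsDE; have [f0|/fl //] := eqVneq (f k) 0.
by rewrite f0 add0r => /gl.
Qed.

Lemma sph_homogN lambda p : sph_homog lambda p -> sph_homog lambda (- p).
Proof.
move=> [f fl ->]; exists (- f); first by move=> k; rewrite fsNE oppr_eq0 => /fl.
by rewrite (morph_addN (@sph_piD R d V)).
Qed.

Lemma sph_homog_sum lambda (I : Type) (r : seq I) (P : pred I) (F : I -> sph R d V) :
  (forall i, P i -> sph_homog lambda (F i)) ->
  sph_homog lambda (\sum_(i <- r | P i) F i).
Proof.
move=> hF; elim/big_ind: _ => //; first exact: sph_homog0.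
by move=> p q; exact: sph_homogD.
Qed.

Lemma sph_homog_mono lambda (k : sexp R d) (v : V) :
  sexp_deg k = lambda -> sph_homog lambda (sph_mono k v).
Proof.
by move=> kl; exists (mono k v) => // j /=; case: (j =P k) => [->|_]; rewrite ?eqxx.
Qed.

Lemma mexp_deg_inc mu (alpha : mexp d) : mexp_deg (mexp_inc mu alpha) = (mexp_deg alpha).+1.
Proof.
rewrite /mexp_deg (bigD1 mu) //= [in RHS](bigD1 mu) //= ffunE eqxx addn1 addSn.
congr (_ + _).+1; apply: eq_bigr => nu numu.
by rewrite ffunE eq_sym (negbTE numu) addn0.
Qed.
Lemma mexp_deg_dec mu (alpha : mexp d) : (0 < alpha mu)%N ->
  mexp_deg alpha = (mexp_deg (mexp_dec mu alpha)).+1.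
Proof.
move=> a0; rewrite -(mexp_deg_inc mu); congr mexp_deg; apply/ffunP => nu.
by rewrite !ffunE subnK //; case: eqP => // <-.
Qed.

Lemma sph_homog_X mu lambda q :
  sph_homog (lambda - 1) q -> sph_homog lambda (sph_X mu q).
Proof.
elim/sph_homog_ind => [|p p' hp hp'|k v kl].
- by rewrite (morph_add0 (@sph_XD V mu)); exact: sph_homog0.
- by rewrite sph_XD; exact: sph_homogD.
rewrite sph_X_mono; apply: sph_homog_mono.
rewrite /sexp_deg /= mexp_deg_inc -natr1.
by move: kl; rewrite /sexp_deg; lra.
Qed.
End Homog.

Lemma sph_homog_map (V W : zmodType) (T : V -> W) lambda (q : sph R d V) :
  {morph T : v w / v + w} ->
  sph_homog lambda q -> sph_homog lambda (sph_map T q : sph R d W).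
Proof.
move=> TD; elim/sph_homog_ind => [|p p' hp hp'|k v kl].
- by rewrite sph_map0 //; exact: sph_homog0.
- by rewrite sph_mapD //; exact: sph_homogD.
by rewrite sph_map_mono //; apply: sph_homog_mono.
Qed.

Lemma sph_homog_d (V : lmodType R[i]) mu lambda (q : sph R d V) :
  sph_homog (lambda + 1) q -> sph_homog lambda (sph_d mu q).
Proof.
elim/sph_homog_ind => [|p p' hp hp'|k v kl].
- by rewrite (morph_add0 (@sph_dD V mu)); exact: sph_homog0.
- by rewrite sph_dD; exact: sph_homogD.
rewrite sph_d_mono; apply: sph_homogD.
  have [k0|k0] := posnP (k.1 mu); first by rewrite k0 mulr0n sph_mono0; exact: sph_homog0.
  apply: sph_homog_mono; move: kl; rewrite /sexp_deg /= (mexp_deg_dec k0) -natr1.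
  lra.
apply: sph_homog_mono; move: kl; rewrite /sexp_deg /= mexp_deg_inc -natr1.
lra.
Qed.

End SphCalculus.

(** * Interpolation on grids and injectivity of evaluation *)

Section Grid.
Variables (R : realType).

(** The matrix [w] is the inverse of a Vandermonde matrix.  The nodes are
    1, ..., n+1 rather than 0, ..., n in order that grid points be nonzero, so
    that spherical polynomials can be evaluated there. *)
Lemma moment_dual n : exists w : nat -> nat -> R, forall k m : 'I_n.+1,
  \sum_(j < n.+1) w k j * (j.+1)%:R ^+ m = (k == m)%:R.
Proof.
pose a : 'rV[R]_n.+1 := \row_j (j.+1)%:R.
pose V := Vandermonde n.+1 a.
have Vu : V \in unitmx.
  rewrite unitmxE unitfE det_Vandermonde prodf_seq_neq0.
  apply/allP => i _ /=; rewrite prodf_seq_neq0; apply/allP => j _ /=.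
  apply/implyP => ij; rewrite !mxE subr_eq0 eqr_nat eqSS.
  by rewrite neq_ltn ij orbT.
exists (fun k j => invmx V (inord j) (inord k)) => k m.
have /matrixP/(_ m k) := mulmxV Vu.
rewrite !mxE eq_sym => <-; apply: eq_bigr => j _.
by rewrite !mxE !inord_val mulrC.
Qed.

(** Lagrange interpolation, with the coefficients of the interpolating
    polynomial extracted by [moment_dual]. *)
Lemma poly_interp n : exists w : nat -> nat -> R, forall p : {poly R[i]},
  (size p <= n.+1)%N -> forall t : R,
  p.[t%:C] = \sum_(k < n.+1) \sum_(j < n.+1) (t ^+ k * w k j)%:C * p.[(j.+1)%:R].
Proof.
have [w wP] := moment_dual n; exists w => p sp t.
rewrite (horner_coef_wide _ sp); apply: eq_bigr => k _.
transitivity (\sum_(m < n.+1) p`_m * t%:C ^+ k * (k == m)%:R).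
  rewrite (bigD1 k) //= eqxx mulr1 big1 ?addr0 // => m mk.
  by rewrite eq_sym (negbTE mk) mulr0.
under [RHS]eq_bigr do rewrite (horner_coef_wide _ sp) mulr_sumr.
rewrite exchange_big /=; apply: eq_bigr => m _.
have -> : (k == m)%:R = ((k == m)%:R)%:C :> R[i] by rewrite rmorph_nat.
rewrite -wP rmorph_sum mulr_sumr; apply: eq_bigr => j _.
rewrite !rmorphM !rmorphXn /= rmorph_nat; ring.
Qed.

Variable d : nat.
Local Notation idx n := {ffun 'I_d -> 'I_n.+1}.

Definition xpow (x : 'rV[R]_d) (alpha : mexp d) : R := \prod_mu x 0 mu ^+ alpha mu.

(** Exponents bounded by n form a finite type; they include all exponents of
    total degree n. *)
Definition mexp_of n (a : idx n) : mexp d := [ffun mu => a mu : nat].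

Definition grid n (b : idx n) : 'rV[R]_d := \row_mu (b mu).+1%:R.

Lemma grid_neq0 n (b : idx n) : (0 < d)%N -> grid b != 0.
Proof.
move=> d0; apply/eqP => /rowP/(_ (Ordinal d0)); rewrite !mxE => /eqP.
by rewrite pnatr_eq0.
Qed.

(** The products of the one-variable dual weights extract any single
    coefficient from the values on the grid, because the sum over the grid of
    a product is the product of the sums. *)
Lemma xpow_grid_eq0 (V : lmodType R[i]) n (P : pred (idx n)) (v : idx n -> V) :
  (forall b : idx n, \sum_(a | P a) (xpow (grid b) (mexp_of a))%:C *: v a = 0) ->
  forall a, P a -> v a = 0.
Proof.
move=> h a Pa; have [w wP] := moment_dual n.
transitivity (\sum_(b : idx n) (\prod_mu w (a mu) (b mu))%:C *:
   \sum_(a | P a) (xpow (grid b) (mexp_of a))%:C *: v a); last first.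
  by rewrite big1 // => b _; rewrite h scaler0.
under eq_bigr do rewrite scaler_sumr.
rewrite exchange_big /=.
have E a' : \sum_(b : idx n) (\prod_mu w (a mu) (b mu))%:C *:
   ((xpow (grid b) (mexp_of a'))%:C *: v a') = (a == a')%:R *: v a'.
  under eq_bigr do rewrite scalerA -rmorphM.
  rewrite -scaler_suml -rmorph_sum /=.
  have -> : \sum_(b : idx n) (\prod_mu w (a mu) (b mu)) * xpow (grid b) (mexp_of a')
    = \sum_(b : idx n) \prod_mu (w (a mu) (b mu) * (b mu).+1%:R ^+ a' mu).
    apply: eq_bigr => b _; rewrite big_split /=; congr (_ * _).
    by apply: eq_bigr => mu _; rewrite !mxE ffunE.
  rewrite -(bigA_distr_bigA (fun mu (j : 'I_n.+1) => w (a mu) j * j.+1%:R ^+ a' mu)).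
  under eq_bigr do rewrite wP.
  have -> : \prod_i ((a i == a' i)%:R : R) = (a == a')%:R; last by rewrite rmorph_nat.
  have [->|aa'] := eqVneq a a'; first by rewrite big1 // => mu _; rewrite eqxx.
  have [mu amu] : exists mu, a mu != a' mu.
    apply/existsP; apply: contraNT aa' => /existsPn h'; apply/eqP/ffunP => mu.
    by apply/eqP/negPn/h'.
  by rewrite (bigD1 mu) //= (negbTE amu) mul0r.
rewrite (bigD1 a) //= E eqxx scale1r big1 ?addr0 // => a' /andP[_ a'a].
by rewrite E eq_sym (negbTE a'a) scale0r.
Qed.

Definition polyfun (G : 'rV[R]_d -> R[i]) : Prop :=
  exists s : seq (mexp d * R[i]), forall x, G x = \sum_(t <- s) (xpow x t.1)%:C * t.2.

Lemma eq_polyfun G G' : G =1 G' -> polyfun G -> polyfun G'.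
Proof. by move=> e [s hs]; exists s => x; rewrite -e hs. Qed.

Lemma polyfun0 : polyfun (fun=> 0).
Proof. by exists [::] => x; rewrite big_nil. Qed.

Lemma polyfunD G G' : polyfun G -> polyfun G' -> polyfun (fun x => G x + G' x).
Proof.
by move=> [s hs] [s' hs']; exists (s ++ s') => x; rewrite big_cat hs hs'.
Qed.

Lemma polyfun_sum (I : Type) (r : seq I) (G : I -> 'rV[R]_d -> R[i]) :
  (forall i, polyfun (G i)) -> polyfun (fun x => \sum_(i <- r) G i x).
Proof.
move=> hG; elim: r => [|i r IH].
  by apply: eq_polyfun polyfun0 => x; rewrite big_nil.
by apply: eq_polyfun (polyfunD (hG i) IH) => x; rewrite big_cons.
Qed.

Lemma polyfun_cst c : polyfun (fun=> c).
Proof.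
exists [:: ([ffun=> 0%N], c)] => x; rewrite big_seq1 /xpow big1 ?mul1r //.
by move=> mu _; rewrite ffunE expr0.
Qed.

Lemma polyfun_scale c G : polyfun G -> polyfun (fun x => c * G x).
Proof.
move=> [s hs]; exists [seq (t.1, c * t.2) | t <- s] => x.
by rewrite hs big_map mulr_sumr; apply: eq_bigr => t _; rewrite /= mulrCA.
Qed.

Lemma xpow_inc x mu (alpha : mexp d) : xpow x (mexp_inc mu alpha) = x 0 mu * xpow x alpha.
Proof.
rewrite /xpow (bigD1 mu) //= [in RHS](bigD1 mu) //= ffunE eqxx addn1 exprS -mulrA.
congr (_ * (_ * _)); apply: eq_bigr => nu numu.
by rewrite ffunE eq_sym (negbTE numu) addn0.
Qed.

Lemma polyfun_X mu k G : polyfun G -> polyfun (fun x => (x 0 mu ^+ k)%:C * G x).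
Proof.
elim: k G => [|k IH] G hG.
  by apply: eq_polyfun hG => x; rewrite expr0 mul1r.
have [s hs] := IH _ hG; exists [seq (mexp_inc mu t.1, t.2) | t <- s] => x.
rewrite exprS rmorphM -mulrA hs big_map mulr_sumr; apply: eq_bigr => t _ /=.
by rewrite xpow_inc rmorphM mulrA.
Qed.

Definition setc (y : 'rV[R]_d) (mu : 'I_d) (t : R) : 'rV[R]_d :=
  \row_nu if nu == mu then t else y 0 nu.

(** The coordinates of a list [s] are interpolated successively: the
    induction shows that G is polynomial in the coordinates of [s] when the
    others are frozen at an arbitrary point [y], since the interpolation nodes
    for a new coordinate only change [y]. *)
Lemma separately_polynomial n (G : 'rV[R]_d -> R[i]) :
  (forall x mu, exists2 p : {poly R[i]}, (size p <= n.+1)%N &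
     forall t : R, G (setc x mu t) = p.[t%:C]) -> polyfun G.
Proof.
move=> h; have [w wP] := poly_interp n.
pose ov (s : seq 'I_d) (y x : 'rV[R]_d) : 'rV[R]_d :=
  \row_nu if nu \in s then x 0 nu else y 0 nu.
suff H s : uniq s -> forall y, polyfun (fun x => G (ov s y x)).
  apply: eq_polyfun (H _ (enum_uniq 'I_d) 0) => x.
  by congr G; apply/rowP => nu; rewrite !mxE mem_enum.
elim: s => [_ y|mu s IH /= /andP[mus us] y].
  apply: eq_polyfun (polyfun_cst (G y)) => x.
  by congr G; apply/rowP => nu; rewrite !mxE.
have E x t : ov s (setc y mu t) x = setc (ov s y x) mu t.
  apply/rowP => nu; rewrite !mxE; have [->|//] := eqVneq nu mu.
  by rewrite (negbTE mus).
apply: (@eq_polyfun (fun x => \sum_(k < n.+1) (x 0 mu ^+ k)%:C *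
    \sum_(j < n.+1) (w k j)%:C * G (ov s (setc y mu j.+1%:R) x))); last first.
  apply: polyfun_sum => k; apply: polyfun_X; apply: polyfun_sum => j.
  by apply: polyfun_scale; exact: IH.
move=> x.
have -> : ov (mu :: s) y x = ov s (setc y mu (x 0 mu)) x.
  rewrite E; apply/rowP => nu; rewrite !mxE inE.
  by have [->|] := eqVneq nu mu.
rewrite E; have [p sp hp] := h (ov s y x) mu.
rewrite hp (wP _ sp); apply: eq_bigr => k _; rewrite mulr_sumr.
apply: eq_bigr => j _; rewrite E hp [in RHS]rmorphM -mulrA; congr (_ * (_ * p.[_])).
by rewrite rmorph_nat.
Qed.

Lemma xpow_scale x (s : R) alpha : xpow (s *: x) alpha = s ^+ mexp_deg alpha * xpow x alpha.
Proof.
rewrite /xpow /mexp_deg -prodrXr -big_split /=; apply: eq_bigr => mu _.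
by rewrite mxE exprMn.
Qed.

(** The dual weights of order N, applied to the values G(x), G(2x), ..., keep
    exactly the monomials of degree N, and by homogeneity they reproduce G(x). *)
Lemma homogeneous_polyfun N (G : 'rV[R]_d -> R[i]) :
  (forall x (s : R), 0 < s -> G (s *: x) = (s ^+ N)%:C * G x) -> polyfun G ->
  exists2 s : seq (mexp d * R[i]), (forall t, t \in s -> mexp_deg t.1 = N) &
    forall x, G x = \sum_(t <- s) (xpow x t.1)%:C * t.2.
Proof.
move=> hom [s hs].
exists [seq t <- s | mexp_deg t.1 == N] => [t|x].
  by rewrite mem_filter => /andP[/eqP].
pose M := (N + \sum_(t <- s) mexp_deg t.1)%N.
have NM : (N < M.+1)%N by rewrite ltnS leq_addr.
have sM t : t \in s -> (mexp_deg t.1 < M.+1)%N.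
  by move=> ts; rewrite ltnS /M (big_rem t) //= addnCA leq_addr.
have [w wP] := moment_dual M.
have wN m : (m < M.+1)%N -> \sum_(j < M.+1) w N j * (j.+1)%:R ^+ m = (N == m)%:R.
  by move=> mM; have := wP (Ordinal NM) (Ordinal mM).
transitivity (\sum_(j < M.+1) (w N j)%:C * G (j.+1%:R *: x)).
  under eq_bigr do rewrite hom // mulrA -rmorphM.
  by rewrite -mulr_suml -rmorph_sum /= wN // eqxx mul1r.
under eq_bigr do rewrite hs mulr_sumr.
rewrite exchange_big /= big_filter [RHS]big_mkcond /= big_seq [RHS]big_seq.
apply: eq_bigr => t ts.
under eq_bigr do rewrite xpow_scale mulrA -rmorphM mulrA.
rewrite -mulr_suml -rmorph_sum /= -mulr_suml wN ?sM //.
by rewrite eq_sym; case: eqP => _; rewrite ?mul1r ?mul0r.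
Qed.

Section Injectivity.
Variable V : lmodType R[i].
Implicit Types q : sph R d V.

(** Elements |x|^(lambda-n) P(x) with P homogeneous of degree n. *)
Definition sph_deg n lambda q := exists c : idx n -> V,
  q = \sum_(a | mexp_deg (mexp_of a) == n) sph_mono (mexp_of a, lambda - n%:R) (c a).

Lemma sph_deg0 n lambda : sph_deg n lambda 0.
Proof. by exists (fun=> 0); rewrite big1 // => a _; rewrite sph_mono0. Qed.

Lemma sph_degD n lambda p q :
  sph_deg n lambda p -> sph_deg n lambda q -> sph_deg n lambda (p + q).
Proof.
move=> [c ->] [c' ->]; exists (fun a => c a + c' a).
by rewrite -big_split /=; apply: eq_bigr => a _; rewrite sph_monoD.
Qed.

Lemma sph_deg_mono lambda alpha (v : V) :
  sph_deg (mexp_deg alpha) lambda (sph_mono (alpha, lambda - (mexp_deg alpha)%:R) v).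
Proof.
have le mu : (alpha mu < (mexp_deg alpha).+1)%N.
  by rewrite ltnS /mexp_deg (bigD1 mu) //= leq_addr.
pose a0 : idx (mexp_deg alpha) := [ffun mu => Ordinal (le mu)].
have a0E : mexp_of a0 = alpha by apply/ffunP => mu; rewrite !ffunE.
exists (fun a => if a == a0 then v else 0); rewrite (bigD1 a0) ?a0E //= eqxx.
by rewrite big1 ?addr0 // => a /andP[_ /negbTE ->]; rewrite sph_mono0.
Qed.

(** Multiply numerator and denominator by |x|^2 = x_1^2 + ... + x_d^2. *)
Lemma sph_deg_S2 n lambda q : sph_deg n lambda q -> sph_deg n.+2 lambda q.
Proof.
move=> [c ->]; elim/big_ind: _ => [||a /eqP an].
- exact: sph_deg0.
- by move=> p p'; exact: sph_degD.
have -> : lambda - n%:R = lambda - n.+2%:R + 2%:R.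
  by rewrite -addn2 natrD; ring.
rewrite -sph_mono_rel; elim/big_ind: _ => [||mu _].
- exact: sph_deg0.
- by move=> p p'; exact: sph_degD.
have dn : mexp_deg (mexp_inc mu (mexp_inc mu (mexp_of a))) = n.+2.
  by rewrite !mexp_deg_inc an.
by rewrite -{1 2}dn; exact: sph_deg_mono.
Qed.

Lemma sph_deg_add2 n k lambda q : sph_deg n lambda q -> sph_deg (k.*2 + n) lambda q.
Proof. by move=> h; elim: k => // k /sph_deg_S2; rewrite doubleS. Qed.

(** Only the parity of the degree of the numerator matters, since
    [sph_deg_S2] brings numerators of equal parity to a common degree. *)
Lemma sph_homog_parity lambda q : sph_homog lambda q -> exists N q0 q1,
  [/\ sph_deg N.*2 lambda q0, sph_deg N.*2.+1 lambda q1 & q = q0 + q1].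
Proof.
elim/sph_homog_ind => [|p p' [N [q0 [q1 [h0 h1 ->]]]] [M [r0 [r1 [g0 g1 ->]]]]|[alpha r] v].
- exists 0%N, 0, 0; split; [exact: sph_deg0|exact: sph_deg0|by rewrite addr0].
- exists (M + N)%N, (q0 + r0), (q1 + r1); split; last by rewrite addrACA.
  + apply: sph_degD; first by rewrite doubleD; exact: sph_deg_add2.
    by rewrite addnC doubleD; exact: sph_deg_add2.
  + apply: sph_degD; first by rewrite doubleD -addnS; exact: sph_deg_add2.
    by rewrite addnC doubleD -addnS; exact: sph_deg_add2.
rewrite /sexp_deg /= => kl.
have {kl} -> : r = lambda - (mexp_deg alpha)%:R by rewrite -kl; ring.
have := sph_deg_mono lambda alpha v.
move: (sph_mono _ _) => p.
rewrite -(odd_double_half (mexp_deg alpha)); case: (odd _) => h.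
  by exists (mexp_deg alpha)./2, 0, p; split; [exact: sph_deg0|exact: h|rewrite add0r].
by exists (mexp_deg alpha)./2, p, 0; split; [exact: h|exact: sph_deg0|rewrite addr0].
Qed.

Lemma enormN (x : 'rV[R]_d) : enorm (- x) = enorm x.
Proof. by congr Num.sqrt; apply: eq_bigr => mu _; rewrite mxE sqrrN. Qed.

Lemma enorm_gt0 (x : 'rV[R]_d) : x != 0 -> 0 < enorm x.
Proof.
move=> x0; have [mu xmu] : exists mu, x 0 mu != 0.
  apply/existsP; apply: contraNT x0 => /existsPn x0; apply/eqP/rowP => mu.
  by rewrite mxE; apply/eqP/negPn/x0.
rewrite sqrtr_gt0 (bigD1 mu) //= ltr_pwDl ?exprn_even_gt0 //.
by apply: sumr_ge0 => nu _; rewrite sqr_ge0.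
Qed.

Lemma enormZ (x : 'rV[R]_d) s : enorm (s *: x) = `|s| * enorm x.
Proof.
rewrite /enorm; under eq_bigr do rewrite mxE exprMn.
by rewrite -mulr_sumr sqrtrM ?sqr_ge0 // sqrtr_sqr.
Qed.

Lemma sqr_enorm (x : 'rV[R]_d) : enorm x ^+ 2 = \sum_mu x 0 mu ^+ 2.
Proof. by rewrite sqr_sqrtr // sumr_ge0 // => mu _; exact: sqr_ge0. Qed.

Lemma sph_deg_eval n lambda q : sph_deg n lambda q -> exists c : idx n -> V,
  q = \sum_(a | mexp_deg (mexp_of a) == n) sph_mono (mexp_of a, lambda - n%:R) (c a) /\
  forall x, x != 0 -> sph_eval x q = (enorm x `^ (lambda - n%:R))%:C *:
    \sum_(a | mexp_deg (mexp_of a) == n) (xpow x (mexp_of a))%:C *: c a.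
Proof.
move=> [c ->]; exists c; split=> // x x0.
rewrite sph_eval_sum // scaler_sumr; apply: eq_bigr => a _.
by rewrite sph_eval_mono // /sexp_eval /= scalerA -rmorphM mulrC.
Qed.

Lemma sph_deg_evalN n lambda q x : sph_deg n lambda q -> x != 0 ->
  sph_eval (- x) q = (-1) ^+ n *: sph_eval x q.
Proof.
move=> /sph_deg_eval[c [_ h]] x0; rewrite !h ?oppr_eq0 // enormN.
rewrite scalerA mulrC -scalerA; congr (_ *: _); rewrite scaler_sumr.
apply: eq_bigr => a /eqP an; rewrite -scaleN1r xpow_scale an.
by rewrite rmorphM rmorphXn rmorphN1 scalerA.
Qed.

Lemma sph_deg_inj n lambda q : (0 < d)%N -> sph_deg n lambda q ->
  (forall x, x != 0 -> sph_eval x q = 0) -> q = 0.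
Proof.
move=> d0 /sph_deg_eval[c [-> h]] q0.
have c0 a : mexp_deg (mexp_of a) == n -> c a = 0.
  apply: (xpow_grid_eq0 (P := fun a => mexp_deg (mexp_of a) == n)) => b.
  have g0 := grid_neq0 b d0.
  have /eqP := q0 _ g0; rewrite h // scaler_eq0 => /orP[|/eqP //].
  by rewrite fmorph_eq0 gt_eqF // powR_gt0 // enorm_gt0.
by rewrite big1 // => a /c0 ->; rewrite sph_mono0.
Qed.

(** Comparing the values at x and -x separates the two parities; each part is
    a nonzero power of |x| times a polynomial, which vanishes on the grid. *)
Lemma sph_eval_inj lambda q : (0 < d)%N -> sph_homog lambda q ->
  (forall x, x != 0 -> sph_eval x q = 0) -> q = 0.
Proof.
move=> d0 /sph_homog_parity[N [q0 [q1 [h0 h1 ->]]]] ev.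
have ev0 x : x != 0 -> sph_eval x q0 = 0.
  move=> x0; have Nx0 : - x != 0 by rewrite oppr_eq0.
  have := ev _ x0; have := ev _ Nx0; rewrite !sph_evalD //.
  rewrite (sph_deg_evalN h0) // (sph_deg_evalN h1) //.
  rewrite exprS -mul2n exprM sqrrN expr1n expr1n mulr1 scale1r scaleN1r.
  move=> /eqP; rewrite subr_eq0 => /eqP <- /eqP.
  by rewrite -mulr2n -scaler_nat scaler_eq0 pnatr_eq0 /= => /eqP.
have ev1 x : x != 0 -> sph_eval x q1 = 0.
  by move=> x0; have := ev _ x0; rewrite sph_evalD // ev0 // add0r.
by rewrite (sph_deg_inj d0 h0 ev0) (sph_deg_inj d0 h1 ev1) addr0.
Qed.

Lemma sph_eval_eq lambda p q : (0 < d)%N -> sph_homog lambda p -> sph_homog lambda q ->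
  (forall x, x != 0 -> sph_eval x p = sph_eval x q) -> p = q.
Proof.
move=> d0 hp hq e; apply/eqP; rewrite -subr_eq0; apply/eqP.
apply: (sph_eval_inj d0 (sph_homogD hp (sph_homogN hq))) => x x0.
by rewrite sph_evalD // sph_evalN // e // subrr.
Qed.
End Injectivity.
End Grid.

(** * Compact modules: projections, weights, finiteness of the spectrum *)

Section FsBig.
Variables (V : zmodType) (I : choiceType).

Lemma fsbig_only (f : I -> V) i :
  (forall j, j != i -> f j = 0) -> \sum_(j \in [set: I]) f j = f i.
Proof.
move=> h; rewrite (fsbigTE [fset i]%fset) ?big_seq_fset1 // => j.
by rewrite inE => /h.
Qed.

Lemma fsbig_addT (f g : I -> V) :
  finite_set [set i | f i != 0] -> finite_set [set i | g i != 0] ->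
  \sum_(i \in [set: I]) (f i + g i) =
  \sum_(i \in [set: I]) f i + \sum_(i \in [set: I]) g i.
Proof.
move=> ff fg.
pose D := (fset_set [set i | f i != 0] `|` fset_set [set i | g i != 0])%fset.
have hD k : k \notin D -> f k = 0 /\ g k = 0.
  rewrite in_fsetU negb_or (in_fset_set ff) (in_fset_set fg) => /andP[].
  by rewrite !notin_setE /= => /negP/negPn/eqP -> /negP/negPn/eqP ->.
rewrite !(fsbigTE D) ?big_split // => i /hD[f0 g0] //.
by rewrite f0 g0 addr0.
Qed.

Lemma fsbig_morph (W : zmodType) (T : V -> W) (f : I -> V) :
  {morph T : x y / x + y} -> finite_set [set i | f i != 0] ->
  T (\sum_(i \in [set: I]) f i) = \sum_(i \in [set: I]) T (f i).
Proof.
move=> TD ff; have T0 := morph_add0 TD.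
have hD k : k \notin fset_set [set i | f i != 0] -> f k = 0.
  by rewrite (in_fset_set ff) notin_setE /= => /negP/negPn/eqP.
rewrite !(fsbigTE (fset_set [set i | f i != 0])) //.
  exact: (big_morph T TD T0).
by move=> k /hD ->.
Qed.
End FsBig.

Section CompactModule.
Variables (R : realType) (d : nat) (H : lmodType R[i]).
Variable act : so R d -> H -> H.
Hypothesis hM : compact_module act.
Local Notation eig := (eigsp act).
Local Notation prj := (pr act).

Lemma act_lin X (c : R[i]) a b : act X (c *: a + b) = c *: act X a + act X b.
Proof. by case: (cm_module hM). Qed.
Lemma actD X : {morph act X : a b / a + b}.
Proof. by move=> a b; have := act_lin X 1 a b; rewrite !scale1r. Qed.
Lemma act0 X : act X 0 = 0.
Proof. exact: morph_add0 (@actD X). Qed.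
Lemma actZ X (c : R[i]) a : act X (c *: a) = c *: act X a.
Proof. by have := act_lin X c a 0; rewrite act0 !addr0. Qed.
Lemma act_linl (r : R) X Y a : act (r *: X + Y) a = r%:C *: act X a + act Y a.
Proof. by case: (cm_module hM). Qed.
Lemma actDl a : {morph act^~ a : X Y / X + Y}.
Proof. by move=> X Y; have := act_linl 1 X Y a; rewrite !scale1r. Qed.
Lemma act0l a : act 0 a = 0.
Proof. exact: (morph_add0 (@actDl a)). Qed.
Lemma actZl (r : R) X a : act (r *: X) a = r%:C *: act X a.
Proof. by have := act_linl r X 0 a; rewrite act0l !addr0. Qed.
Lemma act_sum X (I : Type) (r : seq I) (P : pred I) (F : I -> H) :
  act X (\sum_(i <- r | P i) F i) = \sum_(i <- r | P i) act X (F i).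
Proof. exact: (big_morph _ (@actD X) (act0 X)). Qed.
Lemma act_suml (I : Type) (r : seq I) (P : pred I) (F : I -> so R d) a :
  act (\sum_(i <- r | P i) F i) a = \sum_(i <- r | P i) act (F i) a.
Proof. exact: (big_morph (act^~ a) (@actDl a) (act0l a)). Qed.

Lemma eig0 D : eig D 0.
Proof. by rewrite /eigsp /= act0 scaler0. Qed.
Lemma eig_lin D (c : R[i]) a b : eig D a -> eig D b -> eig D (c *: a + b).
Proof.
by rewrite /eigsp /= act_lin => -> ->; rewrite scalerDr !scalerA mulrC.
Qed.
Lemma eigZ D (c : R[i]) a : eig D a -> eig D (c *: a).
Proof. by move=> h; rewrite -[_ *: _]addr0; apply: eig_lin h (eig0 _). Qed.
Lemma eigD D a b : eig D a -> eig D b -> eig D (a + b).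
Proof. by move=> h h'; rewrite -[a]scale1r; exact: eig_lin. Qed.

Lemma pr_decomp a : is_decomp act a (prj^~ a).
Proof.
have [c [ca _]] := cm_1 hM a.
by apply: (@xgetPex _ (fun=> 0) [set c | is_decomp act a c]); exists c.
Qed.

Lemma pr_unique a c : is_decomp act a c -> prj^~ a = c.
Proof.
move=> ac; have [c' [_ u]] := cm_1 hM a.
by rewrite -(u _ ac) -(u _ (pr_decomp a)).
Qed.

Lemma pr_in D a : eig D (prj D a).
Proof. by have [h _ _] := pr_decomp a; exact: h. Qed.
Lemma pr_fin a : finite_set [set D | prj D a != 0].
Proof. by case: (pr_decomp a). Qed.
Lemma pr_sum a : a = \sum_(D \in [set: R]) prj D a.
Proof. by case: (pr_decomp a). Qed.

Lemma pr_lin D (c : R[i]) a b : prj D (c *: a + b) = c *: prj D a + prj D b.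
Proof.
have E : is_decomp act (c *: a + b) (fun D => c *: prj D a + prj D b).
  split=> [E||]; first by apply: eig_lin; exact: pr_in.
    apply: (sub_finite_set _ (_ : finite_set
      ([set E | prj E a != 0] `|` [set E | prj E b != 0]))).
      move=> E /=; have [->|?] := eqVneq (prj E a) 0; last by left.
      by rewrite scaler0 add0r; right.
    by rewrite finite_setU; split; exact: pr_fin.
  have fa : finite_set [set E | c *: prj E a != 0].
    apply: (sub_finite_set _ (pr_fin a)) => E /=.
    by apply: contra_neq => ->; rewrite scaler0.
  rewrite fsbig_addT //; last exact: pr_fin.
  rewrite -pr_sum {1}(pr_sum a); congr (_ + _).
  rewrite (fsbig_morph (T := *:%R c)) //; last exact: pr_fin.
  by move=> x y; rewrite scalerDr.
exact: (congr1 (fun f => f D) (pr_unique E)).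
Qed.
Lemma prD D : {morph prj D : a b / a + b}.
Proof. by move=> a b; have := pr_lin D 1 a b; rewrite !scale1r. Qed.
Lemma pr0 D : prj D 0 = 0.
Proof. exact: morph_add0 (@prD D). Qed.

Lemma pr_eig D D' a : eig D a -> prj D' a = if D' == D then a else 0.
Proof.
move=> ha; suff E : is_decomp act a (fun D' => if D' == D then a else 0).
  exact: (congr1 (fun f => f D') (pr_unique E)).
split=> [E||]; first by case: eqP => [->//|_]; exact: eig0.
  apply: (sub_finite_set _ (finite_set1 D)) => E /=.
  by case: (E =P D) => // _; rewrite eqxx.
by rewrite (fsbig_only (i := D)) ?eqxx // => j /negbTE ->.
Qed.

(** Linear statements about H need only be checked on eigenvectors of D. *)
Lemma eigen_ind (Q : H -> Prop) : Q 0 ->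
  (forall (c : R[i]) a b, Q a -> Q b -> Q (c *: a + b)) ->
  (forall D a, eig D a -> Q a) -> forall a, Q a.
Proof.
move=> Q0 QL Qe a; rewrite (pr_sum a) /=.
elim/big_ind: _ => // [x y hx hy|D _].
  by rewrite -[x]scale1r; exact: QL.
exact: Qe (pr_in D a).
Qed.

Section Extension.
Variables (V : lmodType R[i]) (f : R -> H -> V).
Hypothesis fL : forall D (c : R[i]) a b, eig D a -> eig D b ->
  f D (c *: a + b) = c *: f D a + f D b.

(** The linear map that is given by f on the eigenspaces of D. *)
Definition eig_ext (a : H) : V := \sum_(D \in [set: R]) f D (prj D a).

Let f0 D : f D 0 = 0.
Proof.
have := fL 1 (eig0 D) (eig0 D); rewrite !scale1r addr0.
by move=> /(congr1 (fun x => x - f D 0)); rewrite addrK subrr.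
Qed.

Lemma eig_ext_fin a : finite_set [set D | f D (prj D a) != 0].
Proof.
by apply: (sub_finite_set _ (pr_fin a)) => D /=; apply: contra_neq => ->.
Qed.

Lemma eig_ext_lin (c : R[i]) a b : eig_ext (c *: a + b) = c *: eig_ext a + eig_ext b.
Proof.
rewrite /eig_ext (fsbig_morph (T := *:%R c)); last exact: eig_ext_fin.
  rewrite -fsbig_addT; last exact: eig_ext_fin.
    apply: eq_fsbigr => D _; rewrite pr_lin fL //; exact: pr_in.
  apply: (sub_finite_set _ (eig_ext_fin a)) => D /=.
  by apply: contra_neq => ->; rewrite scaler0.
by move=> x y; rewrite scalerDr.
Qed.

Lemma eig_ext_eig D a : eig D a -> eig_ext a = f D a.
Proof.
move=> ha; rewrite /eig_ext (fsbig_only (i := D)) ?(pr_eig _ ha) ?eqxx //.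
by move=> E ED; rewrite (pr_eig _ ha) (negbTE ED).
Qed.
End Extension.

(** Eigenvectors of ad D; the generators D, P, K and J have weights 0, 1, -1
    and 0. *)
Definition weight (X : so R d) (w : R) := br (so_D R d) X = w *: X.

Lemma weight_D : weight (so_D R d) 0.
Proof. by rewrite /weight br_e scale0r. Qed.
Lemma weight_P mu : weight (so_P R mu) 1.
Proof. by rewrite /weight br_DP scale1r. Qed.
Lemma weight_K mu : weight (so_K R mu) (-1).
Proof. by rewrite /weight br_DK scaleN1r. Qed.
Lemma weight_J mu nu : weight (so_J R mu nu) 0.
Proof. by rewrite /weight br_DJ scale0r. Qed.
Lemma weight_sum w (I : Type) (r : seq I) (P : pred I) (F : I -> so R d) :
  (forall i, P i -> weight (F i) w) -> weight (\sum_(i <- r | P i) F i) w.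
Proof.
move=> h; elim/big_ind: _ => // [|X Y]; rewrite /weight; first by rewrite br0r scaler0.
by rewrite brDr scalerDr => -> ->.
Qed.
Lemma weightZ w r X : weight X w -> weight (r *: X) w.
Proof. by rewrite /weight brZr => ->; rewrite !scalerA mulrC. Qed.

Lemma act_eig X w D a : weight X w -> eig D a -> eig (D + w) (act X a).
Proof.
move=> Xw Da; have [_ _ h] := cm_module hM.
have := h (so_D R d) X a; rewrite Xw actZl [act (so_D R d) a]Da actZ.
move=> /eqP; rewrite eq_sym subr_eq => /eqP; rewrite /eigsp /= => ->.
by rewrite -scalerDl -rmorphD addrC.
Qed.

(** A weight vector moves each eigenspace to a single eigenspace, so that one
    term of the sum defining the action on the product survives. *)
Lemma bar_act_weight X w v D : weight X w -> hbar act v ->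
  bar_act act X v D = act X (v (D - w)).
Proof.
move=> Xw hv; rewrite /bar_act.
have E D' := pr_eig D (act_eig Xw (hv D')).
rewrite (fsbig_only (i := D - w)) ?E ?subrK ?eqxx // => D' DD'.
rewrite E; case: eqP => // DE; move: DD'.
by rewrite DE addrK eqxx.
Qed.

Lemma hbar_act_weight X w v : weight X w -> hbar act v -> hbar act (bar_act act X v).
Proof.
move=> Xw hv D; rewrite (bar_act_weight _ Xw) //.
by have := act_eig Xw (hv (D - w)); rewrite subrK.
Qed.

Lemma mk_scalar (f : H -> R[i]) :
  (forall c a b, f (c *: a + b) = c * f a + f b) -> exists u : {scalar H}, u =1 f.
Proof.
move=> fL; pose u : {scalar H} := HB.pack f (GRing.isLinear.Build R[i] H R[i] *%R f fL).
by exists u.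
Qed.

Lemma edim_ge n (S : set H) (b : 'I_n -> H) : (forall i, S (b i)) -> lin_indep b ->
  (n%:R%:E <= edim S)%E.
Proof. by move=> Sb bi; apply: ereal_sup_ubound; exists n => //; exists b. Qed.

Lemma edim_ge0 (S : set H) : (0 <= edim S)%E.
Proof.
have := @edim_ge 0 S (fun i => match i with Ordinal _ h => False_rect _ (notF h) end).
by apply; [case|move=> c _ []].
Qed.

(** Each nonzero eigenspace contributes at least 1 to the sum of the
    dimensions, which converges. *)
Lemma spectrum_finite M :
  finite_set [set D | D <= M /\ exists2 v, eig D v & v != 0].
Proof.
apply: contrapT => inf; have := cm_2 hM M.
apply/negP; rewrite -leNgt leye_eq; apply/eqP/eq_infty => t.
have [n tn] : exists n : nat, t <= n%:R.
  exists (Num.bound t); have [t0|/ltW t0] := leP 0 t.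
    by apply/ltW; have := archi_boundP t0.
  by apply: le_trans t0 _.
have [D DS Dn] := infinite_set_fset n inf.
apply: esum_ge; exists [set` D].
  by split; [exact: finite_fset|move=> x /DS[]].
rewrite -fsbig_seq ?fset_uniq //=.
apply: (@le_trans _ _ (\sum_(i <- D) 1)%E).
  rewrite sumEFin lee_fin big_const_seq count_predT iter_addr_0.
  rewrite (le_trans tn) // ler_nat; exact: Dn.
rewrite big_seq [leRHS]big_seq; apply: lee_sum => E ED.
have [_ [v Ev v0]] := DS _ ED.
apply: (@edim_ge 1 _ (fun=> v)) => // c; rewrite big_ord_recl big_ord0 addr0.
move=> /eqP; rewrite scaler_eq0 (negbTE v0) orbF => /eqP c0 i.
by rewrite ord1.
Qed.
End CompactModule.

(** * Dual bases of the weight spaces *)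

Section Duality.
Variables (R : realType) (d : nat) (H : lmodType R[i]).
Variable act : so R d -> H -> H.
Hypothesis hM : compact_module act.
Local Notation eig := (eigsp act).
Local Notation prj := (pr act).

(** A single dimension is bounded by the convergent sum of dimensions. *)
Lemma eig_indep_bound D : exists N, forall n (b : 'I_n -> H),
  (forall i, eig D (b i)) -> lin_indep b -> (n <= N)%N.
Proof.
have le : (edim (eig D) <= \esum_(E in [set E : R | (E <= D)%R]) edim (eig E))%E.
  apply: esum_ge; exists [set D]; last by rewrite fsbig_set1.
  by split; [exact: finite_set1|move=> x /= ->].
have := le_lt_trans le (cm_2 hM D); have := edim_ge0 (eig D).
case E: (edim (eig D)) => [r| |] // _ _.
exists (Num.bound r) => n b be bi; have := edim_ge be bi.
rewrite E lee_fin => nr; rewrite -(ler_nat R) (le_trans nr) //.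
by apply/ltW/archi_boundP; rewrite (le_trans _ nr).
Qed.

(** A linearly independent family of maximal size spans. *)
Lemma eig_basis_exists D : exists n (b : 'I_n -> H),
  [/\ forall i, eig D (b i), lin_indep b &
      forall v, eig D v -> exists c : 'I_n -> R[i], v = \sum_i c i *: b i].
Proof.
pose P n := `[< exists b : 'I_n -> H, (forall i, eig D (b i)) /\ lin_indep b >].
have [N hN] := eig_indep_bound D.
have exP : exists n, P n.
  exists 0%N; apply/asboolP; exists (fun=> 0); split; first by case.
  by move=> c _ [].
have ubP n : P n -> (n <= N)%N by move=> /asboolP[b [be bi]]; exact: hN be bi.
case: (ex_maxnP exP ubP) => n /asboolP[b [be bi]] nmax.
exists n, b; split=> // v Dv.
pose b' (i : 'I_n.+1) := if unlift ord_max i is Some j then b j else v.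
have b'e i : eig D (b' i) by rewrite /b'; case: unliftP.
have : ~ lin_indep b'.
  move=> b'i; have /nmax : P n.+1 by apply/asboolP; exists b'.
  by rewrite ltnn.
move=> /existsNP[c /not_implyP[c0 /existsNP[i ci]]].
have := c0; rewrite (bigD1_ord ord_max) //= {1}/b' unlift_none.
under eq_bigr do rewrite /b' liftK.
move=> e; have cm : c ord_max != 0.
  apply/eqP => cm; apply: ci; case: (unliftP ord_max i) => [j ->|->] //.
  by apply: (bi (fun j => c (lift ord_max j))); rewrite cm scale0r add0r in e.
exists (fun j => - (c ord_max)^-1 * c (lift ord_max j)).
under eq_bigr do rewrite -scalerA; rewrite -scaler_sumr.
move: e => /eqP; rewrite addrC addr_eq0 => /eqP ->.
by rewrite scalerN scaleNr opprK scalerA mulVf // scale1r.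
Qed.

Lemma hdual_pr D (u : {scalar H}) a : hdual act D u -> u a = u (prj D a).
Proof.
move=> hu; move: a; apply: (eigen_ind hM) => [|c a b ha hb|E a Ea].
- by rewrite (pr0 hM).
- by rewrite (pr_lin hM) !linearP ha hb.
by rewrite (pr_eig hM _ Ea); case: eqP => [//|/eqP DE]; rewrite linear0 (hu E) // eq_sym.
Qed.

(** The dual functionals are the coordinates of the projection to the
    eigenspace, so that they vanish on all the other eigenspaces. *)
Lemma eig_dual_basis D : exists n (b : 'I_n -> H) (u : 'I_n -> {scalar H}),
  [/\ forall i, eig D (b i), forall i, hdual act D (u i) &
      forall v, eig D v -> v = \sum_i u i v *: b i].
Proof.
have [n [b [be bi bs]]] := eig_basis_exists D.
have /choice[c hc] : forall v, exists c : 'I_n -> R[i], prj D v = \sum_i c i *: b i.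
  by move=> v; apply: bs; exact: pr_in.
have cL i k v w : c (k *: v + w) i = k * c v i + c w i.
  apply/eqP; rewrite -subr_eq0; apply/eqP; move: i; apply: bi.
  under eq_bigr do rewrite scalerBl scalerDl -scalerA.
  by rewrite sumrB big_split -scaler_sumr -!hc (pr_lin hM) /= subrr.
have /choice[u hu] : forall i, exists u : {scalar H}, u =1 c^~ i.
  by move=> i; apply: mk_scalar => k v w; exact: cL.
exists n, b, u; split=> // [i E a ED Ea|v Dv].
  rewrite hu; move: i; apply: bi; rewrite -hc (pr_eig hM _ Ea).
  by rewrite eq_sym (negbTE ED).
under eq_bigr do rewrite hu.
by rewrite -hc (pr_eig hM _ Dv) eqxx.
Qed.

(** Equalities in H can be tested on the functionals in the summands of its
    restricted dual, because of the dual bases. *)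
Lemma hdual_sep v : (forall D (u : {scalar H}), hdual act D u -> u v = 0) -> v = 0.
Proof.
move=> h; rewrite (pr_sum hM v) fsbig1 // => D _.
have [n [b [u [_ ud e]]]] := eig_dual_basis D.
rewrite (e _ (pr_in hM D v)) big1 // => i _.
by rewrite -hdual_pr // (h _ _ (ud i)) scale0r.
Qed.

Lemma hdual_eq v w :
  (forall D (u : {scalar H}), hdual act D u -> u v = u w) -> v = w.
Proof.
move=> h; apply/eqP; rewrite -subr_eq0; apply/eqP.
by apply: hdual_sep => D u /h; rewrite linearB /= => ->; rewrite subrr.
Qed.

Lemma hdual_hvee D (u : {scalar H}) : hdual act D u -> hvee act u.
Proof.
move=> hu; apply: (sub_finite_set _ (finite_set1 D)) => E /= [a Ea].
by have [//|ED] := eqVneq E D; rewrite (hu _ _ ED Ea) eqxx.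
Qed.

Lemma hpair_hdual D (u : {scalar H}) v : hdual act D u -> hbar act v ->
  hpair u v = u (v D).
Proof. by move=> hu hv; apply: fsbig_only => E ED; exact: hu ED (hv E). Qed.
End Duality.

(** * Derivatives and moduli of complex-valued functions *)

Section ComplexDerivative.
Variable R : realType.
Implicit Types (f g : R -> R[i]) (h : R -> R) (t : R) (c l : R[i]).

Lemma ReD (a b : R[i]) : complex.Re (a + b) = complex.Re a + complex.Re b.
Proof. by case: a b => ? ? [? ?]. Qed.
Lemma ImD (a b : R[i]) : complex.Im (a + b) = complex.Im a + complex.Im b.
Proof. by case: a b => ? ? [? ?]. Qed.
Lemma ReM (a b : R[i]) : complex.Re (a * b) =
  complex.Re a * complex.Re b - complex.Im a * complex.Im b.
Proof. by case: a b => ? ? [? ?]. Qed.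
Lemma ImM (a b : R[i]) : complex.Im (a * b) =
  complex.Re a * complex.Im b + complex.Im a * complex.Re b.
Proof. by case: a b => ? ? [? ?]. Qed.
Lemma complex_eq (a b : R[i]) : complex.Re a = complex.Re b ->
  complex.Im a = complex.Im b -> a = b.
Proof. by case: a b => ? ? [? ?] /= -> ->. Qed.

Lemma is_derive_ext h h' t (l l' : R) : is_derive t 1 h l ->
  (forall s, h s = h' s) -> l = l' -> is_derive t 1 h' l'.
Proof. by move=> hl /funext <- <-. Qed.

Lemma cderive_ext f g t l : (forall s, f s = g s) ->
  is_cderive f t l -> is_cderive g t l.
Proof. by move=> /funext ->. Qed.

Lemma cderive_eq f t l l' : l = l' -> is_cderive f t l -> is_cderive f t l'.
Proof. by move=> ->. Qed.

Lemma cderive_uniq f t l l' : is_cderive f t l -> is_cderive f t l' -> l = l'.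
Proof.
move=> [fr fi] [gr gi]; apply: complex_eq.
  by rewrite -(derive_val (is_derive := fr)) -(derive_val (is_derive := gr)).
by rewrite -(derive_val (is_derive := fi)) -(derive_val (is_derive := gi)).
Qed.

Lemma cderive_cst c t : is_cderive (fun=> c) t 0.
Proof. by split; exact: is_derive_cst. Qed.

Lemma cderive_real h t (l : R) : is_derive t 1 h l -> is_cderive (fun s => (h s)%:C) t l%:C.
Proof. by move=> hl; split=> //=; exact: is_derive_cst. Qed.

Lemma cderiveD f g t l l' : is_cderive f t l -> is_cderive g t l' ->
  is_cderive (fun s => f s + g s) t (l + l').
Proof.
move=> [fr fi] [gr gi]; split.
  by apply: is_derive_ext (is_deriveD fr gr) _ _ => [s|]; rewrite ReD.
by apply: is_derive_ext (is_deriveD fi gi) _ _ => [s|]; rewrite ImD.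
Qed.

Lemma cderiveM f g t l l' : is_cderive f t l -> is_cderive g t l' ->
  is_cderive (fun s => f s * g s) t (l * g t + f t * l').
Proof.
move=> [fr fi] [gr gi]; split.
  apply: is_derive_ext (is_deriveB (is_deriveM fr gr) (is_deriveM fi gi)) _ _ => [s|].
    by rewrite ReM.
  by rewrite ReD !ReM /GRing.scale /=; ring.
apply: is_derive_ext (is_deriveD (is_deriveM fr gi) (is_deriveM fi gr)) _ _ => [s|].
  by rewrite ImM.
by rewrite ImD !ImM /GRing.scale /=; ring.
Qed.

Lemma cderiveZ c f t l : is_cderive f t l -> is_cderive (fun s => c * f s) t (c * l).
Proof.
move=> fl; apply: cderive_eq (cderiveM (cderive_cst c t) fl).
by rewrite mul0r add0r.
Qed.

Lemma cderive_sum (I : Type) (r : seq I) (P : pred I) (f : I -> R -> R[i]) t (l : I -> R[i]) :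
  (forall i, P i -> is_cderive (f i) t (l i)) ->
  is_cderive (fun s => \sum_(i <- r | P i) f i s) t (\sum_(i <- r | P i) l i).
Proof.
move=> h; elim: r => [|i r IH].
  rewrite big_nil; apply: cderive_ext (cderive_cst 0 t) => s.
  by rewrite big_nil.
rewrite big_cons; case: ifPn => Pi.
  apply: cderive_ext (cderiveD (h _ Pi) IH) => s.
  by rewrite big_cons Pi.
by apply: cderive_ext IH => s; rewrite big_cons (negbTE Pi).
Qed.

Lemma cderive0_cst f : (forall t, is_cderive f t 0) -> forall s t, f s = f t.
Proof.
move=> h s t; apply: complex_eq.
  by apply: (@is_derive_0_is_cst _ (fun s => complex.Re (f s))) => u; case: (h u).
by apply: (@is_derive_0_is_cst _ (fun s => complex.Im (f s))) => u; case: (h u).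
Qed.

Lemma cabsE c : (cabs c)%:C = `|c|.
Proof. by rewrite /cabs normc_def. Qed.
Lemma cabs_ge0 c : 0 <= cabs c.
Proof. by rewrite -lecR cabsE normr_ge0. Qed.
Lemma cabsD c l : cabs (c + l) <= cabs c + cabs l.
Proof. by rewrite -lecR rmorphD /= !cabsE ler_normD. Qed.
Lemma cabsM c l : cabs (c * l) = cabs c * cabs l.
Proof. by apply: complexI; rewrite rmorphM /= !cabsE normrM. Qed.
Lemma cabsN c : cabs (- c) = cabs c.
Proof. by rewrite /cabs normrN. Qed.
Lemma cabs0 : cabs 0 = 0 :> R.
Proof. by rewrite /cabs normr0. Qed.
Lemma cabs_eq0 c : cabs c = 0 -> c = 0.
Proof. by move=> c0; apply/eqP; rewrite -normr_eq0 -cabsE c0. Qed.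
Lemma cabs_real (r : R) : cabs r%:C = `|r|.
Proof. by apply: complexI; rewrite cabsE normc_def /= expr0n addr0 sqrtr_sqr. Qed.
Lemma cabs_sum (I : Type) (r : seq I) (P : pred I) (F : I -> R[i]) :
  cabs (\sum_(i <- r | P i) F i) <= \sum_(i <- r | P i) cabs (F i).
Proof.
elim/big_rec2: _ => [|i x y _ h]; first by rewrite cabs0.
by apply: le_trans (cabsD _ _) _; rewrite lerD2l.
Qed.
Lemma Re_le_cabs c : `|complex.Re c| <= cabs c.
Proof. by rewrite -lecR cabsE normc_ge_Re. Qed.
Lemma Im_le_cabs c : `|complex.Im c| <= cabs c.
Proof.
have := Re_le_cabs (c * 'i%C); rewrite ReM /= mulr0 mulr1 sub0r normrN.
move=> /le_trans; apply; rewrite cabsM.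
suff -> : cabs 'i%C = 1 :> R by rewrite mulr1.
by apply: complexI; rewrite cabsE normc_def /= expr0n add0r expr1n sqrtr1.
Qed.
(** Together with [Re_le_cabs] and [Im_le_cabs], this reduces estimates of
    complex numbers to real ones. *)
Lemma cabs_le_ReIm c : cabs c <= `|complex.Re c| + `|complex.Im c|.
Proof.
case: c => a b; have -> : a +i* b = a%:C + b%:C * 'i%C.
  by apply: complex_eq; rewrite ?ReD ?ImD ?ReM ?ImM /=; ring.
apply: le_trans (cabsD _ _) _; rewrite cabsM !cabs_real.
rewrite ReD ImD ReM ImM /= !mulr0 !mul0r !mulr1 !subr0 !addr0 add0r lerD2l.
suff -> : cabs 'i%C = 1 :> R by rewrite mulr1.
by apply: complexI; rewrite cabsE normc_def /= expr0n add0r expr1n sqrtr1.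
Qed.

Lemma derive_quadratic h t : (exists C d, 0 < d /\ forall s, `|s| < d ->
  `|h (t + s)| <= C * s ^+ 2) -> is_derive t 1 h 0.
Proof.
move=> [C0 [dl [dl0 hC0]]].
pose C := `|C0| + 1; have C_gt0 : 0 < C by rewrite /C ltr_wpDl.
have hC s : `|s| < dl -> `|h (t + s)| <= C * s ^+ 2.
  move=> /hC0 /le_trans; apply; rewrite ler_wpM2r ?sqr_ge0 // /C.
  by rewrite (le_trans (ler_norm _)) // lerDl.
have ht : h t = 0.
  apply/eqP; rewrite -normr_le0; have := hC 0.
  by rewrite normr0 addr0 expr0n mulr0; apply.
have cv : (fun s => s^-1 *: (h (s *: 1 + t) - h t)) @ 0^' --> (0 : R).
  apply/cvgrPdist_lt => e e0.
  have : \forall s \near (0 : R)^', s != 0 by exact: nbhs_dnbhs_neq.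
  have : \forall s \near (0 : R)^', `|s| < Num.min dl (e / C).
    apply: dnbhs0_lt; rewrite lt_min dl0 /=; exact: divr_gt0.
  apply: filterS2 => s; rewrite lt_min => /andP[sd se] s0.
  rewrite ht subr0 sub0r normrN normrZ normfV [s *: 1]mulr1 addrC.
  have s_gt0 : 0 < `|s| by rewrite normr_gt0.
  rewrite mulrC ltr_pdivrMr //; apply: le_lt_trans (hC _ sd) _.
  by rewrite -(real_normK (num_real s)) expr2 mulrA ltr_pM2r // mulrC -ltr_pdivlMr.
split; first by apply/cvg_ex; exists 0.
exact: cvg_lim cv.
Qed.

(** The first-order bound that turns O(h^2) errors in space into O(s^2) errors
    along a curve. *)
Lemma derive_lipschitz h t (l : R) : is_derive t 1 h l ->
  \forall s \near (0 : R), `|h (t + s) - h t| <= (`|l| + 1) * `|s|.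
Proof.
move=> hl; have dh : derivable h t 1 by exact: ex_derive.
have cv : (fun s => s^-1 *: (h (s *: 1 + t) - h t)) @ 0^' --> l.
  by have := derive_val (is_derive := hl) => <-.
have /cvgrPdist_lt /(_ _ ltr01) := cv.
rewrite !near_withinE; apply: filterS => s hs.
have [->|s0] := eqVneq s 0; first by rewrite addr0 subrr normr0 mulr0.
have := hs s0; rewrite [s *: 1]mulr1 (addrC s t) => {}hs.
have s_gt0 : 0 < `|s| by rewrite normr_gt0.
rewrite -ler_pdivrMr // mulrC -normfV -normrM.
set q := _ * _ in hs *; have -> : q = l - (l - q) by rewrite opprB addrC subrK.
by rewrite (le_trans (ler_normB _ _)) // lerD2l ltW.
Qed.
End ComplexDerivative.

(** * Real analytic functions are differentiable along curves *)

Section Analytic.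
Variable R : realType.

(** Convergence along finite sets bounds all finite partial sums uniformly,
    since any finite set is a difference of two sets of which one contains F0
    and the other is contained in it.  Applied separately to the terms whose
    real, or imaginary, part has a given sign, this bounds the sums of moduli. *)
Lemma csum_bounded (I : choiceType) (c : I -> R[i]) l : has_csum c l ->
  exists B : R, forall F : {fset I}, \sum_(i <- F) cabs (c i) <= B.
Proof.
move=> h; have [F0 hF0] := h 1 ltr01.
pose B1 := cabs l + 1 + \sum_(i <- F0) cabs (c i).
have b1 (F : {fset I}) : cabs (\sum_(i <- F) c i) <= B1.
  have -> : \sum_(i <- F) c i =
      (\sum_(i <- (F0 `|` F)%fset) c i - l) + l - \sum_(i <- (F0 `\` F)%fset) c i.
    rewrite subrK [X in _ = X - _](big_fsetID _ (fun x => x \in F)) /=.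
    have -> : [fset x in (F0 `|` F) | x \in F]%fset = F.
      by apply/fsetP => x; rewrite !inE; case: (x \in F); rewrite ?orbT ?andbF.
    have -> : [fset x in (F0 `|` F) | x \notin F]%fset = (F0 `\` F)%fset.
      apply/fsetP => x; rewrite !inE; case: (x \in F); rewrite ?orbF ?andbF ?andbT //.
    by rewrite addrK.
  rewrite (le_trans (cabsD _ _)) // cabsN; apply: lerD.
    rewrite (le_trans (cabsD _ _)) // addrC lerD2l ltW //.
    by apply: hF0; exact: fsubsetUl.
  rewrite (le_trans (cabs_sum _ _ _)) // [leRHS](big_fsetID _ (fun x => x \in F)) /=.
  have -> : [fset x in F0 | x \notin F]%fset = (F0 `\` F)%fset.
    by apply/fsetP => x; rewrite !inE andbC.
  rewrite lerDr; apply: sumr_ge0 => i _; exact: cabs_ge0.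
have part (p : R[i] -> R) : (forall a b, p (a + b) = p a + p b) ->
    (forall a, `|p a| <= cabs a) ->
    forall F : {fset I}, \sum_(i <- F) `|p (c i)| <= B1 + B1.
  move=> pD pa F; have p0 : p 0 = 0 by apply: (addIr (p 0)); rewrite -pD !add0r.
  rewrite (big_fsetID _ (fun i => 0 <= p (c i))) /=.
  apply: lerD.
    set G := [fset _ in _ | _]%fset.
    have -> : \sum_(i <- G) `|p (c i)| = p (\sum_(i <- G) c i).
      rewrite (big_morph p pD p0) big_seq [RHS]big_seq; apply: eq_bigr => i.
      by rewrite !inE => /andP[_ /ger0_norm].
    by rewrite (le_trans (ler_norm _)) // (le_trans (pa _)) // b1.
  set G := [fset _ in _ | _]%fset.
  have -> : \sum_(i <- G) `|p (c i)| = - p (\sum_(i <- G) c i).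
    rewrite (big_morph p pD p0) big_seq [in RHS]big_seq -sumrN; apply: eq_bigr => i.
    by rewrite !inE -ltNge => /andP[_ /ltr0_norm].
  by rewrite (le_trans (ler_norm _)) // normrN (le_trans (pa _)) // b1.
exists ((B1 + B1) + (B1 + B1)) => F.
apply: (@le_trans _ _ (\sum_(i <- F) (`|complex.Re (c i)| + `|complex.Im (c i)|))).
  by apply: ler_sum => i _; exact: cabs_le_ReIm.
rewrite big_split /=; apply: lerD; apply: part.
- by move=> a b; rewrite ReD.
- exact: Re_le_cabs.
- by move=> a b; rewrite ImD.
- exact: Im_le_cabs.
Qed.

Variables (d n : nat).
Local Notation mat := 'M[R]_(n, d).
Local Notation multi := 'M[nat]_(n, d).

(** At the radius rho the power series is absolutely bounded; a term of total
    degree at least 2 is smaller by a factor (eta/rho)^2 at distance eta, and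
    only the constant and the d n linear terms remain. *)
Lemma analytic_first_order (A : set mat) (f : mat -> R[i]) (p : mat) :
  real_analytic A f -> A p -> exists (L : 'I_n -> 'I_d -> R[i]) (C r : R), 0 < r /\
  forall (eta : R) (x : mat), eta < r -> (forall i j, `|x i j - p i j| <= eta) ->
  cabs (f x - f p - \sum_i \sum_j (x i j - p i j)%:C * L i j) <= C * eta ^+ 2.
Proof.
move=> fA /fA[r0 [c [r0_gt0 hc]]].
pose rho := r0 / 2; have rho_gt0 : 0 < rho by rewrite divr_gt0.
have rho_r0 : rho < r0 by rewrite /rho; lra.
pose deg (al : multi) := (\sum_i \sum_j al i j)%N.
pose pw (x : mat) (al : multi) : R := \prod_i \prod_j (x i j - p i j) ^+ al i j.
have pw_le (x : mat) al (eta : R) : (forall i j, `|x i j - p i j| <= eta) -> `|pw x al| <= eta ^+ deg al.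
  move=> hx; rewrite /pw normr_prod /deg -prodrXr; apply: ler_prod => i _.
  rewrite normr_ge0 normr_prod -prodrXr /=; apply: ler_prod => j _.
  by rewrite normr_ge0 normrX /= lerXn2r ?nnegrE // (le_trans (normr_ge0 _) (hx i j)).
have [B hB] : exists B : R, forall F : {fset multi},
    \sum_(al <- F) cabs (c al) * rho ^+ deg al <= B.
  (* All coordinates of x0 differ from those of p by rho > 0, so that the terms
     of the series at x0 have the moduli |c al| rho^deg al. *)
  pose x0 : mat := \matrix_(i, j) (p i j + rho).
  have /hc/csum_bounded[B hB] : forall i j, `|x0 i j - p i j| < r0.
    by move=> i j; rewrite mxE addrC addKr gtr0_norm.
  exists B => F; apply: le_trans (hB F); apply: ler_sum => al _.
  rewrite cabsM cabs_real ler_wpM2l ?cabs_ge0 // -/(pw x0 al).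
  rewrite /pw /deg -prodrXr; under eq_bigr do rewrite -prodrXr.
  under [X in _ <= `|X|]eq_bigr do under eq_bigr do rewrite mxE addrC addKr.
  exact: ler_norm.
pose dl (q : 'I_n * 'I_d) : multi := \matrix_(i, j) ((i, j) == q : nat).
pose L i j := c (dl (i, j)).
have dl_inj : injective dl.
  move=> [i j] q /matrixP/(_ i j); rewrite !mxE eqxx.
  by case: ((i, j) =P q).
(* E lists the exponents of total degree at most 1. *)
pose E : seq multi := 0 :: [seq dl q | q <- enum {: 'I_n * 'I_d}].
have Eu : uniq E.
  rewrite /= map_inj_uniq // enum_uniq andbT; apply/negP => /mapP[[i j] _].
  by move=> /matrixP/(_ i j); rewrite !mxE eqxx.
have degE al : al \notin E -> (2 <= deg al)%N.
  rewrite inE negb_or => /andP[al0 alE].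
  have [[i0 j0] aij] : exists q : 'I_n * 'I_d, al q.1 q.2 != 0%N.
    apply/existsP; apply: contraNT al0 => /existsPn h; apply/eqP/matrixP => i j.
    by rewrite mxE; apply/eqP/negPn/(h (i, j)).
  have degp : deg al = (\sum_q al q.1 q.2)%N by rewrite /deg pair_big.
  rewrite leqNgt; apply: contra alE => dal.
  have alE : al = dl (i0, j0).
    apply/matrixP => i j; rewrite mxE.
    move: dal; rewrite degp (bigD1 (i0, j0)) //=.
    case: eqP => [[-> ->]|/eqP ij].
      by move: aij => /=; rewrite -lt0n /=; set m := (\sum_(i1 | _) _)%N; lia.
    rewrite (bigD1 (i, j)) //=; move: aij => /=.
    by rewrite -lt0n; set m := (\sum_(i1 | _) _)%N; lia.
  by apply/mapP; exists (i0, j0); rewrite ?mem_enum.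
have main (eta : R) (x : mat) : eta <= rho -> (forall i j, `|x i j - p i j| <= eta) ->
  cabs (f x - c 0 - \sum_i \sum_j (x i j - p i j)%:C * L i j) <= B / rho ^+ 2 * eta ^+ 2.
  move=> er hx; apply/ler_addgt0Pr => e e0.
  have [F0 hF0] : exists F0 : {fset multi}, forall F, (F0 `<=` F)%fset ->
      cabs (\sum_(al <- F) c al * (pw x al)%:C - f x) < e.
    apply: hc => // i j.
    exact: le_lt_trans (hx i j) (le_lt_trans er rho_r0).
  pose F := (F0 `|` seq_fset tt E)%fset.
  have FE : [fset al in F | al \in E]%fset = seq_fset tt E.
    have inF al : (al \in F) = (al \in F0) || (al \in E) by rewrite in_fsetU seq_fsetE.
    apply/fsetP => al; rewrite seq_fsetE; apply/idP/idP => [|alE].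
      by rewrite in_fset => /andP[].
    by rewrite in_fset; apply/andP; split; rewrite ?inF ?alE ?orbT.
  have sE : \sum_(al <- seq_fset tt E) c al * (pw x al)%:C =
      c 0 + \sum_i \sum_j (x i j - p i j)%:C * L i j.
    have pE : perm_eq (seq_fset tt E) E.
      by apply: (uniq_perm (fset_uniq _) Eu) => al; rewrite seq_fsetE.
    rewrite (perm_big E pE) /=.
    rewrite big_cons big_map big_enum /=; congr (_ + _).
      rewrite /pw big1 ?mulr1 // => i _; rewrite big1 // => j _.
      by rewrite mxE expr0.
    rewrite pair_big /=; apply: eq_bigr => -[i j] _; rewrite mulrC /L /=.
    congr (_%:C * _); rewrite /pw pair_big /= (bigD1 (i, j)) //= mxE eqxx expr1.
    by rewrite big1 ?mulr1 // => -[i' j'] /negbTE ij; rewrite mxE ij expr0.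
  have -> : f x - c 0 - \sum_i \sum_j (x i j - p i j)%:C * L i j =
      - (\sum_(al <- F) c al * (pw x al)%:C - f x)
      + \sum_(al <- [fset al in F | al \notin E]%fset) c al * (pw x al)%:C.
    rewrite (big_fsetID _ (fun x => x \in E)) /= FE sE; ring.
  rewrite (le_trans (cabsD _ _)) // cabsN addrC; apply: lerD; last first.
    by apply/ltW/hF0; exact: fsubsetUl.
  rewrite (le_trans (cabs_sum _ _ _)) //.
  apply: (@le_trans _ _ (\sum_(al <- [fset al in F | al \notin E]%fset)
      (eta / rho) ^+ 2 * (cabs (c al) * rho ^+ deg al))); last first.
    rewrite -mulr_sumr expr_div_n mulrC mulrCA mulrA [leRHS]mulrC mulrA.
    rewrite ler_wpM2r ?invr_ge0 ?sqr_ge0 // ler_wpM2l ?sqr_ge0 //.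
  rewrite big_seq [leRHS]big_seq; apply: ler_sum => al.
  rewrite in_fset => /andP[_ /degE dal]; rewrite cabsM cabs_real mulrCA.
  rewrite ler_wpM2l ?cabs_ge0 // (le_trans (pw_le _ _ _ hx)) //.
  rewrite -(subnKC dal) !exprD mulrA -exprMn divfK ?gt_eqF //.
  have eta0 : 0 <= eta.
    case: (pickP (fun q : 'I_n * 'I_d => true)) => [[i j] _|none].
      exact: le_trans (normr_ge0 _) (hx i j).
    by move: dal; rewrite /deg pair_big /= big_pred0.
  by rewrite ler_wpM2l ?sqr_ge0 // lerXn2r ?nnegrE // ltW.
have fp : f p = c 0.
  have := main 0 p (ltW rho_gt0); rewrite expr0n mulr0 => h.
  have {}h : cabs (f p - c 0 - \sum_i \sum_j (p i j - p i j)%:C * L i j) <= 0.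
    by apply: h => i j; rewrite subrr normr0.
  move: h; rewrite [X in _ - X]big1 ?subr0 => [h|i _]; last first.
    by rewrite big1 // => j _; rewrite subrr mul0r.
  apply/eqP; rewrite -subr_eq0; apply/eqP/cabs_eq0/eqP.
  by rewrite eq_le h cabs_ge0.
exists L, (B / rho ^+ 2), rho; split=> // eta x /ltW er hx.
by rewrite fp; exact: main.
Qed.

(** By [analytic_first_order] the function is differentiable along all curves
    with a derivative that is linear in the velocity; the coordinate lines
    identify this linear form with the given partial derivatives. *)
Lemma analytic_chain (A : set mat) (f : mat -> R[i]) (D : mat -> 'I_n -> 'I_d -> R[i]) :
  real_analytic A f ->
  (forall p i j, A p -> is_cderive (fun s => f (p + s *: delta_mx i j)) 0 (D p i j)) ->
  forall (gam : R -> mat) t (gam' : mat), A (gam t) ->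
  (forall i j, is_derive t 1 (fun s => gam s i j) (gam' i j)) ->
  is_cderive (fun s => f (gam s)) t (\sum_i \sum_j (gam' i j)%:C * D (gam t) i j).
Proof.
move=> fA fD gam t gam' Ap hg.
have [L [C [r [r0 hL]]]] := analytic_first_order fA Ap.
have chain (g : R -> mat) (s0 : R) (g' : mat) : g s0 = gam t ->
    (forall i j, is_derive s0 1 (fun s => g s i j) (g' i j)) ->
    is_cderive (fun s => f (g s)) s0 (\sum_i \sum_j (g' i j)%:C * L i j).
  move=> gs0 gd; set p := gam t in gs0 Ap hL *.
  pose lin s := f p + \sum_i \sum_j (g s i j - p i j)%:C * L i j.
  have lind : is_cderive lin s0 (\sum_i \sum_j (g' i j)%:C * L i j).
    rewrite -[X in is_cderive _ _ X]add0r; apply: cderiveD; first exact: cderive_cst.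
    apply: cderive_sum => i _; apply: cderive_sum => j _.
    apply: cderive_eq (cderiveM (cderive_real (_ : is_derive s0 1 _ (g' i j))) (cderive_cst _ s0)).
      by rewrite mulr0 addr0.
    by apply: is_derive_ext (is_deriveB (gd i j) (is_derive_cst (p i j) s0 1)) _ _ => //; rewrite subr0.
  have rem : exists C d, 0 < d /\ forall s, `|s| < d ->
      cabs (f (g (s0 + s)) - lin (s0 + s)) <= C * s ^+ 2.
    pose K := \sum_i \sum_j (`|g' i j| + 1).
    have K0 : 0 <= K.
      by apply: sumr_ge0 => i _; apply: sumr_ge0 => j _; rewrite addr_ge0.
    have lip : \forall s \near (0 : R), forall i j, `|g (s0 + s) i j - p i j| <= K * `|s|.
      apply: (@filter_forall R _ (fun i s => forall j, `|g (s0 + s) i j - p i j| <= K * `|s|) (nbhs (0 : R)) _) => i.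
      apply: (@filter_forall R _ (fun j s => `|g (s0 + s) i j - p i j| <= K * `|s|) (nbhs (0 : R)) _) => j.
      have := derive_lipschitz (gd i j); apply: filterS => s hs.
      rewrite -gs0 (le_trans hs) // ler_wpM2r // /K (bigD1 i) //= (bigD1 j) //=.
      rewrite -addrA lerDl addr_ge0 //; first by apply: sumr_ge0 => ? _; rewrite addr_ge0.
      by apply: sumr_ge0 => ? _; apply: sumr_ge0 => ? _; rewrite addr_ge0.
    have [d0 /= d0_gt0 hd] := lip.
    exists (C * K ^+ 2), (Num.min d0 (r / (K + 1))); split.
      by rewrite lt_min d0_gt0 divr_gt0 // ltr_wpDl.
    move=> s; rewrite lt_min => /andP[sd sr].
    have hs : forall i j, `|g (s0 + s) i j - p i j| <= K * `|s|.
      by apply: hd; rewrite /ball /= sub0r normrN.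
    have Ks : K * `|s| < r.
      have K1 : 0 < K + 1 by rewrite ltr_wpDl.
      move: sr; rewrite ltr_pdivlMr // mulrC; apply: le_lt_trans.
      by rewrite ler_wpM2r // lerDl.
    have := hL _ _ Ks hs; rewrite exprMn real_normK ?num_real // mulrA.
    by rewrite /lin opprD addrA.
  have [C' [dd [dd0 hrem]]] := rem.
  have remd : is_cderive (fun s => f (g s) - lin s) s0 0.
    split; apply: derive_quadratic; exists C', dd; split=> // s /hrem.
      by apply: le_trans; exact: Re_le_cabs.
    by apply: le_trans; exact: Im_le_cabs.
  have := cderiveD remd lind; rewrite add0r; apply: cderive_ext => s.
  by rewrite subrK.
have LE i j : L i j = D (gam t) i j.
  apply: cderive_uniq (fD _ i j Ap).
  have := chain (fun s => gam t + s *: delta_mx i j) 0 (delta_mx i j).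
  rewrite scale0r addr0 => /(_ erefl) h.
  apply: cderive_eq (h _); last first.
    move=> k l.
    have h1 := is_deriveM (is_derive_id (0 : R) (1 : R))
      (is_derive_cst (delta_mx i j k l : R) (0 : R) (1 : R)).
    apply: is_derive_ext (is_deriveD (is_derive_cst (gam t k l) (0 : R) (1 : R)) h1) _ _.
      by move=> s; rewrite !mxE.
    by rewrite /GRing.scale /=; ring.
  rewrite (bigD1 i) //= (bigD1 j) //= !mxE !eqxx mul1r.
  rewrite [X in _ + X + _]big1 => [|l lj]; last by rewrite mxE (negbTE lj) andbF mul0r.
  rewrite [X in _ + X]big1 ?addr0 // => k ki.
  by rewrite big1 // => l _; rewrite mxE (negbTE ki) mul0r.
have := chain gam t gam' erefl hg.
by under eq_bigr do under eq_bigr do rewrite LE.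
Qed.
End Analytic.

(** * Periodic solutions of linear systems with constant coefficients *)

Section PeriodicODE.
Variable R : realType.
Implicit Types (g : R -> R[i]) (t b : R).

Definition cis (b : R) : R[i] := cos b +i* sin b.

Lemma cisD b c : cis (b + c) = cis b * cis c.
Proof.
by apply: complex_eq; rewrite ?ReM ?ImM /= ?cosD ?sinD //; ring.
Qed.
Lemma cis0 : cis 0 = 1 :> R[i].
Proof. by rewrite /cis cos0 sin0. Qed.

Lemma cderive_cis b t : is_cderive (fun s => cis (b * s)) t ('i%C * b%:C * cis (b * t)).
Proof.
have hb : is_derive t (1 : R) (fun s : R => b * s) b.
  apply: is_derive_ext (is_deriveM (is_derive_cst b t (1 : R)) (is_derive_id t (1 : R))) _ _ => //.
  by rewrite /GRing.scale /=; ring.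
split.
  apply: is_derive_ext (is_derive1_comp (is_derive_cos (b * t)) hb) _ _ => //.
  by rewrite !(ReM, ImM) /=; ring.
apply: is_derive_ext (is_derive1_comp (is_derive_sin (b * t)) hb) _ _ => //.
by rewrite !(ReM, ImM) /=; ring.
Qed.

Lemma cis_period (k : int) t : cis (k%:~R * (t + pi *+ 2)) = cis (k%:~R * t).
Proof.
have N m (u : R) : cis (u + (pi *+ 2) *+ m) = cis u.
  elim: m u => [|m IH] u; first by rewrite mulr0n addr0.
  by rewrite mulrSr addrA /cis cosD2pi sinD2pi; exact: IH.
case: k => m.
  by rewrite mulrDr -[_ * (pi *+ 2)]/(m%:R * _) mulr_natl N.
rewrite NegzE mulrNz -[in LHS](N m.+1); congr cis.
by rewrite -[m.+1%:~R]/(m.+1%:R) -mulr_natl; ring.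
Qed.

(** The exponential of al t, through the real exponential and trigonometric
    functions. *)
Definition cexp (al : R[i]) t : R[i] :=
  (expR (complex.Re al * t))%:C * cis (complex.Im al * t).

Lemma cexp0 al : cexp al 0 = 1.
Proof. by rewrite /cexp !mulr0 expR0 cis0 mulr1. Qed.

Lemma cderive_cexp al t : is_cderive (cexp al) t (al * cexp al t).
Proof.
have hb : is_derive t (1 : R) (fun s : R => complex.Re al * s) (complex.Re al).
  apply: is_derive_ext (is_deriveM (is_derive_cst (complex.Re al) t (1 : R)) (is_derive_id t (1 : R))) _ _ => //.
  by rewrite /GRing.scale /=; ring.
have h1 := is_derive1_comp (is_derive_expR (complex.Re al * t)) hb.
apply: cderive_eq (cderiveM (cderive_real h1) (cderive_cis _ t)).
by rewrite rmorphM /cexp [X in _ = X * _](complexE al); ring.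
Qed.

Lemma cexpN al t : cexp (- al) t * cexp al t = 1.
Proof.
rewrite /cexp; case: al => a b /=.
rewrite mulrACA -rmorphM -expRD -cisD -!mulrDl !addNr !mul0r.
by rewrite expR0 cis0 mulr1.
Qed.

(** The modulus forces the real part of [al] to vanish, and
    cos (2 pi f) = 1 excludes a nonzero fractional part f of the imaginary part. *)
Lemma cexp_period al : cexp al (pi *+ 2) = 1 -> exists k : int, al = 'i%C * (k%:~R)%:C.
Proof.
case: al => a b; rewrite /cexp /= => h.
have pi0 : (0 : R) < pi *+ 2 by rewrite pmulrn_lgt0 ?pi_gt0.
have hr : expR (a * pi *+ 2) * cos (b * pi *+ 2) = 1.
  by have /(congr1 (@complex.Re R)) := h; rewrite ReM /= mul0r subr0 -!mulrnAr.
have hi : expR (a * pi *+ 2) * sin (b * pi *+ 2) = 0.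
  by have /(congr1 (@complex.Im R)) := h; rewrite ImM /= mul0r addr0 -!mulrnAr.
have s0 : sin (b * pi *+ 2) = 0.
  by move/eqP: hi; rewrite mulf_eq0 gt_eqF ?expR_gt0 //= => /eqP.
have c1 : cos (b * pi *+ 2) = 1.
  have : cos (b * pi *+ 2) ^+ 2 = 1 by have := cos2Dsin2 (b * pi *+ 2); rewrite s0 expr0n addr0.
  move=> /eqP; rewrite sqrf_eq1 => /orP[/eqP //|/eqP cN].
  by move: hr; rewrite cN mulrN1 => h1; have := expR_gt0 (a * pi *+ 2); lra.
have a0 : a = 0.
  move: hr; rewrite c1 mulr1 -[X in _ = X]expR0 => /expR_inj.
  by rewrite -mulrnAr => /eqP; rewrite mulf_eq0 (gt_eqF pi0) orbF => /eqP.
pose k := Num.floor b; exists k.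
have fk : 0 <= b - k%:~R < 1.
  have := ge_floor b; have := lt_succ_floor b; rewrite -/k intrD => h1 h2.
  by apply/andP; split; lra.
suff bk : b = k%:~R by rewrite a0 {1}bk; apply: complex_eq; rewrite ?ReM ?ImM /=; ring.
have cf : cos ((b - k%:~R) * pi *+ 2) = 1.
  have := cis_period k; move=> /(_ 0); rewrite mulr0 cis0 add0r => hk.
  have : cis (b * pi *+ 2) = cis ((b - k%:~R) * pi *+ 2) * cis (k%:~R * (pi *+ 2)).
    by rewrite -cisD; congr cis; rewrite -!mulrnAr; ring.
  by rewrite hk mulr1 => /(congr1 (@complex.Re R)) /=; rewrite c1 => <-.
have sf : sin ((b - k%:~R) * pi) = 0.
  move: cf; rewrite cos_mulr2n => cf; have := cos2Dsin2 ((b - k%:~R) * pi) => e.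
  by apply/eqP; rewrite -sqrf_eq0; apply/eqP; lra.
have [f0|f0] := eqVneq (b - k%:~R) 0; first by lra.
have : 0 < sin ((b - k%:~R) * pi).
  apply: sin_gt0_pi; rewrite mulr_gt0 ?pi_gt0 //=; last by rewrite lt_neqAle eq_sym f0; case/andP: fk.
  by rewrite gtr_pMl ?pi_gt0 //; case/andP: fk.
by rewrite sf ltxx.
Qed.

(** Trigonometric polynomials with frequencies in [S]. *)
Definition trig (S : seq int) g : Prop :=
  exists c : int -> R[i], forall t, g t = \sum_(n <- S) c n * cis (n%:~R * t).

(** A particular trigonometric solution exists except for a resonant term with
    al = i k.  After subtracting it, g is exp (al t) times an affine function,
    whose slope vanishes by periodicity; and exp (al t) itself has to be
    periodic unless its coefficient is zero. *)
Lemma trig_ode (S : seq int) g (h : R -> R[i]) (al : R[i]) : uniq S -> trig S h ->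
  (forall t, is_cderive g t (al * g t + h t)) ->
  (forall t, g (t + pi *+ 2) = g t) ->
  (forall k : int, al = 'i%C * (k%:~R)%:C -> k \in S) -> trig S g.
Proof.
move=> Su [c hc] gd gper alS.
pose w (n : int) : R[i] := 'i%C * (n%:~R)%:C - al.
pose c1 n := if w n == 0 then 0 else c n / w n.
pose g0 t := \sum_(n <- S) c1 n * cis (n%:~R * t).
have g0d t : is_cderive g0 t (\sum_(n <- S) c1 n * ('i%C * (n%:~R)%:C * cis (n%:~R * t))).
  by apply: cderive_sum => n _; apply: cderiveZ; exact: cderive_cis.
have g0per t : g0 (t + pi *+ 2) = g0 t.
  by apply: eq_bigr => n _; rewrite cis_period.
pose res t := \sum_(n <- S) (if w n == 0 then c n else 0) * cis (n%:~R * t).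
(* Variation of constants: f is constant up to the resonant term. *)
pose f t := cexp (- al) t * (g t - g0 t).
have fd t : is_cderive f t (cexp (- al) t * res t).
  have g0d' : is_cderive (fun s => - g0 s) t (- \sum_(n <- S) c1 n * ('i%C * (n%:~R)%:C * cis (n%:~R * t))).
    apply: cderive_ext (cderive_eq _ (cderiveZ (-1) (g0d t))) => [s|]; exact: mulN1r.
  apply: cderive_eq (cderiveM (cderive_cexp (- al) t) (cderiveD (gd t) g0d')).
  rewrite hc /res /g0.
  have -> : \sum_(n <- S) (if w n == 0 then c n else 0) * cis (n%:~R * t) =
      \sum_(n <- S) c n * cis (n%:~R * t) - \sum_(n <- S) c1 n * w n * cis (n%:~R * t).
    rewrite -sumrB; apply: eq_bigr => n _; rewrite -mulrBl; congr (_ * _).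
    by rewrite /c1; case: eqP => [_|/eqP w0]; rewrite ?mul0r ?subr0 // divfK ?subrr.
  have -> : \sum_(n <- S) c1 n * w n * cis (n%:~R * t) =
      \sum_(n <- S) c1 n * ('i%C * (n%:~R)%:C * cis (n%:~R * t))
      - al * \sum_(n <- S) c1 n * cis (n%:~R * t).
    rewrite mulr_sumr -sumrB; apply: eq_bigr => n _; rewrite /w; ring.
  ring.
have gE t : g t = g0 t + f t * cexp al t.
  by rewrite /f mulrAC cexpN mul1r addrC subrK.
have [[k alk]|nok] := pselect (exists k : int, al = 'i%C * (k%:~R)%:C).
  have kS := alS _ alk.
  have wk n : (w n == 0) = (n == k).
    rewrite /w subr_eq0 alk; apply/eqP/eqP => [|->//].
    move=> /(congr1 (@complex.Im R)); rewrite !ImM /= !mul0r !add0r !mul1r.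
    by move/intr_inj.
  have cE t : cexp al t = cis (k%:~R * t).
    have -> : cexp al t = cexp (0 +i* k%:~R) t.
      by congr (cexp _ t); rewrite alk; apply: complex_eq; rewrite ?ReM ?ImM /=; ring.
    by rewrite /cexp /= mul0r expR0 mul1r.
  have fE t : f t = f 0 + c k * t%:C.
    have tt : is_derive t (1 : R) (fun s : R => s) 1 by exact: is_derive_id.
    have F' t' : is_cderive (fun s => f s + (-1) * (c k * s%:C)) t' 0.
      have tt' : is_derive t' (1 : R) (fun s : R => s) 1 by exact: is_derive_id.
      apply: cderive_eq (cderiveD (fd t') (cderiveZ (-1) (cderiveZ (c k) (cderive_real tt')))).
      rewrite /res (bigD1_seq k) //= wk eqxx big1 ?addr0; last first.
        by move=> n /negbTE nk; rewrite wk nk mul0r.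
      by rewrite -cE mulrCA cexpN; ring.
    have := cderive0_cst F' t 0.
    rewrite mulr0 mulr0 addr0 => <-; ring.
  have ck : c k = 0.
    have := gper 0; rewrite add0r !gE fE cE.
    have := g0per 0; rewrite add0r => ->; have := cis_period k 0; rewrite add0r mulr0 cis0 => ->.
    rewrite cexp0 !mulr1 => /addrI /eqP; rewrite -subr_eq0 addrC addrA addNr add0r mulf_eq0.
    by move=> /orP[/eqP //|]; rewrite fmorph_eq0 mulrn_eq0 /= gt_eqF ?pi_gt0.
  exists (fun n => c1 n + (if n == k then f 0 else 0)) => t.
  rewrite gE fE ck mul0r addr0 cE.
  under [RHS]eq_bigr do rewrite mulrDl.
  rewrite big_split /=; congr (_ + _).
  rewrite (bigD1_seq k) //= eqxx big1 ?addr0 //.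
  by move=> n /negbTE nk; rewrite nk mul0r.
have wn n : w n == 0 = false.
  by apply/eqP => /eqP; rewrite subr_eq0 => /eqP e; apply: nok; exists n.
have fE t : f t = f 0.
  apply: cderive0_cst => s; apply: cderive_eq (fd s).
  by rewrite /res big1 ?mulr0 // => n _; rewrite wn mul0r.
have f0 : f 0 = 0.
  have := gper 0; rewrite !gE !fE g0per cexp0 mulr1 => /addrI /eqP.
  rewrite add0r -subr_eq0 -{2}[f 0]mulr1 -mulrBr mulf_eq0 => /orP[/eqP //|].
  by rewrite subr_eq0 => /eqP /cexp_period /nok.
by exists c1 => t; rewrite gE fE f0 mul0r addr0.
Qed.

(** Look at a coordinate of an eigenvector of maximal modulus. *)
Lemma eigenvalue_bound m (A : 'M[R[i]]_m) a : eigenvalue A a ->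
  cabs a <= \sum_i \sum_j cabs (A i j).
Proof.
move=> /eigenvalueP[v vA v0].
have [j0 vj0] : exists j, v 0 j != 0.
  apply/existsP; apply: contraNT v0 => /existsPn h; apply/eqP/rowP => j.
  by rewrite mxE; apply/eqP/negPn/h.
pose j := [arg max_(k > j0) cabs (v 0 k)]%O.
have jmax k : cabs (v 0 k) <= cabs (v 0 j).
  by rewrite /j; case: arg_maxP => // l _ h; exact: h.
have vj : 0 < cabs (v 0 j).
  apply: lt_le_trans (jmax j0); rewrite lt_neqAle cabs_ge0 andbT eq_sym.
  by apply: contra vj0 => /eqP /cabs_eq0 ->.
rewrite -(ler_pM2r vj) -cabsM.
have /rowP/(_ j) := vA; rewrite !mxE => <-.
apply: le_trans (cabs_sum _ _ _) _; rewrite mulr_suml; apply: ler_sum => i _.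
rewrite cabsM mulrC; apply: ler_pM; rewrite ?cabs_ge0 //.
by rewrite (bigD1 j) //= lerDl sumr_ge0 // => k _; exact: cabs_ge0.
Qed.

Definition freqs N : seq int := [seq k%:Z - N%:Z | k <- iota 0 N.*2.+1].
Lemma freqs_uniq N : uniq (freqs N).
Proof. by rewrite map_inj_uniq ?iota_uniq // => a b; lia. Qed.
Lemma mem_freqs N (k : int) : (`|k| <= N)%N -> k \in freqs N.
Proof.
move=> kN; apply/mapP; exists (absz (k + N%:Z)%R); last by lia.
by rewrite mem_iota; lia.
Qed.
Lemma freqs_mem N (k : int) : k \in freqs N -> (`|k| <= N)%N.
Proof. by move=> /mapP[a]; rewrite mem_iota => h ->; lia. Qed.

(** By Cayley-Hamilton the product of the operators d/dt - z over the roots z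
    of the characteristic polynomial kills every combination of the g_i.  The
    factors are removed one at a time by [trig_ode]; the frequencies come from
    eigenvalues, which are bounded by the entries of the matrix. *)
Lemma periodic_system (I : finType) (A : I -> I -> R[i]) (g : I -> R -> R[i]) N :
  (forall i t, is_cderive (g i) t (\sum_j A i j * g j t)) ->
  (forall i t, g i (t + pi *+ 2) = g i t) ->
  \sum_i \sum_j cabs (A i j) <= N%:R -> forall i, trig (freqs N) (g i).
Proof.
move=> gd gper AN i0.
have [m cardI] : exists m, #|I| = m.+1.
  by exists #|I|.-1; rewrite prednK //; apply/card_gt0P; exists i0.
pose e (k : 'I_m.+1) : I := enum_val (cast_ord (esym cardI) k).
pose e' (i : I) : 'I_m.+1 := cast_ord cardI (enum_rank i).
have ee' : cancel e' e by move=> i; rewrite /e /e' cast_ordK enum_rankK.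
have e'e : cancel e e' by move=> k; rewrite /e /e' enum_valK cast_ordKV.
have sumE (V : zmodType) (F : I -> V) : \sum_i F i = \sum_k F (e k).
  by rewrite (reindex e) //; exists e' => k _; [exact: e'e|exact: ee'].
pose B : 'M[R[i]]_m.+1 := \matrix_(k, l) A (e k) (e l).
pose gr (r : 'rV[R[i]]_m.+1) t := \sum_k r 0 k * g (e k) t.
have grd r t : is_cderive (gr r) t (gr (r *m B) t).
  have -> : gr (r *m B) t = \sum_k r 0 k * \sum_j A (e k) j * g j t.
    rewrite /gr; under [RHS]eq_bigr do rewrite sumE mulr_sumr.
    rewrite exchange_big /=; apply: eq_bigr => l _; rewrite mxE mulr_suml.
    by apply: eq_bigr => k _; rewrite mxE mulrA.
  by apply: cderive_sum => k _; apply: cderiveZ; exact: gd.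
have [s hs] := closed_field_poly_normal (char_poly B).
rewrite (monicP (char_poly_monic B)) scale1r in hs.
have CH : \prod_(z <- s) (B - z%:M) = 0.
  have := Cayley_Hamilton B; rewrite hs rmorph_prod /= => e0; rewrite -[RHS]e0.
  by apply: eq_bigr => z _; rewrite rmorphB /= horner_mx_X horner_mx_C.
have sN z (k : int) : z \in s -> z = 'i%C * (k%:~R)%:C -> (`|k| <= N)%N.
  move=> zs zk; have : eigenvalue B z by rewrite eigenvalue_root_char hs root_prod_XsubC.
  move=> /eigenvalue_bound; rewrite zk cabsM cabs_real.
  have -> : cabs 'i%C = 1 :> R.
    by apply: complexI; rewrite cabsE normc_def /= expr0n add0r expr1n sqrtr1.
  rewrite mul1r -intr_norm => h; rewrite -(ler_nat R) -[X in X <= _]/((absz k)%:Z%:~R) abszE.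
  apply: le_trans h _; apply: le_trans _ AN.
  rewrite sumE; apply: ler_sum => a _; rewrite sumE; apply: ler_sum => b _.
  by rewrite mxE.
suff H r : r *m \prod_(z <- s) (B - z%:M) = 0 -> trig (freqs N) (gr r).
  have [c hc] := H (delta_mx 0 (e' i0)) (etrans (congr1 _ CH) (mulmx0 _ _)).
  exists c => t; rewrite -hc /gr (bigD1 (e' i0)) //= mxE !eqxx mul1r ee' big1 ?addr0 //.
  by move=> k /negbTE ki; rewrite mxE ki mul0r.
have {hs CH} : {subset s <= s} by [].
move: {1 3}s => s'; elim: s' r => [|z s' IH] r ss.
  rewrite big_nil mulmx1 => r0; exists (fun=> 0) => t.
  rewrite /gr r0 !big1 // => [k _|k _]; first by rewrite mul0r.
  by rewrite mxE mul0r.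
rewrite big_cons mulmxA => h.
have {}IH := IH _ _ h.
apply: (trig_ode (al := z) (freqs_uniq N) (IH _)).
- by move=> y ys; apply: ss; rewrite inE ys orbT.
- move=> t; apply: cderive_eq (grd r t).
  rewrite mulmxBr mul_mx_scalar /gr mulr_sumr -big_split /=.
  by apply: eq_bigr => k _; rewrite !mxE; ring.
- by move=> t; apply: eq_bigr => k _; rewrite gper.
- by move=> k zk; apply: mem_freqs; apply: (sN z) => //; apply: ss; exact: mem_head.
Qed.
End PeriodicODE.

(** * Functions on the sphere of finite type under rotations *)

Section SphereFunctions.
Variables (R : realType) (d : nat) (I : finType) (lambda : R).
Variables (F : I -> 'rV[R]_d -> R[i]) (DF : I -> 'I_d -> 'rV[R]_d -> R[i]).
Variable A : 'I_d -> 'I_d -> I -> I -> R[i].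
Hypothesis F_chain : forall i (gam : R -> 'rV[R]_d) t (gam' : 'rV[R]_d), gam t != 0 ->
  (forall nu, is_derive t 1 (fun s => gam s 0 nu) (gam' 0 nu)) ->
  is_cderive (fun s => F i (gam s)) t (\sum_nu (gam' 0 nu)%:C * DF i nu (gam t)).
Hypothesis F_euler : forall i (x : 'rV[R]_d), x != 0 ->
  \sum_nu (x 0 nu)%:C * DF i nu x = lambda%:C * F i x.
Hypothesis F_rot : forall nu mu i (x : 'rV[R]_d), x != 0 ->
  (x 0 nu)%:C * DF i mu x - (x 0 mu)%:C * DF i nu x = \sum_j A nu mu i j * F j x.

(** Along t |-> e^t x, Euler's equation reads f' = lambda f. *)
Lemma euler_homogeneous i (x : 'rV[R]_d) s : x != 0 -> 0 < s -> F i (s *: x) = (s `^ lambda)%:C * F i x.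
Proof.
move=> x0 s0.
pose gam (t : R) := expR t *: x.
have gam0 t : gam t != 0 by rewrite scaler_eq0 negb_or x0 andbT gt_eqF ?expR_gt0.
have gd t : is_cderive (fun u => F i (gam u)) t (lambda%:C * F i (gam t)).
  rewrite -F_euler //; apply: F_chain => // nu.
  apply: is_derive_ext (is_deriveM (is_derive_expR t) (is_derive_cst (x 0 nu) t (1 : R))) _ _.
    by move=> u; rewrite mxE.
  by rewrite mxE /GRing.scale /=; ring.
pose h t := cexp (- lambda%:C) t * F i (gam t).
have hd t : is_cderive h t 0.
  apply: cderive_eq (cderiveM (cderive_cexp _ t) (gd t)); ring.
have := cderive0_cst hd (ln s) 0.
rewrite /h cexp0 mul1r /gam expR0 scale1r lnK ?posrE // => <-.
have -> : (s `^ lambda)%:C = cexp lambda%:C (ln s).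
  by rewrite /cexp /= mul0r cis0 mulr1 /powR gt_eqF.
by rewrite mulrA [_ * cexp _ _]mulrC cexpN mul1r.
Qed.

Definition great_circle (f : 'rV[R]_d) (mu : 'I_d) (t : R) : 'rV[R]_d :=
  cos t *: f + sin t *: delta_mx 0 mu.

(** A bound for the frequencies on all great circles considered. *)
Definition rot_bound : nat :=
  Num.bound (\sum_nu \sum_mu \sum_i \sum_j cabs (A nu mu i j)).

Lemma great_circle_mu (f : 'rV[R]_d) mu t : f 0 mu = 0 -> great_circle f mu t 0 mu = sin t.
Proof. by move=> fmu; rewrite !mxE fmu !eqxx mulr0 add0r mulr1. Qed.

Lemma great_circle_other f mu nu t : nu != mu -> great_circle f mu t 0 nu = cos t * f 0 nu.
Proof. by move=> /negbTE h; rewrite !mxE h andbF mulr0 addr0. Qed.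

Lemma great_circle_norm (f : 'rV[R]_d) mu t : f 0 mu = 0 -> \sum_nu f 0 nu ^+ 2 = 1 ->
  \sum_nu great_circle f mu t 0 nu ^+ 2 = 1.
Proof.
move=> fmu f1; rewrite (bigD1 mu) //= great_circle_mu //.
under eq_bigr do rewrite great_circle_other // exprMn.
move: f1; rewrite (bigD1 mu) //= fmu expr0n add0r -mulr_sumr => ->.
by rewrite mulr1 addrC cos2Dsin2.
Qed.

Lemma great_circle_enorm (f : 'rV[R]_d) mu t : f 0 mu = 0 -> \sum_nu f 0 nu ^+ 2 = 1 -> enorm (great_circle f mu t) = 1.
Proof. by move=> fmu f1; rewrite /enorm great_circle_norm // sqrtr1. Qed.

Lemma great_circle_neq0 (f : 'rV[R]_d) mu t : f 0 mu = 0 -> \sum_nu f 0 nu ^+ 2 = 1 -> great_circle f mu t != 0.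
Proof.
move=> fmu f1; apply/eqP => h; have := great_circle_norm t fmu f1.
rewrite h big1 => [/eqP|nu _]; last by rewrite mxE expr0n.
by rewrite eq_sym oner_eq0.
Qed.

(** The velocity of the circle at x is the sum over nu of f_nu times the
    rotation field x_nu d_mu - x_mu d_nu, so its matrix is a combination of the
    A nu mu with coefficients of modulus at most 1. *)
Lemma great_circle_trig (f : 'rV[R]_d) mu i : f 0 mu = 0 -> \sum_nu f 0 nu ^+ 2 = 1 ->
  trig (freqs rot_bound) (fun t => F i (great_circle f mu t)).
Proof.
move=> fmu f1.
pose B i j := \sum_nu (f 0 nu)%:C * A nu mu i j.
have fle nu : `|f 0 nu| <= 1.
  rewrite -(@expr_le1 _ 2) // real_normK ?num_real // -f1 (bigD1 nu) //=.
  by rewrite lerDl sumr_ge0 // => k _; exact: sqr_ge0.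
apply: (periodic_system (A := B) (g := fun i t => F i (great_circle f mu t))).
- move=> {}i t; have c0 := great_circle_neq0 t fmu f1.
  pose gam' : 'rV[R]_d := - sin t *: f + cos t *: delta_mx 0 mu.
  apply: cderive_eq (@F_chain i _ _ gam' c0 _); last first.
    move=> nu.
    have h1 := is_deriveM (is_derive_cos t) (is_derive_cst (f 0 nu) t (1 : R)).
    have h2 := is_deriveM (is_derive_sin t) (is_derive_cst ((delta_mx 0 mu : 'rV[R]_d) 0 nu : R) t (1 : R)).
    apply: is_derive_ext (is_deriveD h1 h2) _ _ => [s|]; first by rewrite !mxE.
    by rewrite !mxE /GRing.scale /=; ring.
  under [RHS]eq_bigr do rewrite mulr_suml.
  rewrite [RHS]exchange_big /=.
  under [RHS]eq_bigr do under eq_bigr do rewrite -mulrA.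
  under [RHS]eq_bigr do rewrite -mulr_sumr -F_rot // great_circle_mu // mulrBr.
  rewrite sumrB; set x := great_circle f mu t in c0 *.
  have -> : \sum_nu (f 0 nu)%:C * ((x 0 nu)%:C * DF i mu x) = (cos t)%:C * DF i mu x.
    under eq_bigr do rewrite mulrA; rewrite -mulr_suml; congr (_ * _).
    rewrite -[cos t]mulr1 -f1 mulr_sumr rmorph_sum; apply: eq_bigr => nu _.
    rewrite -rmorphM; congr (_%:C); have [->|h] := eqVneq nu mu; first by rewrite fmu; ring.
    by rewrite /x great_circle_other //; ring.
  have -> : \sum_nu (gam' 0 nu)%:C * DF i nu x =
      \sum_nu ((cos t)%:C * (((delta_mx 0 mu : 'rV[R]_d) 0 nu)%:C * DF i nu x)
        - (f 0 nu)%:C * ((sin t)%:C * DF i nu x)).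
    by apply: eq_bigr => nu _; rewrite !mxE rmorphD !rmorphM rmorphN; ring.
  rewrite sumrB -mulr_sumr; congr (_ * _ - _).
  rewrite (bigD1 mu) //= !mxE !eqxx mul1r big1 ?addr0 // => nu /negbTE h.
  by rewrite mxE h mul0r.
- by move=> {}i t; rewrite /great_circle cosD2pi sinD2pi.
apply: le_trans (_ : \sum_nu \sum_mu \sum_i \sum_j cabs (A nu mu i j) <= _); last first.
  apply/ltW/archi_boundP; apply: sumr_ge0 => ? _; apply: sumr_ge0 => ? _.
  by apply: sumr_ge0 => ? _; apply: sumr_ge0 => ? _; exact: cabs_ge0.
apply: (@le_trans _ _ (\sum_nu \sum_i \sum_j cabs (A nu mu i j))).
  rewrite [leRHS]exchange_big /=; apply: ler_sum => i' _.
  rewrite [leRHS]exchange_big /=; apply: ler_sum => j' _.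
  rewrite (le_trans (cabs_sum _ _ _)) //; apply: ler_sum => nu _.
  by rewrite cabsM cabs_real ler_piMl ?cabs_ge0.
apply: ler_sum => nu _; rewrite [leRHS](bigD1 mu) //= lerDl.
apply: sumr_ge0 => ? _; apply: sumr_ge0 => ? _.
by apply: sumr_ge0 => ? _; exact: cabs_ge0.
Qed.

Section Parity.
Variables (i : I) (N : nat).
Hypotheses (N_gt0 : (0 < N)%N) (N_big : (rot_bound <= N)%N).

(** The even or odd part, according to N, rescaled to degree N.  The value 0
    at the origin is the continuous one, as N > 0. *)
Definition parity_part (x : 'rV[R]_d) : R[i] :=
  if x == 0 then 0
  else (enorm x `^ (N%:R - lambda))%:C * (F i x + (-1) ^+ N * F i (- x)).
Local Notation G := parity_part.

Lemma parity_partN x : G (- x) = (-1) ^+ N * G x.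
Proof.
rewrite /G oppr_eq0; case: eqP => _; first by rewrite mulr0.
have s2 : (-1) ^+ N * (-1) ^+ N = 1 :> R[i] by rewrite -exprMn mulrNN mulr1 expr1n.
rewrite enormN opprK mulrCA; congr (_ * _).
by rewrite mulrDr mulrA s2 mul1r addrC.
Qed.

Lemma parity_partZ_gt0 x s : 0 < s -> G (s *: x) = (s ^+ N)%:C * G x.
Proof.
move=> s0; rewrite /G scaler_eq0 gt_eqF //=; case: eqP => [_|/eqP x0].
  by rewrite mulr0.
rewrite -scalerN !euler_homogeneous ?oppr_eq0 // enormZ gtr0_norm //.
rewrite powRM ?ltW // ?enorm_gt0 //.
have -> : s ^+ N = s `^ (N%:R - lambda) * s `^ lambda.
  rewrite -powRD; last by rewrite (gt_eqF s0) implybT.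
  by rewrite subrK powR_mulrn // ltW.
rewrite !rmorphM; ring.
Qed.

Lemma parity_partZ x s : G (s *: x) = (s ^+ N)%:C * G x.
Proof.
have [s0|s0|->] := ltgtP s 0.
- have ns0 : 0 < - s by rewrite oppr_gt0.
  rewrite -[s in LHS]opprK scaleNr parity_partN parity_partZ_gt0 //.
  rewrite mulrA; congr (_ * _); rewrite -[s in RHS]opprK [in RHS]exprNn rmorphM.
  by congr (_ * _); rewrite rmorphXn rmorphN1.
- exact: parity_partZ_gt0.
by rewrite scale0r expr0n gtn_eqF // /G eqxx mul0r.
Qed.

Lemma cisX (t : R) n : cis (n%:R * t) = cis t ^+ n.
Proof.
elim: n => [|n IH]; first by rewrite mul0r cis0 expr0.
by rewrite exprS -IH -cisD -nat1r mulrDl mul1r.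
Qed.

Lemma cis_pi (n : int) : cis (n%:~R * (pi : R)) = (-1) ^+ `|n|%N.
Proof.
have cpi : cis pi = -1 :> R[i].
  by apply: complex_eq; rewrite /= ?cospi ?sinpi ?oppr0.
have cNpi : cis (- pi) = -1 :> R[i].
  by apply: complex_eq; rewrite /= ?cosN ?sinN ?cospi ?sinpi ?oppr0.
case: n => n; first by rewrite [n%:~R]/(n%:R) cisX cpi.
by rewrite NegzE mulrNz mulNr -mulrN [n.+1%:~R]/(n.+1%:R) cisX cNpi abszN.
Qed.

(** In the plane with coordinates (s, t), r^N cis(k th) is
    (s^2+t^2)^((N-|k|)/2) (s +- i t)^|k| when N and k have the same parity. *)
Lemma great_circle_line_poly (c r s : R[i]) n (k : int) : (k \in freqs rot_bound) ->
  n = `|k|%N -> ~~ odd (N + n) ->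
  (size (c%:P * ((s ^+ 2)%:P + 'X^2) ^+ (N - n)./2 * (s%:P + r%:P * 'X) ^+ n)%R
    <= N.+1)%N.
Proof.
move=> /freqs_mem kb -> ev.
have nN : (`|k| <= N)%N := leq_trans kb N_big.
have e2 : ((N - `|k|)./2.*2 + `|k|)%N = N.
  rewrite -[in RHS](subnK nN) -[in RHS](odd_double_half (N - `|k|)).
  by rewrite oddB // -oddD (negbTE ev) add0n.
apply: leq_trans (size_polyMleq _ _) _.
have s1 : (size (c%:P * ((s ^+ 2)%:P + 'X^2) ^+ (N - `|k|)./2)%R <= (N - `|k|)./2.*2.+1)%N.
  apply: leq_trans (size_polyMleq _ _) _.
  have := size_polyC_leq1 c; have := size_poly_exp_leq ((s ^+ 2)%:P + 'X^2 : {poly R[i]}) (N - `|k|)./2.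
  have : (size ((s ^+ 2)%:P + 'X^2)%R <= 3)%N.
    apply: leq_trans (size_polyD _ _) _; rewrite geq_max size_polyXn leqnn andbT.
    exact: leq_trans (size_polyC_leq1 _) _.
  move: (size _) (size _) (size _) => a b e; rewrite -muln2; nia.
have s2 : (size ((s%:P + r%:P * 'X) ^+ `|k|)%R <= `|k|.+1)%N.
  have := size_poly_exp_leq (s%:P + r%:P * 'X : {poly R[i]}) `|k|.
  have : (size (s%:P + r%:P * 'X)%R <= 2)%N.
    apply: leq_trans (size_polyD _ _) _; rewrite geq_max (leq_trans (size_polyC_leq1 _)) //=.
    apply: leq_trans (size_polyMleq _ _) _; rewrite size_polyX addn2 /=.
    by have := size_polyC_leq1 r.
  move: (size _) (size _) => a b; nia.
move: s1 s2; move: (size _) (size _) => a b; lia.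
Qed.

(** The antipode of the point at angle t is the point at t + pi, where
    cis (k t) has changed by (-1)^k; so only frequencies of the parity of N
    remain. *)
Lemma parity_part_great_circle (f : 'rV[R]_d) mu : f 0 mu = 0 -> \sum_nu f 0 nu ^+ 2 = 1 ->
  exists c : int -> R[i], forall t, G (great_circle f mu t) =
    \sum_(k <- freqs rot_bound | ~~ odd (N + `|k|)) c k * cis (k%:~R * t).
Proof.
move=> fmu f1; have [c hc] := great_circle_trig i fmu f1.
exists (fun k => c k *+ 2) => t.
rewrite /G (negbTE (great_circle_neq0 t fmu f1)) great_circle_enorm // powR1 mul1r.
have -> : - great_circle f mu t = great_circle f mu (t + pi).
  by rewrite /great_circle cosDpi sinDpi !scaleNr opprD.
rewrite !hc mulr_sumr -big_split [RHS]big_mkcond /=; apply: eq_bigr => k _.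
rewrite mulrDr cisD cis_pi -signr_odd -[X in _ + _ * (_ * (_ * X))]signr_odd oddD.
by case: (odd N); case: (odd `|k|) => /=; rewrite ?expr0 ?expr1; ring.
Qed.

Lemma cis_int (k : int) (t : R) :
  cis (k%:~R * t) = cis ((if (0 <= k)%R then 1 else -1) * t) ^+ `|k|%N.
Proof.
case: k => n; rewrite ?NegzE /=.
  by rewrite mul1r -cisX.
rewrite -cisX mulrNz -[n.+1%:~R]/(n.+1%:R); congr cis.
by rewrite mulrA mulrN1.
Qed.

(** The line through x in direction mu lies in the plane spanned by e_mu and
    the component y of x orthogonal to it.  If y is nonzero, the points of the
    line have polar angle in (-pi/2, pi/2), whence the arctangent; if y = 0,
    the line is an axis and G is a monomial on it. *)
Lemma parity_part_line (x : 'rV[R]_d) mu : exists2 p : {poly R[i]}, (size p <= N.+1)%N &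
  forall t : R, G (setc x mu t) = p.[t%:C].
Proof.
pose y := setc x mu 0.
have yE t : setc x mu t = y + t *: delta_mx 0 mu.
  apply/rowP => nu; rewrite !mxE eqxx /=.
  by case: (nu == mu); rewrite ?mulr1 ?mulr0 ?add0r ?addr0.
have ymu : y 0 mu = 0 by rewrite mxE eqxx.
have [y0|y0] := eqVneq y 0.
  exists ((G (delta_mx 0 mu))%:P * 'X^N) => [|t].
    apply: leq_trans (size_polyMleq _ _) _; rewrite size_polyXn addnS /=.
    exact: leq_add (size_polyC_leq1 _) (leqnn N).
  by rewrite yE y0 add0r parity_partZ !hornerE ?hornerXn rmorphXn mulrC.
pose s := enorm y; have s0 : 0 < s by exact: enorm_gt0.
pose f := s^-1 *: y.
have fmu : f 0 mu = 0 by rewrite mxE ymu mulr0.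
have f1 : \sum_nu f 0 nu ^+ 2 = 1.
  under eq_bigr do rewrite mxE exprMn.
  by rewrite -mulr_sumr -sqr_enorm -exprMn mulVf ?expr1n // gt_eqF.
have [c hc] := parity_part_great_circle fmu f1.
pose sg (k : int) : R[i] := 'i%C * (if (0 <= k)%R then 1 else -1).
exists (\sum_(k <- freqs rot_bound | ~~ odd (N + `|k|))
  (c k)%:P * ((s%:C ^+ 2)%:P + 'X^2) ^+ (N - `|k|)./2 * (s%:C%:P + (sg k)%:P * 'X) ^+ `|k|).
  rewrite big_seq_cond; elim/big_rec: _ => [|k p /andP[kf ev] sp]; first by rewrite size_poly0.
  apply: leq_trans (size_polyD _ _) _; rewrite geq_max sp andbT.
  exact: (great_circle_line_poly (c k) (sg k) (s%:C) kf erefl ev).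
move=> t; pose r := Num.sqrt (s ^+ 2 + t ^+ 2); pose th := atan (t / s).
have r0 : 0 < r by rewrite sqrtr_gt0 ltr_pwDl ?exprn_gt0 ?sqr_ge0.
have r2 : r ^+ 2 = s ^+ 2 + t ^+ 2 by rewrite sqr_sqrtr // addr_ge0 ?sqr_ge0.
have rc : r * cos th = s.
  rewrite /th cos_atan; have -> : 1 + (t / s) ^+ 2 = r ^+ 2 / s ^+ 2.
    by rewrite r2 mulrDl divff ?expr_div_n // expf_neq0 // gt_eqF.
  rewrite -expr_div_n sqrtr_sqr ger0_norm ?divr_ge0 ?ltW // invf_div mulrC divfK //.
  by rewrite gt_eqF.
have rs : r * sin th = t.
  have : tan th = t / s by rewrite /th atanK.
  have ct : cos th != 0.
    by apply: contraTneq s0 => c0; rewrite -rc c0 mulr0 ltxx.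
  move=> /(congr1 (fun u => u * cos th)); rewrite /tan divfK // => ->.
  by rewrite mulrCA rc divfK // gt_eqF.
have -> : setc x mu t = r *: great_circle f mu th.
  by rewrite /great_circle scalerDr !scalerA rc rs divff ?scale1r ?yE // gt_eqF.
rewrite parity_partZ hc mulr_sumr horner_sum big_seq_cond [RHS]big_seq_cond.
apply: eq_bigr => k /andP[kf ev].
transitivity (c k * (s%:C ^+ 2 + t%:C ^+ 2) ^+ (N - `|k|)./2 * (s%:C + sg k * t%:C) ^+ `|k|);
  last by rewrite !(hornerE, horner_exp, hornerXn).
rewrite mulrCA -mulrA; congr (_ * _).
have kN : (`|k| <= N)%N := leq_trans (freqs_mem kf) N_big.
have e2 : N = ((N - `|k|)./2.*2 + `|k|)%N.
  rewrite -[in LHS](subnK kN) -[in LHS](odd_double_half (N - `|k|)).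
  by rewrite oddB // -oddD (negbTE ev) add0n.
have -> : r ^+ N = (r ^+ 2) ^+ (N - `|k|)./2 * r ^+ `|k|.
  by rewrite {1}e2 exprD -mul2n exprM.
rewrite r2 cis_int rmorphM !rmorphXn rmorphD !rmorphXn -mulrA -exprMn.
congr (_ * _ ^+ _).
rewrite -rc -[in RHS]rs /sg; case: (0 <= k)%R; apply: complex_eq;
  rewrite /= ?ReM ?ImM ?ReD ?ImD /= ?ReM ?ImM /= ?mul1r ?mulN1r ?cosN ?sinN; ring.
Qed.

Lemma parity_part_sph : exists2 q : sph R d R[i]^o, sph_homog lambda q &
  forall x, x != 0 -> sph_eval x q = F i x + (-1) ^+ N * F i (- x).
Proof.
have [s sN hs] := homogeneous_polyfun (fun x s (s0 : 0 < s) => parity_partZ x s)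
  (separately_polynomial parity_part_line).
exists (\sum_(t <- s) sph_mono (t.1, lambda - N%:R) (t.2 : R[i]^o)).
  rewrite big_seq; apply: sph_homog_sum => t ts; apply: sph_homog_mono.
  by rewrite /sexp_deg /= sN // addrC subrK.
move=> x x0; rewrite sph_eval_sum //.
transitivity ((enorm x `^ (lambda - N%:R))%:C * G x).
  rewrite hs mulr_sumr; apply: eq_bigr => t _; rewrite sph_eval_mono //.
  by rewrite /sexp_eval /= rmorphM [RHS]mulrA [in RHS](mulrC (_%:C)).
rewrite /G (negbTE x0) mulrA -rmorphM -powRD ?(gt_eqF (enorm_gt0 x0)) ?implybT //.
by rewrite addrA subrK subrr powRr0 mul1r.
Qed.
End Parity.

(** F is half the sum of its even and its odd part. *)
Lemma sphere_finite i : exists2 q : sph R d R[i]^o, sph_homog lambda q &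
  forall x, x != 0 -> sph_eval x q = F i x.
Proof.
have b0 : (rot_bound <= rot_bound.+1.*2)%N by lia.
have b1 : (rot_bound <= rot_bound.+1.*2.+1)%N by lia.
have [q0 h0 e0] := @parity_part_sph i rot_bound.+1.*2 isT b0.
have [q1 h1 e1] := @parity_part_sph i rot_bound.+1.*2.+1 isT b1.
exists (sph_map ( *:%R (2^-1 : R[i])) (q0 + q1)).
  by apply: sph_homog_map; [exact: scaleD|exact: sph_homogD].
move=> x x0; rewrite sph_eval_map //; last exact: scale_lin.
rewrite sph_evalD // e0 // e1 // exprS -mul2n exprM sqrrN expr1n expr1n.
have two : (2 : R[i]) != 0 by rewrite pnatr_eq0.
by rewrite -[LHS]/(_ * _); field.
Qed.
End SphereFunctions.

(** * The conformal action on two-point functions *)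

Section TupleSums.
Variables (T : finType) (V : zmodType).

Lemma sum_tuple0 (F : 0.-tuple T -> V) : \sum_(s : 0.-tuple T) F s = F [tuple].
Proof. by rewrite (bigD1 [tuple]) //= big1 ?addr0 // => s /eqP[]; exact: tuple0. Qed.

Lemma sum_tupleS k (F : k.+1.-tuple T -> V) :
  \sum_(s : k.+1.-tuple T) F s = \sum_(i : T) \sum_(s : k.-tuple T) F (cons_tuple i s).
Proof.
rewrite pair_big /= (reindex (fun p : T * k.-tuple T => cons_tuple p.1 p.2)) //=.
exists (fun s => (thead s, [tuple of behead s])) => [[i s] _|s _] /=.
  by congr (_, _); apply: val_inj.
by apply: val_inj; rewrite /= [in RHS](tuple_eta s).
Qed.
End TupleSums.

Section Tau.
Variables (R : realType) (d : nat).
Implicit Types (X : so R d) (x : 'rV[R]_d).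

(** For D, P and J the exponential series stops at the linear term. *)
Lemma tau_first_order x X : (forall mu nu, br (so_P R mu) (br (so_P R nu) X) = 0) ->
  tau x X = X - \sum_rho x 0 rho *: br (so_P R rho) X.
Proof.
move=> h; rewrite /tau !big_ord_recr big_ord0 /= add0r.
rewrite sum_tuple0 sum_tupleS [X in _ + _ + X]sum_tupleS /=.
rewrite [X in _ + _ + X]big1 ?addr0; last first.
  by move=> i _; rewrite sum_tupleS big1 // => j _; rewrite sum_tuple0 /= h scaler0.
rewrite big_nil expr0 fact0 divr1 mulr1 scale1r; congr (_ + _).
rewrite -sumrN; apply: eq_bigr => i _; rewrite sum_tuple0 /=.
by rewrite big_seq1 expr1 divr1 mulN1r scaleNr.
Qed.

Lemma tau0 X : tau 0 X = X.
Proof.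
rewrite /tau !big_ord_recr big_ord0 /= add0r.
rewrite sum_tuple0 sum_tupleS [X in _ + _ + X]sum_tupleS /=.
rewrite [X in _ + _ + X]big1 ?addr0; last first.
  by move=> i _; rewrite big1 // => s _; rewrite big_cons mxE mul0r mulr0 scale0r.
rewrite [X in _ + X]big1 ?addr0; last first.
  by move=> i _; rewrite big1 // => s _; rewrite big_cons mxE mul0r mulr0 scale0r.
by rewrite big_nil expr0 fact0 divr1 mulr1 scale1r.
Qed.

Lemma tau_D x : tau x (so_D R d) = so_D R d + \sum_rho x 0 rho *: so_P R rho.
Proof.
rewrite tau_first_order => [|mu nu]; last by rewrite br_PD brNr br_PP oppr0.
by congr (_ + _); rewrite -sumrN; apply: eq_bigr => rho _; rewrite br_PD scalerN opprK.
Qed.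

Lemma tau_J x mu nu : tau x (so_J R mu nu) =
  so_J R mu nu - x 0 mu *: so_P R nu + x 0 nu *: so_P R mu.
Proof.
rewrite tau_first_order => [|k l]; last first.
  by rewrite br_PJ brNr /brJP brDr !brZr !br_PP !scaler0 addr0 oppr0.
rewrite -addrA; congr (_ + _); rewrite -sumrN.
under eq_bigr do rewrite br_PJ /brJP /kron opprD scaleNr opprK scalerDr !scalerN !scalerA opprD opprK.
rewrite big_split /=; congr (_ + _).
  rewrite (bigD1 mu) //= eqxx mulr1 big1 ?addr0 // => k /negbTE h.
  by rewrite eq_sym h mulr0 scale0r oppr0.
rewrite (bigD1 nu) //= eqxx mulr1 big1 ?addr0 // => k /negbTE h.
by rewrite eq_sym h mulr0 scale0r.
Qed.
End Tau.

Section TwoPoint.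
Variables (R : realType) (d : nat) (H : lmodType R[i]).
Variables (act : so R d -> H -> H).
Variables (YY : forall n, 'M[R]_(n, d) -> ('I_n -> H) -> R -> H) (vac : H).
Hypothesis hCC : CC_system YY act vac.
Let hM := cc_compact hCC.
Local Notation eig := (eigsp act).

Definition two_pt (x1 x2 : 'rV[R]_d) (a b : H) : R -> H := YY (col_mx x1 x2) (pair2 a b).

Lemma row_col1 (x1 x2 : 'rV[R]_d) : row (lshift 1 ord0) (col_mx x1 x2) = x1.
Proof. by apply/rowP => j; rewrite mxE col_mxEu. Qed.
Lemma row_col2 (x1 x2 : 'rV[R]_d) : row (rshift 1 ord0) (col_mx x1 x2) = x2.
Proof. by apply/rowP => j; rewrite mxE col_mxEd. Qed.

Lemma ord2P (i : 'I_(1 + 1)) : i = lshift 1 ord0 \/ i = rshift 1 ord0.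
Proof. by case: (split_ordP i) => j ->; rewrite ord1; [left|right]. Qed.

Lemma sum_ord2 (V : zmodType) (F : 'I_(1 + 1) -> V) :
  \sum_i F i = F (lshift 1 ord0) + F (rshift 1 ord0).
Proof. by rewrite big_split_ord /= !big_ord1. Qed.

Lemma conf2 x1 x2 : x1 != x2 -> @Conf R d (1 + 1) (col_mx x1 x2).
Proof.
move=> h i j; case: (ord2P i) => ->; case: (ord2P j) => ->;
  rewrite ?row_col1 ?row_col2 ?eqxx // => _.
by rewrite eq_sym.
Qed.

Lemma pair2_1 (a b : H) : pair2 a b (lshift 1 ord0) = a.
Proof. by rewrite /pair2 /cat_args (unsplitK (inl ord0)). Qed.
Lemma pair2_2 (a b : H) : pair2 a b (rshift 1 ord0) = b.
Proof. by rewrite /pair2 /cat_args (unsplitK (inr ord0)). Qed.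

Lemma upd_pair2_1 (a b c : H) : upd (pair2 a b) (lshift 1 ord0) c = pair2 c b.
Proof.
by apply/funext => i; rewrite /upd; case: (ord2P i) => ->; rewrite ?eqxx ?pair2_1 ?pair2_2.
Qed.
Lemma upd_pair2_2 (a b c : H) : upd (pair2 a b) (rshift 1 ord0) c = pair2 a c.
Proof.
by apply/funext => i; rewrite /upd; case: (ord2P i) => ->; rewrite ?eqxx ?pair2_1 ?pair2_2.
Qed.

Section Points.
Variables (x1 x2 : 'rV[R]_d).
Hypothesis x12 : x1 != x2.
Local Notation W := (two_pt x1 x2).

Lemma two_pt_in a b D : eig D (W a b D).
Proof. exact: (cc_bar hCC (pair2 a b) isT (conf2 x12)). Qed.

Lemma two_pt_hbar a b : hbar act (W a b).
Proof. by move=> D; exact: two_pt_in. Qed.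

Lemma two_pt_linl D b (c : R[i]) a a' : W (c *: a + a') b D = c *: W a b D + W a' b D.
Proof.
have := cc_multilinear hCC (pair2 a b) (lshift 1 ord0) c a a' D isT (conf2 x12).
by rewrite !upd_pair2_1.
Qed.
Lemma two_pt_linr D a (c : R[i]) b b' : W a (c *: b + b') D = c *: W a b D + W a b' D.
Proof.
have := cc_multilinear hCC (pair2 a b) (rshift 1 ord0) c b b' D isT (conf2 x12).
by rewrite !upd_pair2_2.
Qed.
Lemma two_ptDl D b : {morph (fun a => W a b D) : a a' / a + a'}.
Proof. by move=> a a'; have := two_pt_linl D b 1 a a'; rewrite !scale1r. Qed.
Lemma two_ptDr D a : {morph (fun b => W a b D) : b b' / b + b'}.
Proof. by move=> b b'; have := two_pt_linr D a 1 b b'; rewrite !scale1r. Qed.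
Lemma two_pt0l D b : W 0 b D = 0.
Proof. exact: (morph_add0 (two_ptDl D b)). Qed.
Lemma two_pt0r D a : W a 0 D = 0.
Proof. exact: (morph_add0 (two_ptDr D a)). Qed.
Lemma two_ptZl D (c : R[i]) a b : W (c *: a) b D = c *: W a b D.
Proof. by have := two_pt_linl D b c a 0; rewrite two_pt0l !addr0. Qed.
Lemma two_ptZr D (c : R[i]) a b : W a (c *: b) D = c *: W a b D.
Proof. by have := two_pt_linr D a c b 0; rewrite two_pt0r !addr0. Qed.
Lemma two_pt_suml D b (I : Type) (r : seq I) (P : pred I) (F : I -> H) :
  W (\sum_(i <- r | P i) F i) b D = \sum_(i <- r | P i) W (F i) b D.
Proof. exact: (big_morph _ (two_ptDl D b) (two_pt0l D b)). Qed.
Lemma two_pt_sumr D a (I : Type) (r : seq I) (P : pred I) (F : I -> H) :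
  W a (\sum_(i <- r | P i) F i) D = \sum_(i <- r | P i) W a (F i) D.
Proof. exact: (big_morph _ (two_ptDr D a) (two_pt0r D a)). Qed.

Lemma two_pt_covariance X a b D : bar_act act X (W a b) D =
  W (act (tau x1 X) a) b D + W a (act (tau x2 X) b) D.
Proof.
rewrite (cc_covariance hCC (pair2 a b) X D isT (conf2 x12)) sum_ord2.
by rewrite row_col1 row_col2 upd_pair2_1 upd_pair2_2 pair2_1 pair2_2.
Qed.
End Points.

(** The chain rule on configurations of two points, with the partial
    derivatives supplied by translation invariance. *)
Lemma two_pt_chain (u : {scalar H}) a b (g1 g2 : R -> 'rV[R]_d) t (g1' g2' : 'rV[R]_d) :
  hvee act u -> g1 t != g2 t ->
  (forall nu, is_derive t 1 (fun s => g1 s 0 nu) (g1' 0 nu)) ->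
  (forall nu, is_derive t 1 (fun s => g2 s 0 nu) (g2' 0 nu)) ->
  is_cderive (fun s => hpair u (two_pt (g1 s) (g2 s) a b)) t
    (\sum_nu (g1' 0 nu)%:C * hpair u (two_pt (g1 t) (g2 t) (act (so_P R nu) a) b)
     + \sum_nu (g2' 0 nu)%:C * hpair u (two_pt (g1 t) (g2 t) a (act (so_P R nu) b))).
Proof.
move=> hu g12 d1 d2.
pose Df (p : 'M[R]_(1 + 1, d)) i j :=
  hpair u (YY p (upd (pair2 a b) i (act (so_P R j) (pair2 a b i)))).
have tr p i j : @Conf R d (1 + 1) p -> is_cderive (fun s => hpair u (YY (p + s *: delta_mx i j) (pair2 a b))) 0 (Df p i j).
  by move=> pc; exact: (cc_translation hCC (n := 1 + 1)).
have := @analytic_chain _ _ _ _ _ Df (cc_analytic hCC (pair2 a b) isT hu) tr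
  (fun s => col_mx (g1 s) (g2 s)) t (col_mx g1' g2') (conf2 g12).
move=> h; apply: cderive_eq (h _) => {h}.
  rewrite sum_ord2 /Df; congr (_ + _); apply: eq_bigr => nu _.
    by rewrite col_mxEu upd_pair2_1 pair2_1.
  by rewrite col_mxEd upd_pair2_2 pair2_2.
move=> i nu; case: (ord2P i) => ->.
  rewrite col_mxEu; apply: is_derive_ext (d1 nu) _ _ => // s.
  by rewrite col_mxEu.
rewrite col_mxEd; apply: is_derive_ext (d2 nu) _ _ => // s.
by rewrite col_mxEd.
Qed.
End TwoPoint.

(** * Two-point functions are spherical polynomials *)

Section Existence.
Variables (R : realType) (d : nat) (H : lmodType R[i]).
Variables (act : so R d -> H -> H).
Variables (YY : forall n, 'M[R]_(n, d) -> ('I_n -> H) -> R -> H) (vac : H).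
Hypothesis hCC : CC_system YY act vac.
Let hM := cc_compact hCC.
Local Notation eig := (eigsp act).
Local Notation W x := (two_pt YY x 0).

(** Covariance under D at (x, 0), where tau_x(D) = D + sum_nu x_nu P_nu. *)
Lemma two_pt_euler (x : 'rV[R]_d) a b D0 D1 D2 : x != 0 -> eig D1 a -> eig D2 b ->
  \sum_nu (x 0 nu)%:C *: W x (act (so_P R nu) a) b D0 = (D0 - D1 - D2)%:C *: W x a b D0.
Proof.
move=> x0 aD bD; have := two_pt_covariance hCC x0 (so_D R d) a b D0.
rewrite tau0 tau_D (actDl hM) [act _ a]aD [act _ b]bD (act_suml hM).
rewrite (two_ptDl hCC x0) (two_pt_suml hCC x0).
rewrite (bar_act_weight hM _ (weight_D R d)) ?subr0; last exact: (two_pt_hbar hCC x0).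
rewrite [act _ (W x a b D0)](two_pt_in hCC x0) (two_ptZl hCC x0) (two_ptZr hCC x0).
under eq_bigr do rewrite (actZl hM) (two_ptZl hCC x0).
move=> e; rewrite !rmorphB !scalerBl e -[in RHS]addrA -opprD.
by rewrite [_ *: _ + \sum_nu _]addrC -[in RHS](addrA (\sum_nu _)) addrK.
Qed.

(** Covariance under J_{nu,mu} at (x, 0); the terms of tau_x(J_{nu,mu}) linear
    in x form the rotation field. *)
Lemma two_pt_rot (x : 'rV[R]_d) a b D0 mu nu : x != 0 ->
  (x 0 nu)%:C *: W x (act (so_P R mu) a) b D0 - (x 0 mu)%:C *: W x (act (so_P R nu) a) b D0 =
  W x (act (so_J R nu mu) a) b D0 + W x a (act (so_J R nu mu) b) D0
  - act (so_J R nu mu) (W x a b D0).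
Proof.
move=> x0; have := two_pt_covariance hCC x0 (so_J R nu mu) a b D0.
rewrite (bar_act_weight hM _ (weight_J R nu mu)) ?subr0; last exact: (two_pt_hbar hCC x0).
rewrite tau0 tau_J -scaleNr !(actDl hM) !(actZl hM) !(two_ptDl hCC x0) !(two_ptZl hCC x0) => ->.
rewrite rmorphN scaleNr -[_ - _ + _]addrA [_ + _ + W x a _ _]addrAC opprD addrA subrr sub0r.
by rewrite opprD opprK.
Qed.

(** [sphere_finite] applies to the matrix coefficients of the two-point
    function in bases of the three weight spaces; they form a finite family
    that is stable under rotations by [two_pt_rot]. *)
Lemma two_pt_homog_exists D0 D1 D2 a b : eig D1 a -> eig D2 b ->
  exists2 q : sph R d H, sph_homog (D0 - D1 - D2) q &
    forall x, x != 0 -> sph_eval x q = W x a b D0.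
Proof.
move=> aD bD.
have [n0 [b0 [u0 [b0e u0d b0s]]]] := eig_dual_basis hM D0.
have [n1 [b1 [u1 [b1e _ b1s]]]] := eig_dual_basis hM D1.
have [n2 [b2 [u2 [b2e _ b2s]]]] := eig_dual_basis hM D2.
pose I := ('I_n0 * ('I_n1 * 'I_n2))%type.
pose F (p : I) x := hpair (u0 p.1) (W x (b1 p.2.1) (b2 p.2.2)).
pose DF (p : I) nu x := hpair (u0 p.1) (W x (act (so_P R nu) (b1 p.2.1)) (b2 p.2.2)).
(* The rotation acts on a, on b and, contragrediently, on u. *)
pose A nu mu (p q : I) : R[i] :=
  u1 q.2.1 (act (so_J R nu mu) (b1 p.2.1)) * (q.1 == p.1)%:R * (q.2.2 == p.2.2)%:R
  + u2 q.2.2 (act (so_J R nu mu) (b2 p.2.2)) * (q.1 == p.1)%:R * (q.2.1 == p.2.1)%:R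
  - u0 p.1 (act (so_J R nu mu) (b0 q.1)) * (q.2 == p.2)%:R.
have hpE (x : 'rV[R]_d) i v w : x != 0 -> hpair (u0 i) (W x v w) = u0 i (W x v w D0).
  by move=> x0; apply: (hpair_hdual (u0d i)); exact: (two_pt_hbar hCC x0).
have F_chain i (gam : R -> 'rV[R]_d) t (gam' : 'rV[R]_d) : gam t != 0 ->
  (forall nu, is_derive t 1 (fun s => gam s 0 nu) (gam' 0 nu)) ->
  is_cderive (fun s => F i (gam s)) t (\sum_nu (gam' 0 nu)%:C * DF i nu (gam t)).
  move=> g0 gd.
  have z0 (nu : 'I_d) : is_derive t (1 : R) (fun s : R => (0 : 'rV[R]_d) 0 nu) ((0 : 'rV[R]_d) 0 nu).
    by rewrite mxE; apply: is_derive_ext (is_derive_cst (0 : R) t (1 : R)) _ _ => // s; rewrite mxE.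
  have := two_pt_chain hCC (b1 i.2.1) (b2 i.2.2) (g2 := fun=> 0) (g2' := 0)
    (hdual_hvee (u0d i.1)) g0 gd z0.
  by rewrite [X in _ + X]big1 ?addr0 // => nu _; rewrite mxE mul0r.
have F_euler i (x : 'rV[R]_d) : x != 0 ->
    \sum_nu (x 0 nu)%:C * DF i nu x = (D0 - D1 - D2)%:C * F i x.
  move=> x0; rewrite /F hpE // -[RHS]linearZ /= -(two_pt_euler D0 x0 (b1e _) (b2e _)) linear_sum.
  by apply: eq_bigr => nu _; rewrite /DF hpE // linearZ.
have sumI (g : I -> R[i]) : \sum_p g p = \sum_i \sum_q g (i, q).
  by rewrite pair_bigA; apply: eq_bigr => -[i q].
have sumJ (g : 'I_n1 * 'I_n2 -> R[i]) : \sum_q g q = \sum_j \sum_k g (j, k).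
  by rewrite pair_bigA; apply: eq_bigr => -[j k].
have only (J : finType) (g : J -> R[i]) j0 : (forall j, j != j0 -> g j = 0) -> \sum_j g j = g j0.
  by move=> h; rewrite (bigD1 j0) //= big1 ?addr0 // => j /h.
have F_rot nu mu i (x : 'rV[R]_d) : x != 0 ->
    (x 0 nu)%:C * DF i mu x - (x 0 mu)%:C * DF i nu x = \sum_j A nu mu i j * F j x.
  move=> x0; rewrite /DF !hpE // -[X in X - _]linearZ -[X in _ - X]linearZ -linearB /= two_pt_rot //.
  have JD : eig D0 (act (so_J R nu mu) (W x (b1 i.2.1) (b2 i.2.2) D0)).
    by have := act_eig hM (weight_J R nu mu) (two_pt_in hCC x0 (b1 i.2.1) (b2 i.2.2) D0); rewrite addr0.
  have Ja : eig D1 (act (so_J R nu mu) (b1 i.2.1)).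
    by have := act_eig hM (weight_J R nu mu) (b1e i.2.1); rewrite addr0.
  have Jb : eig D2 (act (so_J R nu mu) (b2 i.2.2)).
    by have := act_eig hM (weight_J R nu mu) (b2e i.2.2); rewrite addr0.
  rewrite linearB linearD /= {1}(b1s _ Ja) {1}(b2s _ Jb).
  rewrite (two_pt_suml hCC x0) (two_pt_sumr hCC x0) !linear_sum /=.
  rewrite [X in u0 _ (act _ X)](b0s _ (two_pt_in hCC x0 (b1 i.2.1) (b2 i.2.2) D0)) (act_sum hM) linear_sum /=.
  rewrite /A; under [RHS]eq_bigr do rewrite mulrBl mulrDl.
  rewrite sumrB big_split /=; congr (_ + _ - _).
  - rewrite sumI (only _ _ i.1) => [|k /negbTE h]; last first.
      by rewrite big1 // => q _; rewrite /= h mulr0 !mul0r.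
    rewrite sumJ; apply: eq_bigr => j _; rewrite (only _ _ i.2.2) => [|k /negbTE h]; last first.
      by rewrite /= h mulr0 mul0r.
    by rewrite /F hpE // !eqxx !mulr1 (two_ptZl hCC x0) linearZ.
  - rewrite sumI (only _ _ i.1) => [|k /negbTE h]; last first.
      by rewrite big1 // => q _; rewrite /= h mulr0 !mul0r.
    rewrite sumJ (only _ _ i.2.1) => [|k /negbTE h]; last first.
      by rewrite big1 // => q _; rewrite /= h mulr0 mul0r.
    apply: eq_bigr => k _.
    by rewrite /F hpE // !eqxx !mulr1 (two_ptZr hCC x0) linearZ.
  rewrite sumI; apply: eq_bigr => k _; rewrite (only _ _ i.2) => [|q /negbTE h]; last first.
    by rewrite /= h mulr0 mul0r.
  by rewrite /F hpE // eqxx mulr1 (actZ hM) linearZ /= mulrC.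
have hq p := sphere_finite F_chain F_euler F_rot p.
pose T (p : I) (c : R[i]^o) : H := (u1 p.2.1 a * u2 p.2.2 b * c) *: b0 p.1.
have TL p (c : R[i]) (v w : R[i]^o) : T p (c *: v + w) = c *: T p v + T p w.
  by rewrite /T scalerA -scalerDl mulrDr mulrCA.
have TD p : {morph T p : v w / v + w}.
  by move=> v w; have := TL p 1 v w; rewrite !scale1r.
pose q p := sph_map (T p) (s2val (cid2 (hq p))).
exists (\sum_p q p).
  apply: sph_homog_sum => p _; rewrite /q; case: (cid2 _) => r rh _ /=.
  exact: sph_homog_map.
move=> x x0; rewrite sph_eval_sum //.
have -> : \sum_p sph_eval x (q p) = \sum_p T p (F p x).
  apply: eq_bigr => p _; rewrite /q; case: (cid2 _) => r _ rx /=.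
  by rewrite sph_eval_map // rx.
rewrite [in RHS](b1s _ aD) [in RHS](b2s _ bD) (two_pt_suml hCC x0).
under [RHS]eq_bigr do rewrite (two_pt_sumr hCC x0).
under [RHS]eq_bigr do under eq_bigr do rewrite (two_ptZl hCC x0) (two_ptZr hCC x0)
  (b0s _ (two_pt_in hCC x0 _ _ _)) !scaler_sumr.
rewrite pair_bigA /= exchange_big pair_bigA /=; apply: eq_bigr => -[k [i j]] _ /=.
by rewrite /T /F hpE // !scalerA.
Qed.
End Existence.

(** * Splitting two-point functions by degree *)

Section VertexOperator.
Variables (R : realType) (d : nat).
Hypothesis d_gt0 : (0 < d)%N.
Variables (H : lmodType R[i]) (act : so R d -> H -> H).
Variables (YY : forall n, 'M[R]_(n, d) -> ('I_n -> H) -> R -> H) (vac : H).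
Hypothesis hCC : CC_system YY act vac.
Let hM := cc_compact hCC.
Local Notation eig := (eigsp act).
Local Notation prj := (pr act).
Local Notation W x := (two_pt YY x 0).

(** The part of degree lambda of x |-> YY_(x,0)(a,b), which for eigenvectors is
    the component of weight D1 + D2 + lambda. *)
Definition two_pt_part (x : 'rV[R]_d) (lambda : R) (a b : H) : H :=
  eig_ext act (fun D1 a => eig_ext act (fun D2 b => W x a b (D1 + D2 + lambda)) b) a.
Local Notation y := two_pt_part.

Section PartLinear.
Variables (x : 'rV[R]_d).
Hypothesis x0 : x != 0.

Let inner lambda D1 a b := eig_ext act (fun D2 b => W x a b (D1 + D2 + lambda)) b.

Let inner_linr lambda D1 a (c : R[i]) b b' :
  inner lambda D1 a (c *: b + b') = c *: inner lambda D1 a b + inner lambda D1 a b'.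
Proof. by apply: (eig_ext_lin hM) => D k v w _ _; exact: (two_pt_linr hCC x0). Qed.

Let inner_eig lambda D1 D2 a b : eig D2 b -> inner lambda D1 a b = W x a b (D1 + D2 + lambda).
Proof. by apply: (eig_ext_eig hM) => D k v w _ _; exact: (two_pt_linr hCC x0). Qed.

Let inner_linl lambda D1 b (c : R[i]) a a' :
  inner lambda D1 (c *: a + a') b = c *: inner lambda D1 a b + inner lambda D1 a' b.
Proof.
move: b; apply: (eigen_ind hM) => [|k b b' hb hb'|D2 b bD].
- by rewrite !(inner_eig _ _ _ (eig0 hM 0)) !(two_pt0r hCC x0) scaler0 addr0.
- rewrite !inner_linr hb hb' !scalerDr !scalerA (mulrC k) -!addrA; congr (_ + _).
  by rewrite addrCA.
by rewrite !(inner_eig _ _ _ bD) (two_pt_linl hCC x0).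
Qed.

Lemma two_pt_part_linl lambda b (c : R[i]) a a' :
  y x lambda (c *: a + a') b = c *: y x lambda a b + y x lambda a' b.
Proof. by apply: (eig_ext_lin hM) => D k v w _ _; exact: inner_linl. Qed.

Let part_eig1 lambda D1 a b : eig D1 a -> y x lambda a b = inner lambda D1 a b.
Proof.
apply: (eig_ext_eig hM (f := fun D a => inner lambda D a b)) => D k v w _ _.
exact: inner_linl.
Qed.

Lemma two_pt_part_eig lambda D1 D2 a b : eig D1 a -> eig D2 b ->
  y x lambda a b = W x a b (D1 + D2 + lambda).
Proof. by move=> aD bD; rewrite (part_eig1 _ _ aD) (inner_eig _ _ _ bD). Qed.

Lemma two_pt_part_linr lambda a (c : R[i]) b b' :
  y x lambda a (c *: b + b') = c *: y x lambda a b + y x lambda a b'.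
Proof.
move: a; apply: (eigen_ind hM) => [|k a a' ha ha'|D1 a aD].
- by rewrite !(part_eig1 _ _ (eig0 hM 0)) inner_linr.
- rewrite !two_pt_part_linl ha ha' !scalerDr !scalerA (mulrC k) -!addrA; congr (_ + _).
  by rewrite addrCA.
by rewrite !(part_eig1 _ _ aD) inner_linr.
Qed.

Lemma two_pt_part0l lambda b : y x lambda 0 b = 0.
Proof.
have := two_pt_part_linl lambda b 1 0 0; rewrite !scale1r addr0.
by move=> /(congr1 (fun v => v - y x lambda 0 b)); rewrite addrK subrr.
Qed.
Lemma two_pt_part0r lambda a : y x lambda a 0 = 0.
Proof.
have := two_pt_part_linr lambda a 1 0 0; rewrite !scale1r addr0.
by move=> /(congr1 (fun v => v - y x lambda a 0)); rewrite addrK subrr.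
Qed.

(** For eigenvectors this is the reindexing D = D1 + D2 + lambda; the
    finiteness is what makes both sums additive in a and b. *)
Lemma sum_two_pt_part (V : lmodType R[i]) (T : H -> V) a b :
  (forall (c : R[i]) v w, T (c *: v + w) = c *: T v + T w) ->
  finite_set [set D | exists2 v, eig D v & T v != 0] ->
  finite_set [set lambda | T (y x lambda a b) != 0] /\
  \sum_(lambda \in [set: R]) T (y x lambda a b) = \sum_(D \in [set: R]) T (W x a b D).
Proof.
move=> TL Tfin.
have TD : {morph T : v w / v + w} by move=> v w; have := TL 1 v w; rewrite !scale1r.
have T0 := morph_add0 TD.
have TZ c v : T (c *: v) = c *: T v by have := TL c v 0; rewrite addr0 T0 addr0.
have Wfin a' b' : finite_set [set D | T (W x a' b' D) != 0].
  apply: (sub_finite_set _ Tfin) => D /= h; exists (W x a' b' D) => //.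
  exact: (two_pt_in hCC x0).
have comb (c : R[i]) (f g h : R -> V) : (forall l, h l = c *: f l + g l) ->
    finite_set [set l | f l != 0] -> finite_set [set l | g l != 0] ->
    finite_set [set l | h l != 0] /\
    \sum_(l \in [set: R]) h l = c *: (\sum_(l \in [set: R]) f l) + \sum_(l \in [set: R]) g l.
  move=> hE ff gf.
  have cf : finite_set [set l | c *: f l != 0].
    by apply: (sub_finite_set _ ff) => l /=; apply: contra_neq => ->; rewrite scaler0.
  split.
    apply: (sub_finite_set _ (_ : finite_set ([set l | f l != 0] `|` [set l | g l != 0]))).
      move=> l /=; rewrite hE; have [->|?] := eqVneq (f l) 0; last by left.
      by rewrite scaler0 add0r; right.
    by rewrite finite_setU.
  rewrite (fsbig_morph (T := *:%R c)) //; last by move=> v w; rewrite scalerDr.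
  by rewrite -fsbig_addT //; apply: eq_fsbigr => l _.
move: a b; apply: (eigen_ind hM) => [b|c a a' ha ha' b|D1 a aD].
- split.
    apply: (sub_finite_set _ (finite_set0 R)) => l /=.
    by rewrite two_pt_part0l T0 eqxx.
  by rewrite !fsbig1 // => l _; rewrite ?two_pt_part0l ?(two_pt0l hCC x0) T0.
- have [fa ea] := ha b; have [fa' ea'] := ha' b.
  have [|f e] := comb c _ _ (fun l => T (y x l (c *: a + a') b)) _ fa fa'.
    by move=> l; rewrite two_pt_part_linl TL.
  split=> //; rewrite e ea ea'.
  have [|_ ->//] := comb c _ _ (fun D => T (W x (c *: a + a') b D)) _ (Wfin a b) (Wfin a' b).
  by move=> l; rewrite (two_pt_linl hCC x0) TL.
apply: (eigen_ind hM) => [|c b b' [fb eb] [fb' eb']|D2 b bD].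
- split.
    apply: (sub_finite_set _ (finite_set0 R)) => l /=.
    by rewrite two_pt_part0r T0 eqxx.
  by rewrite !fsbig1 // => l _; rewrite ?two_pt_part0r ?(two_pt0r hCC x0) T0.
- have [|f e] := comb c _ _ (fun l => T (y x l a (c *: b + b'))) _ fb fb'.
    by move=> l; rewrite two_pt_part_linr TL.
  split=> //; rewrite e eb eb'.
  have [|_ ->//] := comb c _ _ (fun D => T (W x a (c *: b + b') D)) _ (Wfin a b) (Wfin a b').
  by move=> l; rewrite (two_pt_linr hCC x0) TL.
have E l : y x l a b = W x a b (D1 + D2 + l) := two_pt_part_eig l aD bD.
split.
  apply: (sub_finite_set _ (_ : finite_set ((fun D => D - D1 - D2) @` [set D | T (W x a b D) != 0]))).
    move=> l /=; rewrite E => h; exists (D1 + D2 + l) => //=; ring.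
  exact: finite_image.
under eq_fsbigr do rewrite E.
rewrite [RHS](reindex_fsbigT (fun l => D1 + D2 + l)) //.
Qed.
End PartLinear.
End VertexOperator.

(** * The vertex operator *)

Section PolynomialParts.
Lemma fslin0 (K : choiceType) (V W : zmodType) (F : K -> V -> W) :
  (forall k v w, F k (v + w) = F k v + F k w) -> fslin F 0 = 0.
Proof. by move=> FD; apply: (addIr (fslin F 0)); rewrite -fslinD // !add0r. Qed.

Lemma sph_homog_poly (R : realType) d (V : zmodType) (s : R) (q : sph R d V) :
  sph_homog s q -> exists p : fs (mexp d) V,
    q = fslin (fun alpha v => sph_mono (alpha, s - (mexp_deg alpha)%:R) v) p.
Proof.
pose F (alpha : mexp d) (v : V) : sph R d V := sph_mono (alpha, s - (mexp_deg alpha)%:R) v.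
have FD k v w : F k (v + w) = F k v + F k w by exact: sph_monoD.
elim/sph_homog_ind => [|q1 q2 [p1 ->] [p2 ->]|[alpha r] v].
- by exists 0; rewrite (fslin0 FD).
- by exists (p1 + p2); rewrite (fslinD FD).
rewrite /sexp_deg /= => kl; exists (mono alpha v); rewrite (fslin_mono FD) /F.
by congr (sph_mono (_, _) _); rewrite -kl addrAC subrr add0r.
Qed.

(** A homogeneous element of degree s has the form
    |x|^s P(x_1/|x|,...,x_d/|x|), since the power of |x| in each of its terms
    is determined by the monomial. *)
Lemma in_sphere_poly_homog (R : realType) d (V : zmodType) (s : R) (f : R -> sph R d V) :
  sph_homog s (f s) -> (forall lambda, lambda != s -> f lambda = 0) -> in_sphere_poly s f.
Proof.
move=> /sph_homog_poly[p fs] f0; exists p => lambda.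
by case: eqP => [->//|/eqP /f0].
Qed.
End PolynomialParts.

Section Clauses.
Variables (R : realType) (d : nat).
Hypothesis d_gt0 : (0 < d)%N.
Variables (H : lmodType R[i]) (act : so R d -> H -> H).
Variables (YY : forall n, 'M[R]_(n, d) -> ('I_n -> H) -> R -> H) (vac : H).
Hypothesis hCC : CC_system YY act vac.
Let hM := cc_compact hCC.
Local Notation eig := (eigsp act).
Local Notation prj := (pr act).
Local Notation W x := (two_pt YY x 0).
Local Notation y := (two_pt_part act YY).
Implicit Types x : 'rV[R]_d.

Let part_linl x (x0 : x != 0) := two_pt_part_linl hCC x0.
Let part_linr x (x0 : x != 0) := two_pt_part_linr hCC x0.

(** By linearity the case of eigenvectors suffices, which is
    [two_pt_homog_exists]. *)
Lemma two_pt_part_exists a b lambda : exists q : sph R d H,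
  sph_homog lambda q /\ forall x, x != 0 -> sph_eval x q = y x lambda a b.
Proof.
have comb (c : R[i]) (f g h : 'rV[R]_d -> H) :
    (forall x, x != 0 -> h x = c *: f x + g x) ->
    (exists q : sph R d H, sph_homog lambda q /\ forall x, x != 0 -> sph_eval x q = f x) ->
    (exists q : sph R d H, sph_homog lambda q /\ forall x, x != 0 -> sph_eval x q = g x) ->
    exists q : sph R d H, sph_homog lambda q /\ forall x, x != 0 -> sph_eval x q = h x.
  move=> hE [q [qh qe]] [r [rh re]]; exists (sph_map ( *:%R c) q + r); split.
    apply: sph_homogD => //; apply: sph_homog_map => //.
    by move=> v w; rewrite scalerDr.
  move=> x x0; rewrite sph_evalD // sph_eval_map ?qe ?re ?hE // => k v w.
  exact: scale_lin.
move: a b; apply: (eigen_ind hM) => [b|c a a' ha ha' b|D1 a aD].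
- exists 0; split; [exact: sph_homog0|move=> x x0].
  by rewrite sph_eval0 // (two_pt_part0l hCC x0).
- by apply: comb (ha b) (ha' b) => x x0; exact: (part_linl x0).
apply: (eigen_ind hM) => [|c b b' hb hb'|D2 b bD].
- exists 0; split; [exact: sph_homog0|move=> x x0].
  by rewrite sph_eval0 // (two_pt_part0r hCC x0).
- by apply: comb hb hb' => x x0; exact: (part_linr x0).
have [q qh qe] := two_pt_homog_exists hCC (D1 + D2 + lambda) aD bD.
exists q; split; first by move: qh; congr sph_homog; ring.
by move=> x x0; rewrite qe // (two_pt_part_eig hCC x0 _ aD bD).
Qed.

(** The element exists by [two_pt_part_exists] and is unique by
    [sph_eval_inj]. *)
Definition vertex_op (a b : H) (lambda : R) : sph R d H :=
  xget 0 [set q | sph_homog lambda q /\ forall x, x != 0 -> sph_eval x q = y x lambda a b].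
Local Notation Y := vertex_op.

Lemma vertex_opP a b lambda : sph_homog lambda (Y a b lambda) /\
  forall x, x != 0 -> sph_eval x (Y a b lambda) = y x lambda a b.
Proof.
exact: (@xgetPex _ 0 [set q | sph_homog lambda q /\
  forall x, x != 0 -> sph_eval x q = y x lambda a b] (two_pt_part_exists a b lambda)).
Qed.
Lemma vertex_op_homog a b lambda : sph_homog lambda (Y a b lambda).
Proof. by case: (vertex_opP a b lambda). Qed.
Lemma vertex_op_eval x a b lambda : x != 0 -> sph_eval x (Y a b lambda) = y x lambda a b.
Proof. by case: (vertex_opP a b lambda) => _; apply. Qed.

Lemma vertex_op_linl (c : R[i]) a a' b lambda :
  Y (c *: a + a') b lambda = sph_map ( *:%R c) (Y a b lambda) + Y a' b lambda.
Proof.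
apply: (sph_eval_eq (lambda := lambda) d_gt0); first exact: vertex_op_homog.
  apply: sph_homogD; last exact: vertex_op_homog.
  by apply: sph_homog_map; [exact: scaleD|exact: vertex_op_homog].
move=> x x0; rewrite sph_evalD // sph_eval_map ?vertex_op_eval ?part_linl // => k v w.
exact: scale_lin.
Qed.

Lemma vertex_op_linr (c : R[i]) a b b' lambda :
  Y a (c *: b + b') lambda = sph_map ( *:%R c) (Y a b lambda) + Y a b' lambda.
Proof.
apply: (sph_eval_eq (lambda := lambda) d_gt0); first exact: vertex_op_homog.
  apply: sph_homogD; last exact: vertex_op_homog.
  by apply: sph_homog_map; [exact: scaleD|exact: vertex_op_homog].
move=> x x0; rewrite sph_evalD // sph_eval_map ?vertex_op_eval ?part_linr // => k v w.
exact: scale_lin.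
Qed.

Lemma vertex_op_eq0 a b lambda : (forall x, x != 0 -> y x lambda a b = 0) -> Y a b lambda = 0.
Proof.
move=> h; apply: (sph_eval_inj d_gt0 (vertex_op_homog a b lambda)) => x x0.
by rewrite vertex_op_eval // h.
Qed.

(** For eigenvectors a nonzero term of degree lambda forces D1 + D2 + lambda
    to belong to the spectrum of D, which is finite below any bound. *)
Lemma vertex_op_laurent a b : is_laurent (Y a b).
Proof.
split=> [lambda|M]; first exact: vertex_op_homog.
have comb (f g h : R -> sph R d H) : (forall l, f l = 0 -> g l = 0 -> h l = 0) ->
    finite_set [set l | l < M /\ f l != 0] -> finite_set [set l | l < M /\ g l != 0] ->
    finite_set [set l | l < M /\ h l != 0].
  move=> hE ff gf; apply: (sub_finite_set _ (_ : finite_set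
    ([set l | l < M /\ f l != 0] `|` [set l | l < M /\ g l != 0]))).
    move=> l /= [lM hl]; have [f0|?] := eqVneq (f l) 0; last by left.
    have [g0|?] := eqVneq (g l) 0; last by right.
    by move: hl; rewrite hE ?eqxx.
  by rewrite finite_setU.
have zero (f : R -> sph R d H) : (forall l, f l = 0) -> finite_set [set l | l < M /\ f l != 0].
  by move=> f0; apply: (sub_finite_set _ (finite_set0 R)) => l /= [_]; rewrite f0 eqxx.
move: a b; apply: (eigen_ind hM) => [b|c a a' ha ha' b|D1 a aD].
- by apply: zero => l; apply: vertex_op_eq0 => x x0; rewrite (two_pt_part0l hCC x0).
- apply: comb (ha b) (ha' b) => l f0 g0; rewrite vertex_op_linl f0 g0 sph_map0 ?addr0 //.
  exact: scaleD.
apply: (eigen_ind hM) => [|c b b' hb hb'|D2 b bD].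
- by apply: zero => l; apply: vertex_op_eq0 => x x0; rewrite (two_pt_part0r hCC x0).
- apply: comb hb hb' => l f0 g0; rewrite vertex_op_linr f0 g0 sph_map0 ?addr0 //.
  exact: scaleD.
apply: (sub_finite_set _ (finite_image (fun D => D - (D1 + D2))
  (spectrum_finite hM (D1 + D2 + M)))) => l /= [lM Yl].
exists (D1 + D2 + l); last by ring.
split; first by rewrite lerD2l ltW.
apply: contrapT => none; move/eqP: Yl; apply; apply: vertex_op_eq0 => x x0.
rewrite (two_pt_part_eig hCC x0 _ aD bD); apply/eqP/negPn/negP => w0; apply: none.
by exists (W x a b (D1 + D2 + l)) => //; exact: (two_pt_in hCC x0).
Qed.

Lemma vertex_op_map : is_vertex_map Y.
Proof.
split=> [|c a a' b|c a b b']; first exact: vertex_op_laurent.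
  by apply/funext => l; exact: vertex_op_linl.
by apply/funext => l; exact: vertex_op_linr.
Qed.

Lemma linear_mor (u : {scalar H}) (c : R[i]) v w : u (c *: v + w) = c *: (u v : R[i]^o) + u w.
Proof. by rewrite linearP. Qed.

Lemma vertex_op_two_point : is_two_point act YY Y.
Proof.
split=> [|D0 D1 D2 u a b uD aD bD|u a b x hu x0]; first exact: vertex_op_map.
  apply: in_sphere_poly_homog.
    apply: sph_homog_map; last exact: vertex_op_homog.
    by move=> v w; rewrite linearD.
  move=> l ls; apply: (sph_eval_inj (lambda := l) d_gt0).
    apply: sph_homog_map; last exact: vertex_op_homog.
    by move=> v w; rewrite linearD.
  move=> x x0; rewrite /ser_map sph_eval_map //; last exact: linear_mor.
  rewrite vertex_op_eval // (two_pt_part_eig hCC x0 _ aD bD).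
  apply: uD (two_pt_in hCC x0 _ _ _).
  by apply: contra_neq ls => <-; ring.
have [_ e] := sum_two_pt_part hCC x0 a b (linear_mor u) hu; apply: etrans e.
apply: eq_fsbigr => l _; rewrite /ser_map sph_eval_map ?vertex_op_eval //.
exact: linear_mor.
Qed.

(** Both sides are bilinear.  For eigenvectors and a functional of weight D0,
    only the degree D0 - D1 - D2 contributes to either side, so that the sum
    over all degrees that is prescribed determines this single term. *)
Lemma two_point_eval Y' x a b l : x != 0 -> is_two_point act YY Y' ->
  sph_eval x (Y' a b l) = y x l a b.
Proof.
move=> x0 [[hl linl linr] hs hW].
have el c v w b' : sph_eval x (Y' (c *: v + w) b' l)
    = c *: sph_eval x (Y' v b' l) + sph_eval x (Y' w b' l).
  rewrite linl [(_ + _) l]/(_ l + _ l) sph_evalD // sph_eval_map // => *; exact: scale_lin.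
have er c v w b' : sph_eval x (Y' b' (c *: v + w) l)
    = c *: sph_eval x (Y' b' v l) + sph_eval x (Y' b' w l).
  rewrite linr [(_ + _) l]/(_ l + _ l) sph_evalD // sph_eval_map // => *; exact: scale_lin.
have el0 b' : sph_eval x (Y' 0 b' l) = 0.
  by have := el (-1) 0 0 b'; rewrite scaler0 addr0 scaleN1r addNr.
have er0 b' : sph_eval x (Y' b' 0 l) = 0.
  by have := er (-1) 0 0 b'; rewrite scaler0 addr0 scaleN1r addNr.
move: a b; apply: (eigen_ind hM) => [b|c a a' ha ha' b|D1 a aD].
- by rewrite el0 (two_pt_part0l hCC x0).
- by rewrite el ha ha' (part_linl x0).
apply: (eigen_ind hM) => [|c b b' hb hb'|D2 b bD].
- by rewrite er0 (two_pt_part0r hCC x0).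
- by rewrite er hb hb' (part_linr x0).
rewrite (two_pt_part_eig hCC x0 _ aD bD).
apply: (hdual_eq hM) => D0 u uD.
rewrite -(sph_eval_map _ x0 (linear_mor u)).
have [p hp] := hs _ _ _ _ _ _ uD aD bD.
have [ls|ls] := eqVneq l (D0 - D1 - D2); last first.
  have := hp l; rewrite (negbTE ls) /ser_map => ->; rewrite sph_eval0 //.
  apply/esym; apply: uD (two_pt_in hCC x0 _ _ _).
  by apply: contra_neq ls => <-; ring.
have := hW u a b x (hdual_hvee uD) x0; rewrite (hpair_hdual uD (two_pt_hbar hCC x0 a b)).
rewrite (fsbig_only (i := l)); last first.
  by move=> k kl; rewrite hp -ls (negbTE kl) sph_eval0.
rewrite /ser_map => ->; congr (u (W x a b _)); rewrite ls; ring.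
Qed.

Lemma two_point_unique Y' : is_two_point act YY Y' -> Y' = Y.
Proof.
move=> hY; apply/funext => a; apply/funext => b; apply/funext => l.
apply: (sph_eval_eq (lambda := l) d_gt0) => [||x x0]; last first.
- by rewrite (two_point_eval _ _ _ x0 hY) vertex_op_eval.
- exact: vertex_op_homog.
by case: hY => -[hl _ _] _ _; case: (hl a b).
Qed.

Lemma ser_eval_vertex_op x a b : x != 0 -> ser_eval act x (Y a b) = W x a b.
Proof.
move=> x0; apply/funext => D.
have prL (c : R[i]) v w := pr_lin hM D c v w.
transitivity (\sum_(l \in [set: R]) prj D (y x l a b)).
  by apply: eq_fsbigr => l _; rewrite sph_eval_map // vertex_op_eval.
have [|_ ->] := sum_two_pt_part hCC x0 a b prL.
  apply: (sub_finite_set _ (finite_set1 D)) => E /= [v Ev].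
  by rewrite (pr_eig hM _ Ev); case: (D =P E) => [->//|_]; rewrite eqxx.
rewrite (fsbig_only (i := D)) => [|E ED].
  by rewrite (pr_eig hM _ (two_pt_in hCC x0 a b D)) eqxx.
by rewrite (pr_eig hM _ (two_pt_in hCC x0 a b E)) eq_sym (negbTE ED).
Qed.
End Clauses.

(** * Formal and analytic derivatives of spherical polynomials *)

Section EvalDerivative.
Variables (R : realType) (d : nat).
Implicit Types x : 'rV[R]_d.

Lemma cderive_near (f g : R -> R[i]) t l : {near t, f =1 g} ->
  is_cderive f t l -> is_cderive g t l.
Proof.
move=> fg [fr fi]; split.
  apply: near_eq_is_derive fr.
  by apply: filterS fg => s ->.
apply: near_eq_is_derive fi.
by apply: filterS fg => s ->.
Qed.

Lemma line_neq0 x (mu : 'I_d) : x != 0 ->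
  \forall t \near (0 : R), x + t *: delta_mx 0 mu != 0.
Proof.
move=> x0; have e0 := enorm_gt0 x0.
exists (enorm x); first by []; move=> t; rewrite /= sub0r normrN => te.
apply: contraTneq te => /eqP; rewrite addr_eq0 => /eqP ->; rewrite enormN enormZ.
have -> : enorm (delta_mx 0 mu : 'rV[R]_d) = 1.
  rewrite /enorm (bigD1 mu) //= !mxE !eqxx expr1n big1 ?addr0 ?sqrtr1 // => nu /negbTE h.
  by rewrite mxE h andbF expr0n.
by rewrite mulr1 -leNgt.
Qed.

Lemma derive_prod_expr (I : finType) (f : I -> R -> R) (f' : I -> R) (e : I -> nat) (t : R) :
  (forall i, is_derive t 1 (f i) (f' i)) ->
  is_derive t 1 (fun s => \prod_i f i s ^+ e i)
    (\sum_i (e i)%:R * f i t ^+ (e i).-1 * f' i * \prod_(j | j != i) f j t ^+ e j).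
Proof.
move=> fd.
have fe i : is_derive t 1 (fun s => f i s ^+ e i) ((e i)%:R * f i t ^+ (e i).-1 * f' i).
  apply: is_derive_ext (is_deriveX (e i) (fd i)) _ _ => [s|//].
  by rewrite exprfctE.
have gen (r : seq I) : uniq r -> is_derive t 1 (fun s => \prod_(i <- r) f i s ^+ e i)
    (\sum_(i <- r) (e i)%:R * f i t ^+ (e i).-1 * f' i * \prod_(j <- r | j != i) f j t ^+ e j).
  elim: r => [_|i r IH /= /andP[ir ur]].
    rewrite big_nil; apply: is_derive_ext (is_derive_cst (1 : R) t (1 : R)) _ _ => // s.
    by rewrite big_nil.
  apply: is_derive_ext (is_deriveM (fe i) (IH ur)) _ _ => [s|].
    by rewrite big_cons.
  rewrite big_cons big_cons eqxx /= /GRing.scale /= addrC; congr (_ + _).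
    rewrite mulrC; congr (_ * _); rewrite big_seq [RHS]big_seq_cond.
    rewrite [RHS](eq_bigl (fun j => j \in r)) // => j.
    by case: (boolP (j \in r)) => //= jr; apply: contraNneq ir => <-.
  rewrite mulr_sumr big_seq [RHS]big_seq; apply: eq_bigr => j jr.
  rewrite big_cons; have -> : i != j by apply: contraNneq ir => ->.
  by rewrite mulrCA.
have := gen (index_enum I) (index_enum_uniq I); exact.
Qed.

(** |x|^r is differentiated as (x_1^2 + ... + x_d^2)^(r/2). *)
Lemma derive_monomial x (mu : 'I_d) (k : sexp R d) : x != 0 ->
  is_derive (0 : R) 1 (fun t => sexp_eval (x + t *: delta_mx 0 mu) k (enorm (x + t *: delta_mx 0 mu)))
    (sexp_eval x (mexp_dec mu k.1, k.2) (enorm x) *+ k.1 mu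
     + k.2 * sexp_eval x (mexp_inc mu k.1, k.2 - 2%:R) (enorm x)).
Proof.
move=> x0; case: k => alpha r; have e0 := enorm_gt0 x0.
pose z t := x + t *: (delta_mx 0 mu : 'rV[R]_d).
have zd nu : is_derive (0 : R) 1 (fun t => z t 0 nu) ((nu == mu)%:R : R).
  have h1 := is_deriveM (is_derive_id (0 : R) (1 : R))
    (is_derive_cst ((delta_mx 0 mu : 'rV[R]_d) 0 nu) (0 : R) (1 : R)).
  apply: is_derive_ext (is_deriveD (is_derive_cst (x 0 nu) (0 : R) (1 : R)) h1) _ _.
    by move=> s; rewrite !mxE.
  by rewrite /GRing.scale /= !mxE eqxx /=; ring.
have z0 : z 0 = x by rewrite /z scale0r addr0.
pose S t := \sum_nu z t 0 nu ^+ 2.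
have Sd : is_derive (0 : R) 1 S (2 * x 0 mu).
  have h (nu : 'I_d) := is_deriveX 2 (zd nu).
  apply: is_derive_ext (is_derive_sum h) _ _ => [t|].
    by rewrite /S fct_sumE.
  rewrite (bigD1 mu) //= eqxx big1 ?addr0 => [|nu /negbTE ->]; last by rewrite scaler0.
  by rewrite z0 /GRing.scale /= expr1 mulr1 mulr_natl.
have S0 : S 0 = enorm x ^+ 2 by rewrite /S z0 sqr_enorm.
have S_gt0 : 0 < S 0 by rewrite S0 exprn_gt0.
have enE t : enorm (z t) `^ r = S t `^ (r / 2).
  have -> : S t = enorm (z t) `^ 2%:R.
    by rewrite powR_mulrn ?sqrtr_ge0 // sqr_enorm.
  by rewrite -powRrM mulrC divfK ?pnatr_eq0.
have pd : is_derive (0 : R) 1 (fun t => enorm (z t) `^ r) (r * x 0 mu * enorm x `^ (r - 2%:R)).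
  apply: is_derive_ext (is_derive1_comp (is_derive1_powR (r / 2) S_gt0) Sd) _ _ => [t|].
    by rewrite /= enE.
  have -> : S 0 `^ (r / 2 - 1) = enorm x `^ (r - 2%:R).
    by rewrite S0 -powR_mulrn ?ltW // -powRrM; congr (_ `^ _); field.
  by field.
have hm := is_deriveM (derive_prod_expr (fun nu => alpha nu) zd) pd.
apply: is_derive_ext hm _ _ => // .
rewrite /GRing.scale /= z0 addrC /sexp_eval /=; congr (_ + _).
  rewrite (bigD1 mu) //= eqxx mulr1 [X in _ * (_ + X)]big1 ?addr0; last first.
    by move=> nu /negbTE ->; rewrite mulr0 mul0r.
  rewrite mulrC -mulrnAl; congr (_ * _).
  rewrite [in RHS](bigD1 mu) //= ffunE eqxx subn1 -mulrnAl; congr (_ * _).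
    by rewrite ?mulr1 mulr_natl.
  by apply: eq_bigr => nu h; rewrite ffunE eq_sym (negbTE h) subn0.
by have := xpow_inc x mu alpha; rewrite /xpow => ->; ring.
Qed.

(** Evaluation is additive only away from the origin, hence the passage to
    functions that agree near t = 0. *)
Lemma sph_eval_derive x mu (q : sph R d R[i]^o) : x != 0 ->
  is_cderive (fun t => sph_eval (x + t *: delta_mx 0 mu) q) 0 (sph_eval x (sph_d mu q)).
Proof.
move=> x0; have near0 := line_neq0 mu x0.
elim/sph_ind: q => [|p q hp hq|k v].
- apply: (@cderive_near (fun=> 0)).
    by apply: filterS near0 => t t0; rewrite sph_eval0.
  by rewrite (morph_add0 (@sph_dD R d _ mu)) sph_eval0 //; exact: cderive_cst.
- apply: (@cderive_near (fun t => sph_eval (x + t *: delta_mx 0 mu) p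
      + sph_eval (x + t *: delta_mx 0 mu) q)).
    by apply: filterS near0 => t t0; rewrite sph_evalD.
  by rewrite sph_dD sph_evalD //; exact: cderiveD.
apply: (@cderive_near (fun t =>
    v * (sexp_eval (x + t *: delta_mx 0 mu) k (enorm (x + t *: delta_mx 0 mu)))%:C)).
  by apply: filterS near0 => t t0; rewrite sph_eval_mono // mulrC.
rewrite sph_d_mono sph_evalD // !sph_eval_mono //.
apply: cderive_eq (cderiveZ v (cderive_real (derive_monomial mu k x0))).
rewrite rmorphD rmorphMn mulrDr; congr (_ + _).
  by rewrite -[RHS]/((sexp_eval x (mexp_dec mu k.1, k.2) (enorm x))%:C * (v *+ k.1 mu)) !mulrnAr [in LHS]mulrC.
rewrite (rmorphM (real_complex R) k.2) /= -[RHS]/(_ * (_ * v)); ring.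
Qed.

Lemma sph_map_d (V W : lmodType R[i]) (T : V -> W) mu (q : sph R d V) :
  (forall (c : R[i]) v w, T (c *: v + w) = c *: T v + T w) ->
  sph_map T (sph_d mu q) = sph_d mu (sph_map T q).
Proof.
move=> TL.
have TD : {morph T : v w / v + w} by move=> v w; have := TL 1 v w; rewrite !scale1r.
have TZ c v : T (c *: v) = c *: T v.
  by have := TL c v 0; rewrite addr0 (morph_add0 TD) addr0.
elim/sph_ind: q => [|p q hp hq|k v].
- by rewrite sph_map0 // !(morph_add0 (@sph_dD R d _ mu)) sph_map0.
- by rewrite sph_dD !sph_mapD // sph_dD hp hq.
rewrite sph_map_mono // !sph_d_mono sph_mapD // !sph_map_mono // TZ.
congr (sph_mono _ _ + _); elim: (k.1 mu) => [|n IH]; first by rewrite !mulr0n (morph_add0 TD).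
by rewrite !mulrS TD IH.
Qed.
End EvalDerivative.

(** * Covariance of the vertex operator *)

Section Covariance.
Variables (R : realType) (d : nat).
Hypothesis d_gt0 : (0 < d)%N.
Variables (H : lmodType R[i]) (act : so R d -> H -> H).
Variables (YY : forall n, 'M[R]_(n, d) -> ('I_n -> H) -> R -> H) (vac : H).
Hypothesis hCC : CC_system YY act vac.
Let hM := cc_compact hCC.
Local Notation eig := (eigsp act).
Local Notation W x := (two_pt YY x 0).
Local Notation y := (two_pt_part act YY).
Local Notation Y := (vertex_op act YY).
Implicit Types x : 'rV[R]_d.

(** Both sides are homogeneous of degree l.  The formal derivative has the
    analytic derivative as its values, and this is given by translation
    invariance of the two-point function. *)
Lemma vertex_op_translation mu a b : Y (act (so_P R mu) a) b = ser_d mu (Y a b).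
Proof.
apply/funext => l; rewrite /ser_d.
apply: (sph_eval_eq (lambda := l) d_gt0) => [||x x0].
- exact: (vertex_op_homog hCC).
- by apply: sph_homog_d; exact: (vertex_op_homog hCC).
rewrite (vertex_op_eval hCC) //.
have dlin : forall (c : R[i]) a a' b, sph_d mu (Y (c *: a + a') b (l + 1))
    = sph_map ( *:%R c) (sph_d mu (Y a b (l + 1))) + sph_d mu (Y a' b (l + 1)).
  move=> c v w b'; rewrite (vertex_op_linl d_gt0 hCC) sph_dD sph_map_d // => *.
  exact: scale_lin.
have dlinr : forall (c : R[i]) a b b', sph_d mu (Y a (c *: b + b') (l + 1))
    = sph_map ( *:%R c) (sph_d mu (Y a b (l + 1))) + sph_d mu (Y a b' (l + 1)).
  move=> c v w b'; rewrite (vertex_op_linr d_gt0 hCC) sph_dD sph_map_d // => *.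
  exact: scale_lin.
have el c v w b' : sph_eval x (sph_d mu (Y (c *: v + w) b' (l + 1)))
    = c *: sph_eval x (sph_d mu (Y v b' (l + 1))) + sph_eval x (sph_d mu (Y w b' (l + 1))).
  by rewrite dlin sph_evalD // sph_eval_map // => *; exact: scale_lin.
have er c v w b' : sph_eval x (sph_d mu (Y b' (c *: v + w) (l + 1)))
    = c *: sph_eval x (sph_d mu (Y b' v (l + 1))) + sph_eval x (sph_d mu (Y b' w (l + 1))).
  by rewrite dlinr sph_evalD // sph_eval_map // => *; exact: scale_lin.
have el0 b' : sph_eval x (sph_d mu (Y 0 b' (l + 1))) = 0.
  by have := el (-1) 0 0 b'; rewrite scaler0 addr0 scaleN1r addNr.
have er0 b' : sph_eval x (sph_d mu (Y b' 0 (l + 1))) = 0.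
  by have := er (-1) 0 0 b'; rewrite scaler0 addr0 scaleN1r addNr.
move: a b; apply: (eigen_ind hM) => [b|c a a' ha ha' b|D1 a aD].
- by rewrite el0 (act0 hM) (two_pt_part0l hCC x0).
- by rewrite el (act_lin hM) (two_pt_part_linl hCC x0) ha ha'.
apply: (eigen_ind hM) => [|c b b' hb hb'|D2 b bD].
- by rewrite er0 (two_pt_part0r hCC x0).
- by rewrite er (two_pt_part_linr hCC x0) hb hb'.
have PaD := act_eig hM (weight_P R mu) aD.
rewrite (two_pt_part_eig hCC x0 _ PaD bD).
apply: (hdual_eq hM) => D0 u uD.
have uL := @linear_mor R H u.
rewrite -(sph_eval_map _ x0 uL) sph_map_d //.
have [DE|DE] := eqVneq (D1 + D2 + (l + 1)) D0; last first.
  have -> : sph_map u (Y a b (l + 1)) = 0.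
    apply: (sph_eval_inj (lambda := l + 1) d_gt0).
      by apply: sph_homog_map; [move=> v w; rewrite linearD|exact: (vertex_op_homog hCC)].
    move=> z z0; rewrite sph_eval_map // (vertex_op_eval hCC) // (two_pt_part_eig hCC z0 _ aD bD).
    exact: uD (two_pt_in hCC z0 _ _ _).
  rewrite (morph_add0 (@sph_dD R d _ mu)) sph_eval0 //.
  apply: uD (two_pt_in hCC x0 _ _ _); apply: contra_neq DE => <-; ring.
have h1 := sph_eval_derive mu (sph_map u (Y a b (l + 1))) x0.
apply/esym; apply: cderive_uniq h1 _.
have -> : u (W x (act (so_P R mu) a) b (D1 + 1 + D2 + l))
    = hpair u (W x (act (so_P R mu) a) b).
  rewrite (hpair_hdual uD (two_pt_hbar hCC x0 _ _)); congr (u (W x _ b _)).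
  by rewrite -DE; ring.
apply: (@cderive_near _ (fun t => hpair u (W (x + t *: delta_mx 0 mu) a b))).
  apply: filterS (line_neq0 mu x0) => t t0.
  rewrite sph_eval_map // (vertex_op_eval hCC) // (two_pt_part_eig hCC t0 _ aD bD).
  by rewrite (hpair_hdual uD (two_pt_hbar hCC t0 _ _)) DE.
have z0 (nu : 'I_d) : is_derive (0 : R) (1 : R) (fun s : R => (0 : 'rV[R]_d) 0 nu) ((0 : 'rV[R]_d) 0 nu).
  by rewrite mxE; apply: is_derive_ext (is_derive_cst (0 : R) (0 : R) (1 : R)) _ _ => // s; rewrite mxE.
have zd (nu : 'I_d) : is_derive (0 : R) 1 (fun t : R => (x + t *: delta_mx 0 mu : 'rV[R]_d) 0 nu)
    ((delta_mx 0 mu : 'rV[R]_d) 0 nu).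
  have h2 := is_deriveM (is_derive_id (0 : R) (1 : R))
    (is_derive_cst ((delta_mx 0 mu : 'rV[R]_d) 0 nu) (0 : R) (1 : R)).
  apply: is_derive_ext (is_deriveD (is_derive_cst (x 0 nu) (0 : R) (1 : R)) h2) _ _.
    by move=> s; rewrite !mxE.
  by rewrite /GRing.scale /=; ring.
have x00 : x + 0 *: delta_mx 0 mu != 0 by rewrite scale0r addr0.
apply: cderive_eq (two_pt_chain hCC a b (g1 := fun t => x + t *: delta_mx 0 mu)
  (g2 := fun=> 0) (g2' := 0) (hdual_hvee uD) x00 zd z0).
rewrite scale0r addr0 [X in _ + X]big1 ?addr0; last by move=> nu _; rewrite mxE mul0r.
rewrite (bigD1 mu) //= !mxE !eqxx mul1r big1 ?addr0 // => nu /negbTE h.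
by rewrite mxE h andbF mul0r.
Qed.

Lemma adPs_lin (s : seq 'I_d) (r : R) X Z : adPs s (r *: X + Z) = r *: adPs s X + adPs s Z.
Proof. by elim: s => [|i s IH] //=; rewrite IH brZDr. Qed.

(** The operator form of being a weight vector; unlike the latter, it passes to
    brackets with P by the module axioms alone. *)
Definition shifts (X : so R d) (w : R) := forall D a, eig D a -> eig (D + w) (act X a).

Lemma shifts_br mu X w : shifts X w -> shifts (br (so_P R mu) X) (w + 1).
Proof.
move=> hX D a aD; have [_ _ h] := cm_module hM; rewrite h.
apply: (eigD hM).
  by rewrite addrA; apply: act_eig (weight_P R mu) _ => //; exact: hX.
rewrite -scaleN1r; apply: (eigZ hM); rewrite (addrC w) addrA; apply: hX.
exact: (act_eig hM (weight_P R mu)).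
Qed.

Lemma shifts_adPs (s : seq 'I_d) X w : shifts X w -> shifts (adPs s X) (w + (size s)%:R).
Proof.
move=> hX; elim: s => [|i s IH] /=; first by rewrite addr0.
by rewrite -natr1 addrA; exact: shifts_br.
Qed.

Lemma ser_X_foldr_homog (V : zmodType) (s : seq 'I_d) (f : R -> sph R d V) :
  (forall l, sph_homog l (f l)) ->
  forall l, sph_homog l (foldr (fun rho f => ser_X rho f) f s l).
Proof. by move=> fh; elim: s => [|i s IH] l //=; apply: sph_homog_X; exact: IH. Qed.

Lemma ser_X_foldr_eval (V : lmodType R[i]) (s : seq 'I_d) (f : R -> sph R d V) x l : x != 0 ->
  sph_eval x (foldr (fun rho f => ser_X rho f) f s l) =
  (\prod_(rho <- s) x 0 rho)%:C *: sph_eval x (f (l - (size s)%:R)).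
Proof.
move=> x0; elim: s l => [|i s IH] l /=; first by rewrite big_nil subr0 scale1r.
rewrite /ser_X sph_eval_X // IH big_cons rmorphM scalerA.
by congr (_ *: sph_eval x (f _)); rewrite -natr1; ring.
Qed.

(** The values of Y(tau_x(X) a, x) b in degree l: each factor x_rho raises the
    degree by one. *)
Definition tau_part x (X : so R d) (l : R) (a b : H) : H :=
  \sum_(k < 3) \sum_(s : k.-tuple 'I_d) ((-1) ^+ k / k`!%:R : R[i]) *:
    ((\prod_(rho <- s) x 0 rho)%:C *: y x (l - k%:R) (act (adPs s X) a) b).

Lemma Y_tauE X a b l : Y_tau act Y X a b l =
  \sum_(k < 3) \sum_(s : k.-tuple 'I_d)
    sph_map ( *:%R ((-1) ^+ k / k`!%:R : R[i]))
      (foldr (fun rho f => ser_X rho f) (Y (act (adPs s X) a) b) s l).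
Proof.
rewrite /Y_tau (big_morph (fun f : R -> sph R d H => f l) (id1 := 0) (op1 := +%R)) //.
apply: eq_bigr => k _.
by rewrite (big_morph (fun f : R -> sph R d H => f l) (id1 := 0) (op1 := +%R)).
Qed.

Lemma Y_tau_homog X a b l : sph_homog l (Y_tau act Y X a b l).
Proof.
rewrite Y_tauE; apply: sph_homog_sum => k _; apply: sph_homog_sum => s _.
apply: sph_homog_map; first exact: scaleD.
by apply: ser_X_foldr_homog => l'; exact: (vertex_op_homog hCC).
Qed.

Lemma Y_tau_eval x X a b l : x != 0 -> sph_eval x (Y_tau act Y X a b l) = tau_part x X l a b.
Proof.
move=> x0; rewrite Y_tauE sph_eval_sum //; apply: eq_bigr => k _.
rewrite sph_eval_sum //; apply: eq_bigr => s _.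
rewrite sph_eval_map //; last by move=> *; exact: scale_lin.
by rewrite ser_X_foldr_eval // size_tuple (vertex_op_eval hCC).
Qed.

Section PartCovariance.
Variable x : 'rV[R]_d.
Hypothesis x0 : x != 0.

Lemma tau_part_linX r X Z l a b :
  tau_part x (r *: X + Z) l a b = r%:C *: tau_part x X l a b + tau_part x Z l a b.
Proof.
rewrite /tau_part scaler_sumr -big_split; apply: eq_bigr => k _ /=.
rewrite scaler_sumr -big_split; apply: eq_bigr => s _ /=.
by rewrite adPs_lin (act_linl hM) (two_pt_part_linl hCC x0) !scale_lin.
Qed.

Lemma tau_part_lina X (c : R[i]) l a a' b :
  tau_part x X l (c *: a + a') b = c *: tau_part x X l a b + tau_part x X l a' b.
Proof.
rewrite /tau_part scaler_sumr -big_split; apply: eq_bigr => k _ /=.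
rewrite scaler_sumr -big_split; apply: eq_bigr => s _ /=.
by rewrite (act_lin hM) (two_pt_part_linl hCC x0) !scale_lin.
Qed.

Lemma tau_part_linb X (c : R[i]) l a b b' :
  tau_part x X l a (c *: b + b') = c *: tau_part x X l a b + tau_part x X l a b'.
Proof.
rewrite /tau_part scaler_sumr -big_split; apply: eq_bigr => k _ /=.
rewrite scaler_sumr -big_split; apply: eq_bigr => s _ /=.
by rewrite (two_pt_part_linr hCC x0) !scale_lin.
Qed.

(** On eigenvectors, all the terms are components of one and the same weight of
    the covariance identity of the two-point function. *)
Lemma part_covariance_weight X w l a b : weight X w ->
  act X (y x l a b) = y x l a (act X b) + tau_part x X l a b.
Proof.
move=> Xw; move: a b; apply: (eigen_ind hM) => [b|c a a' ha ha' b|D1 a aD].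
- rewrite !(two_pt_part0l hCC x0) (act0 hM) add0r /tau_part big1 // => k _.
  by rewrite big1 // => s _; rewrite (act0 hM) (two_pt_part0l hCC x0) !scaler0.
- rewrite !(two_pt_part_linl hCC x0) (act_lin hM) tau_part_lina ha ha' scalerDr -!addrA.
  by congr (_ + _); rewrite addrCA.
apply: (eigen_ind hM) => [|c b b' hb hb'|D2 b bD].
- rewrite (act0 hM) !(two_pt_part0r hCC x0) (act0 hM) add0r /tau_part big1 // => k _.
  by rewrite big1 // => s _; rewrite (two_pt_part0r hCC x0) !scaler0.
- rewrite (act_lin hM) !(two_pt_part_linr hCC x0) (act_lin hM) tau_part_linb hb hb' scalerDr -!addrA.
  by congr (_ + _); rewrite addrCA.
have hX : shifts X w by move=> D v; exact: (act_eig hM).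
rewrite (two_pt_part_eig hCC x0 _ aD bD) (two_pt_part_eig hCC x0 _ aD (hX _ _ bD)).
have := two_pt_covariance hCC x0 X a b (D1 + (D2 + w) + l).
rewrite (bar_act_weight hM _ Xw (two_pt_hbar hCC x0 a b)) tau0.
have -> : D1 + (D2 + w) + l - w = D1 + D2 + l by ring.
move=> ->; rewrite addrC; congr (_ + _); rewrite /tau (act_suml hM) (two_pt_suml hCC x0).
apply: eq_bigr => k _; rewrite (act_suml hM) (two_pt_suml hCC x0); apply: eq_bigr => s _.
rewrite (actZl hM) (two_ptZl hCC x0) scalerA; congr (_ *: _).
  by rewrite rmorphM; congr (_ * _); rewrite rmorphM rmorphXn rmorphN1 fmorphV rmorph_nat.
have := shifts_adPs s hX aD; rewrite size_tuple => aD'.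
by rewrite (two_pt_part_eig hCC x0 _ aD' bD); congr (W x _ _ _); ring.
Qed.

Lemma part_covariance X l a b : act X (y x l a b) = y x l a (act X b) + tau_part x X l a b.
Proof.
move: X; apply: so_ind => [|r X Z hX hZ||mu|mu|mu nu].
- rewrite !(act0l hM) (two_pt_part0r hCC x0) add0r /tau_part.
  have z (s : seq 'I_d) : adPs s (0 : so R d) = 0 by elim: s => //= i s ->; rewrite br0r.
  by rewrite big1 // => k _; rewrite big1 // => s _; rewrite z (act0l hM) (two_pt_part0l hCC x0) !scaler0.
- rewrite !(act_linl hM) (two_pt_part_linr hCC x0) tau_part_linX hX hZ scalerDr -!addrA.
  by congr (_ + _); rewrite addrCA.
- exact: part_covariance_weight (weight_D R d).
- exact: part_covariance_weight (weight_P R mu).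
- exact: part_covariance_weight (weight_K R mu).
- exact: part_covariance_weight (weight_J R mu nu).
Qed.
End PartCovariance.

Lemma vertex_op_covariant : covariant_vertex_operator act Y.
Proof.
split; [exact: (vertex_op_map d_gt0 hCC)|exact: vertex_op_translation|move=> X a b].
apply/funext => l; rewrite [RHS]/(_ l + _ l) /ser_map.
apply: (sph_eval_eq (lambda := l) d_gt0) => [||x x0].
- by apply: sph_homog_map; [exact: (actD hM)|exact: (vertex_op_homog hCC)].
- by apply: sph_homogD; [exact: (vertex_op_homog hCC)|exact: Y_tau_homog].
rewrite sph_evalD // sph_eval_map //; last by move=> c v w; rewrite (act_lin hM).
by rewrite !(vertex_op_eval hCC) // Y_tau_eval // part_covariance.
Qed.
End Covariance.

(** * Moving the second point *)

Section Taylor.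
Variable R : realType.

Lemma derive_exp_coef (k : nat) (t : R) :
  is_derive t (1 : R) (fun s : R => s ^+ k.+1 / k.+1`!%:R) (t ^+ k / k`!%:R).
Proof.
have h := is_deriveM (is_deriveX k.+1 (is_derive_id t (1 : R)))
  (is_derive_cst ((k.+1)`!%:R^-1 : R) t (1 : R)).
apply: is_derive_ext h _ _ => [s|]; first by rewrite exprfctE.
rewrite /GRing.scale /= factS natrM.
have k1 : (k.+1%:R : R) != 0 by rewrite pnatr_eq0.
have kf : (k`!%:R : R) != 0 by rewrite pnatr_eq0 -lt0n fact_gt0.
move: (k.+1%:R : R) (k`!%:R : R) k1 kf => p q p0 q0.
by field; rewrite p0 q0.
Qed.

(** Repeated integration from 0, starting from g N = 0. *)
Lemma taylor_nilpotent (N : nat) (g : nat -> R -> R[i]) :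
  (forall k t, is_cderive (g k) t (g k.+1 t)) -> (forall t, g N t = 0) ->
  forall t, g 0 t = \sum_(k < N) (t ^+ k / k`!%:R)%:C * g k 0.
Proof.
elim: N g => [|N IH] g gd gN t; first by rewrite big_ord0 gN.
have {}IH := IH (fun k => g k.+1) (fun k t => gd k.+1 t) gN.
pose h s := g 0 s + (-1) * \sum_(k < N.+1) (s ^+ k / k`!%:R)%:C * g k 0.
have hd s : is_cderive h s 0.
  rewrite (_ : 0 = g 1 s + (-1) * (0 + \sum_(k < N) g k.+1 0 * (s ^+ k / k`!%:R)%:C)).
    apply: cderiveD (gd 0 s) _; apply: cderiveZ.
    apply: (cderive_ext (f := fun s => (g 0 0 : R[i]) +
        \sum_(k < N) g k.+1 0 * (s ^+ k.+1 / k.+1`!%:R)%:C)).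
      move=> s'; rewrite big_ord_recl /= expr0 fact0 divr1 mul1r; congr (_ + _).
      by apply: eq_bigr => k _; rewrite mulrC.
    apply: cderiveD; first exact: cderive_cst.
    apply: cderive_sum => k _; apply: cderiveZ; apply: cderive_real.
    exact: derive_exp_coef.
  rewrite IH add0r mulN1r; apply/esym/eqP; rewrite subr_eq0; apply/eqP.
  by apply: eq_bigr => k _; rewrite mulrC.
have h0 : h 0 = 0.
  rewrite /h big_ord_recl big1 => [|k _]; last by rewrite expr0n mul0r mul0r.
  by rewrite expr0 fact0 divr1 mul1r addr0 mulN1r subrr.
by have := cderive0_cst hd t 0; rewrite h0 /h mulN1r => /eqP; rewrite subr_eq0 => /eqP.
Qed.
End Taylor.

Section Exponential.
Variables (R : realType) (d : nat) (H : lmodType R[i]) (act : so R d -> H -> H).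
Variables (YY : forall n, 'M[R]_(n, d) -> ('I_n -> H) -> R -> H) (vac : H).
Hypothesis hCC : CC_system YY act vac.
Let hM := cc_compact hCC.
Local Notation eig := (eigsp act).

(** The spectrum below D is finite, so it contains only finitely many of the
    numbers D - n. *)
Lemma eig_lower_bound D : exists N, forall n v, (N <= n)%N -> eig (D - n%:R) v -> v = 0.
Proof.
have sf := spectrum_finite hM D.
pose S := fset_set [set E | E <= D /\ exists2 v, eig E v & v != 0].
exists (Num.bound (\sum_(E <- S) `|D - E|)) => n v Nn vD.
apply: contrapT => /eqP v0.
have nS : D - n%:R \in S.
  rewrite in_fset_set // inE /=; split; last by exists v.
  by rewrite gerBl.
have : n%:R <= \sum_(E <- S) `|D - E|.
  have nE : `|D - (D - n%:R)| = n%:R by rewrite opprB addrC subrK ger0_norm.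
  rewrite (big_fsetD1 _ nS) /= nE lerDl.
  by apply: sumr_ge0 => E _.
apply/negP; rewrite -ltNge.
have := archi_boundP (_ : 0 <= \sum_(E <- S) `|D - E|).
rewrite sumr_ge0 => [/(_ isT)|E _ //] h; apply: lt_le_trans h _.
by rewrite ler_nat.
Qed.

Section Flow.
Variables (x1 x2 : 'rV[R]_d) (a b : H).
Hypothesis x12 : x1 != x2.
Let X : so R d := \sum_rho x2 0 rho *: so_P R rho.
Let v s := two_pt YY (x1 - x2 + s *: x2) (s *: x2) a b.

Let X1 : weight X 1.
Proof. by apply: weight_sum => rho _; apply: weightZ; exact: weight_P. Qed.

Let neq s : x1 - x2 + s *: x2 != s *: x2.
Proof. by rewrite -subr_eq0 addrK subr_eq0. Qed.

Let v_hbar s : hbar act (v s).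
Proof. exact: (two_pt_hbar hCC (neq s)). Qed.

Let iter_hbar n s : hbar act (iter n (bar_act act X) (v s)).
Proof. by elim: n => [|n IH] //=; exact: (hbar_act_weight hM X1). Qed.

Let tauX x : tau x X = X.
Proof.
rewrite tau_first_order => [|mu nu]; last first.
  rewrite [br (so_P R nu) X](_ : _ = 0) ?br0r // /X.
  rewrite (big_morph (br (so_P R nu)) (id1 := 0) (op1 := +%R)) ?br0r //.
    by rewrite big1 // => rho _; rewrite brZr br_PP scaler0.
  by move=> Z Z'; rewrite brDr.
rewrite big1 ?subr0 // => mu _; rewrite [br _ X](_ : _ = 0) ?scaler0 // /X.
rewrite (big_morph (br (so_P R mu)) (id1 := 0) (op1 := +%R)) ?br0r //.
  by rewrite big1 // => rho _; rewrite brZr br_PP scaler0.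
by move=> Z Z'; rewrite brDr.
Qed.

(** Moving both points along x2 differentiates by X = sum_rho x2_rho P_rho,
    because tau fixes the translations.  For higher derivatives, X is moved to
    the functional: u o X has weight D - 1. *)
Lemma flow_derive n D (u : {scalar H}) s : hdual act D u ->
  is_cderive (fun s => u (iter n (bar_act act X) (v s) D)) s
    (u (iter n.+1 (bar_act act X) (v s) D)).
Proof.
elim: n D u => [|n IH] D u uD.
  have x2d (nu : 'I_d) : is_derive s (1 : R) (fun t : R => (t *: x2) 0 nu) (x2 0 nu).
    have h := is_deriveM (is_derive_id s (1 : R)) (is_derive_cst (x2 0 nu) s (1 : R)).
    apply: is_derive_ext h _ _ => [t|]; first by rewrite mxE.
    by rewrite /GRing.scale /=; ring.
  have x1d (nu : 'I_d) : is_derive s (1 : R) (fun t : R => (x1 - x2 + t *: x2) 0 nu) (x2 0 nu).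
    apply: is_derive_ext (is_deriveD (is_derive_cst ((x1 - x2) 0 nu) s (1 : R)) (x2d nu)) _ _ => [t|].
      by rewrite [RHS]mxE.
    by rewrite add0r.
  have := two_pt_chain hCC a b (hdual_hvee uD) (neq s) x1d x2d.
  move=> h; apply: cderive_eq (cderive_ext _ h) => [|t]; last first.
    by rewrite (hpair_hdual uD (v_hbar t)).
  rewrite /= (two_pt_covariance hCC (neq s)) !tauX linearD /= /X !(act_suml hM).
  rewrite (two_pt_suml hCC (neq s)) (two_pt_sumr hCC (neq s)) !linear_sum /=.
  congr (_ + _); apply: eq_bigr => nu _; rewrite (actZl hM).
    by rewrite (two_ptZl hCC (neq s)) linearZ (hpair_hdual uD (two_pt_hbar hCC (neq s) _ _)).
  by rewrite (two_ptZr hCC (neq s)) linearZ (hpair_hdual uD (two_pt_hbar hCC (neq s) _ _)).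
have [u' u'E] : exists u' : {scalar H}, u' =1 fun w => u (act X w).
  by apply: mk_scalar => c w w'; rewrite (act_lin hM) linearP.
have u'D : hdual act (D - 1) u'.
  move=> E w ED Ew; rewrite u'E; apply: uD (act_eig hM X1 Ew).
  by apply: contra_neq ED => <-; rewrite addrK.
have E m t : u (iter m.+1 (bar_act act X) (v t) D) = u' (iter m (bar_act act X) (v t) (D - 1)).
  by rewrite u'E /= (bar_act_weight hM _ X1 (iter_hbar m t)).
rewrite E; apply: (cderive_ext _ (IH _ _ u'D)) => t.
by rewrite E.
Qed.

(** Components of weight D - n vanish for large n, so that Taylor's formula
    between s = 0 and s = 1 is exact. *)
Lemma two_pt_flow : two_pt YY x1 x2 a b = bar_exp act X (two_pt YY (x1 - x2) 0 a b).
Proof.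
have v0 : v 0 = two_pt YY (x1 - x2) 0 a b by rewrite /v scale0r addr0.
have v1 : v 1 = two_pt YY x1 x2 a b by rewrite /v scale1r subrK.
rewrite -v0 -v1; apply/funext => D; rewrite /bar_exp.
have [N hN] := eig_lower_bound D.
have low n t E : iter n (bar_act act X) (v t) E = iter n (act X) (v t (E - n%:R)).
  elim: n E => [|n IH] E; first by rewrite subr0.
  rewrite iterS (bar_act_weight hM _ X1 (iter_hbar n t)) IH /= -natr1.
  by congr (act X (iter n _ (v t _))); ring.
have zero n t : (N <= n)%N -> iter n (bar_act act X) (v t) D = 0.
  move=> Nn; rewrite low (hN n _ Nn (v_hbar t (D - n%:R))).
  by elim: n {Nn} => //= n ->; rewrite (act0 hM).
have -> : \sum_(k \in [set: nat]) (k`!%:R^-1 : R[i]) *: iter k (bar_act act X) (v 0) D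
    = \sum_(k < N) (k`!%:R^-1 : R[i]) *: iter k (bar_act act X) (v 0) D.
  rewrite (fsbig_ord _ _ (fun k => (k`!%:R^-1 : R[i]) *: iter k (bar_act act X) (v 0) D)).
  apply/esym/fsbig_widen => // k [_ /= kN]; rewrite /= zero ?scaler0 //.
  by rewrite leqNgt; apply/negP.
apply: (hdual_eq hM) => E u uE.
have [ED|ED] := eqVneq E D; last first.
  rewrite (uE _ _ _ (v_hbar 1 D)) 1?eq_sym // linear_sum /= big1 // => k _.
  by rewrite linearZ /= (uE _ _ _ (iter_hbar k 0 D)) ?mulr0 // eq_sym.
subst E; have gN t : u (iter N (bar_act act X) (v t) D) = 0 by rewrite zero // linear0.
have := taylor_nilpotent (g := fun k s => u (iter k (bar_act act X) (v s) D))
  (fun k t => flow_derive k t uE) gN 1.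
move=> /= ->; rewrite linear_sum; apply: eq_bigr => k _; rewrite linearZ /= expr1n mul1r.
by rewrite fmorphV rmorph_nat.
Qed.
End Flow.
End Exponential.

(** * Existence, uniqueness and covariance of the vertex operator *)

Theorem proposition2p9 (R : realType) (d : nat) (hd : (2 <= d)%N)
    (H : lmodType R[i]) (act : so R d -> H -> H)
    (YY : forall n, 'M[R]_(n, d) -> ('I_n -> H) -> R -> H) (vac : H)
    (hCC : CC_system YY act vac) :
  exists Y : H -> H -> R -> sph R d H,
  [/\ is_two_point act YY Y,
      forall Y', is_two_point act YY Y' -> Y' = Y,
      covariant_vertex_operator act Y
    & forall a b (x1 x2 : 'rV[R]_d), x1 != x2 ->
        YY _ (col_mx x1 x2) (pair2 a b)
        = bar_exp act (\sum_rho x2 0 rho *: so_P R rho)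
            (ser_eval act (x1 - x2) (Y a b))].
Proof.
have d_gt0 : (0 < d)%N by exact: leq_trans hd.
exists (vertex_op act YY); split.
- exact: (vertex_op_two_point d_gt0 hCC).
- by move=> Y'; exact: (two_point_unique d_gt0 hCC).
- exact: (vertex_op_covariant d_gt0 hCC).
move=> a b x1 x2 x12; rewrite (ser_eval_vertex_op hCC) ?subr_eq0 //.
exact: (two_pt_flow hCC).
Qed.
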